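(* There exist real analytic Riemannian metrics on the 2-torus which are arbitrarily close to Liouville metrics, and different from them, and non-zero real analytic magnetic fields, such that the corresponding magnetic geodesic flows on the energy level $\{H=\tfrac12\}$ have a first integral that is polynomial in momenta of degree two. Explicitly: there exists a real analytic Liouville metric $ds_0^2$ on $\mathbb{T}^2$ such that every $C^\infty$-neighbourhood of $ds_0^2$ contains a real analytic Riemannian metric $ds^2=g_{ij}dx^idx^j$ on $\mathbb{T}^2$ which is not a Liouville metric, for which there is a real analytic magnetic field $\Omega\,dx^1\wedge dx^2$ on $\mathbb{T}^2$, $\Omega\not\equiv 0$, such that the magnetic geodesic flow of $(ds^2,\Omega)$ has, on the energy level $\{H=\tfrac12\}$, a first integral $F$ that is polynomial of degree two in the momenta $p_1,p_2$.
   Context: Magnetic geodesic flow: given a Riemannian metric $ds^2=g_{ij}dx^idx^j$ on the 2-torus $\mathbb{T}^2$ and a 2-form (magnetic field) $\Omega(x^1,x^2)\,dx^1\wedge dx^2$ on $\mathbb{T}^2$, it is the Hamiltonian system on $T^*\mathbb{T}^2$, $\dot x^j=\{x^j,H\}_{mg}$, $\dot p_j=\{p_j,H\}_{mg}$ $(j=1,2)$, with $H=\frac12 g^{ij}p_ip_j$ and Poisson bracket $$\{F,H\}_{mg}=\sum_{i=1}^2\left(\frac{\partial F}{\partial x^i}\frac{\partial H}{\partial p_i}-\frac{\partial F}{\partial p_i}\frac{\partial H}{\partial x^i}\right)+\Omega(x^1,x^2)\left(\frac{\partial F}{\partial p_1}\frac{\partial H}{\partial p_2}-\frac{\partial F}{\partial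 p_2}\frac{\partial H}{\partial p_1}\right).$$ Liouville metric: a Riemannian metric on $\mathbb{T}^2$ which in some coordinates (global coordinates on the universal cover) has the form $(\Lambda_1(x^1)+\Lambda_2(x^2))((dx^1)^2+(dx^2)^2)$. First integral on the energy level $\{H=\frac12\}$, polynomial in momenta of degree two: a smooth function $F$ on $T^*\mathbb{T}^2$ which is a (not necessarily homogeneous) polynomial of degree two in $p_1,p_2$ with coefficients depending on $x^1,x^2$, such that $\{F,H\}_{mg}=0$ at every point of $\{H=\frac12\}$, and $F$ is functionally independent of $H$ almost everywhere on this level (i.e. $dF$ and $dH$ are linearly independent at almost every point of $\{H=\frac12\}$; in particular $F$ is not constant on the level). *)

(* Defs.v *)
(* The torus is T^2 = R^2 / Z^2: functions, metrics and 2-forms on T^2 are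
   Z^2-periodic functions, matrix fields and densities on the universal cover
   'rV[R]_2.  Indices 1, 2 of the coordinates are the elements 0, 1 of 'I_2. *)
From HB Require Import structures.
From mathcomp Require Import all_boot all_order all_algebra.
From mathcomp Require Import all_classical all_reals all_analysis.
Set Implicit Arguments.
Unset Strict Implicit.
Unset Printing Implicit Defensive.
Import Order.TTheory GRing.Theory Num.Theory.
Import numFieldNormedType.Exports.
Local Open Scope classical_set_scope.
Local Open Scope ring_scope.

Definition ebase (R : realType) (i : 'I_2) : 'rV[R]_2 := delta_mx 0 i.

Definition partial (R : realType) (i : 'I_2) (f : 'rV[R]_2 -> R)
  : 'rV[R]_2 -> R := fun x => 'D_(@ebase R i) f x.

(* Iterated partial derivatives are indexed by the word of their directions;
   the order of the derivative is the size of the word. *)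
Definition partials (R : realType) (w : seq 'I_2) (f : 'rV[R]_2 -> R)
  : 'rV[R]_2 -> R := foldr (@partial R) f w.

Definition smooth (R : realType) (f : 'rV[R]_2 -> R) : Prop :=
  forall w : seq 'I_2,
    continuous (partials w f) /\
    forall (i : 'I_2) (x : 'rV[R]_2), derivable (partials w f) x (@ebase R i).

(* f is, near every point a, the sum of an absolutely convergent double power
   series \sum_(i, j) c i j (x_1 - a_1)^i (x_2 - a_2)^j.  The terms are summed
   along the diagonals i + j = n, which for an absolutely convergent double
   series is no restriction. *)
Definition real_analytic (R : realType) (f : 'rV[R]_2 -> R) : Prop :=
  forall a : 'rV[R]_2, exists (r : R) (c : nat -> nat -> R), 0 < r /\
    forall x : 'rV[R]_2, (forall k : 'I_2, `|x 0 k - a 0 k| < r) ->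
      let term i j := c i j * (x 0 0 - a 0 0) ^+ i * (x 0 1 - a 0 1) ^+ j in
      cvgn (series (fun n => \sum_(i < n.+1) `|term i (n - i)%N|)) /\
      series (fun n => \sum_(i < n.+1) term i (n - i)%N) @ \oo --> f x.

Definition Z2_periodic (R : realType) (T : Type) (f : 'rV[R]_2 -> T) : Prop :=
  forall (i : 'I_2) (x : 'rV[R]_2), f (x + @ebase R i) = f x.

Definition entry (R : realType) (g : 'rV[R]_2 -> 'M[R]_2) (i j : 'I_2)
  : 'rV[R]_2 -> R := fun x => g x i j.

(* Regularity is not included: it is always required separately. *)
Definition torus_metric (R : realType) (g : 'rV[R]_2 -> 'M[R]_2) : Prop :=
  [/\ Z2_periodic g,
      forall x, (g x)^T = g x &
      forall x (v : 'rV[R]_2), v != 0 ->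
        0 < \sum_(i < 2) \sum_(j < 2) g x i j * v 0 i * v 0 j].

Definition analytic_torus_metric (R : realType) (g : 'rV[R]_2 -> 'M[R]_2)
  : Prop :=
  torus_metric g /\ forall i j, real_analytic (entry g i j).

Definition component (R : realType) (phi : 'rV[R]_2 -> 'rV[R]_2) (k : 'I_2)
  : 'rV[R]_2 -> R := fun x => phi x 0 k.

Definition diffeomorphism (R : realType) (phi : 'rV[R]_2 -> 'rV[R]_2) : Prop :=
  exists psi : 'rV[R]_2 -> 'rV[R]_2,
    [/\ cancel phi psi, cancel psi phi,
        forall k, smooth (component phi k) &
        forall k, smooth (component psi k)].

(* (y_1, y_2) = phi x are the new global coordinates on the universal cover,
   and g = (L1(y_1) + L2(y_2)) (dy_1^2 + dy_2^2) is written out in the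
   coordinates x.  No regularity is required of L1 and L2: if g is smooth then
   so is L1(y_1) + L2(y_2), hence so are L1 and L2. *)
Definition Liouville (R : realType) (g : 'rV[R]_2 -> 'M[R]_2) : Prop :=
  exists (phi : 'rV[R]_2 -> 'rV[R]_2) (L1 L2 : R -> R),
    diffeomorphism phi /\
    forall (x : 'rV[R]_2) (i j : 'I_2),
      g x i j = (L1 (phi x 0 0) + L2 (phi x 0 1)) *
        \sum_(k < 2) partial i (component phi k) x *
                     partial j (component phi k) x.

(* The sets { g | Ck_close k eps g0 g }, k : nat, eps > 0, form a basis of
   neighbourhoods of g0 in the C^infinity topology on metrics on T^2. *)
Definition Ck_close (R : realType) (k : nat) (eps : R)
    (g0 g : 'rV[R]_2 -> 'M[R]_2) : Prop :=
  forall (w : seq 'I_2) (i j : 'I_2) (x : 'rV[R]_2), (size w <= k)%N ->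
    `|partials w (entry g i j) x - partials w (entry g0 i j) x| < eps.

(* Functions on T^*T^2 are written F x p, with p = (p_1, p_2). *)
Definition partial_x (R : realType) (i : 'I_2)
    (F : 'rV[R]_2 -> 'rV[R]_2 -> R) (x p : 'rV[R]_2) : R :=
  partial i (fun y => F y p) x.

Definition partial_p (R : realType) (i : 'I_2)
    (F : 'rV[R]_2 -> 'rV[R]_2 -> R) (x p : 'rV[R]_2) : R :=
  partial i (F x) p.

Definition mg_bracket (R : realType) (Omega : 'rV[R]_2 -> R)
    (F H : 'rV[R]_2 -> 'rV[R]_2 -> R) (x p : 'rV[R]_2) : R :=
  \sum_(i < 2) (partial_x i F x p * partial_p i H x p -
                partial_p i F x p * partial_x i H x p) +
  Omega x * (partial_p 0 F x p * partial_p 1 H x p -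
             partial_p 1 F x p * partial_p 0 H x p).

Definition hamiltonian (R : realType) (g : 'rV[R]_2 -> 'M[R]_2)
    (x p : 'rV[R]_2) : R :=
  2^-1 * \sum_(i < 2) \sum_(j < 2) invmx (g x) i j * p 0 i * p 0 j.

Definition differential (R : realType) (F : 'rV[R]_2 -> 'rV[R]_2 -> R)
    (x p : 'rV[R]_2) : 'rV[R]_(2 + 2) :=
  row_mx (\row_i partial_x i F x p) (\row_i partial_p i F x p).

(* The point of {H = 1/2} over x = (x1, x2) with momentum in the direction
   (cos t, sin t): the momentum is rescaled by (2 H)^(-1/2), as H is quadratic
   in p.  This is a surjective local diffeomorphism from R^3 onto {H = 1/2}. *)
Definition level_base (R : realType) (z : R * R * R) : 'rV[R]_2 :=
  \row_(i < 2) (if i == 0 then z.1.1 else z.1.2).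

Definition level_momentum (R : realType) (g : 'rV[R]_2 -> 'M[R]_2)
    (z : R * R * R) : 'rV[R]_2 :=
  let u := \row_(i < 2) (if i == 0 then cos z.2 else sin z.2) in
  (Num.sqrt (2 * hamiltonian g (level_base z) u))^-1 *: u.

(* Null sets of the hypersurface {H = 1/2} are those whose preimages under the
   above local diffeomorphism are Lebesgue null in R^3. *)
Definition independent_ae_on_level (R : realType) (g : 'rV[R]_2 -> 'M[R]_2)
    (F : 'rV[R]_2 -> 'rV[R]_2 -> R) : Prop :=
  let mu := ((@lebesgue_measure R \x @lebesgue_measure R) \x
             @lebesgue_measure R)%E in
  {ae mu, forall z : R * R * R,
     free [:: differential F (level_base z) (level_momentum g z);
              differential (hamiltonian g) (level_base z)
                (level_momentum g z)]}.

(* Polynomials of degree exactly two in p, with coefficients smooth functions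
   on T^2; A is symmetric, so A x != 0 means that the quadratic part of
   F x is nonzero. *)
Definition quadratic_in_momenta (R : realType)
    (F : 'rV[R]_2 -> 'rV[R]_2 -> R) : Prop :=
  exists (A : 'rV[R]_2 -> 'M[R]_2) (b : 'rV[R]_2 -> 'rV[R]_2)
         (c : 'rV[R]_2 -> R),
    [/\ [/\ Z2_periodic A, Z2_periodic b & Z2_periodic c],
        [/\ forall i j, smooth (entry A i j),
            forall i, smooth (component b i) & smooth c],
        forall x, (A x)^T = A x,
        exists x, A x != 0 &
        forall x p, F x p =
          \sum_(i < 2) \sum_(j < 2) A x i j * p 0 i * p 0 j +
          \sum_(i < 2) b x 0 i * p 0 i + c x].

Definition quadratic_first_integral (R : realType)
    (g : 'rV[R]_2 -> 'M[R]_2) (Omega : 'rV[R]_2 -> R)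
    (F : 'rV[R]_2 -> 'rV[R]_2 -> R) : Prop :=
  [/\ quadratic_in_momenta F,
      forall x p, hamiltonian g x p = 2^-1 ->
        mg_bracket Omega F (hamiltonian g) x p = 0 &
      independent_ae_on_level g F].

(* Main.v *)
Require Import Defs.
From HB Require Import structures.
From mathcomp Require Import all_boot all_order all_algebra.
From mathcomp Require Import all_classical all_reals all_analysis.
From mathcomp Require Import ring lra zify.
From mathcomp.real_closed Require Import complex polyrcf.
Import Order.TTheory GRing.Theory Num.Theory.
Import numFieldNormedType.Exports.
Local Open Scope classical_set_scope.
Local Open Scope ring_scope.

Set Implicit Arguments.
Unset Strict Implicit.
Unset Printing Implicit Defensive.

(* The factor L of the metric L (dx^2 + dy^2) is deformed along the analytic
   evolution equations
     L_s = f_x + g_y,   f_s = L_x / L,   g_s = L_y / L,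
   starting at s = 0 from L = 4 + cos 2 pi x + cos 2 pi y and f = g = 0.  Let U,
   V, T solve U_s = f_x, V_s = g_y, T_s = f_y, starting from
   4 + cos 2 pi x, cos 2 pi y and 0.  Then L = U + V, g_x = f_y, U_y = T_x and
   V_x = T_y.  Moreover C1 = 2 T + f g and C2 = 2 L f_y + L_x g + L_y f vanish at
   s = 0 and satisfy C1_s = C2 / L and C2_s = C1_xx + C1_yy, so they vanish
   identically.  These identities say that
     F = p1^2 - p2^2 + 2 (g p1 + f p2) + V - U - (f^2 - g^2) / 2
   is a first integral on {H = 1/2} of the metric L (dx^2 + dy^2) with magnetic
   field - (f_x + g_y) / 2.  The formal series in s converges by majorants of
   the form r^N N! / (N + 1)^2 for all partial derivatives at once.

   The Jacobian minor of (F, H) in p is, on each fibre of the energy level, a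
   trigonometric polynomial with a nonzero leading term; this gives independence
   almost everywhere.

   A diffeomorphism of the plane which makes L (dx^2 + dy^2) Liouville is
   conformal, hence affine, so that (a^2 - b^2) L_xy + a b (L_xx - L_yy) = 0 for
   some constants (a, b) <> 0.  For small s > 0 this fails: L_xy = O(s^2)
   everywhere, L_xx - L_yy is far from 0 at (0, 1/2), whereas at (1/4, 1/4) it is
   O(s^2) and L_xy is of exact order s^2. *)

(** * Smooth functions on the plane *)

(** The obstacle is periodicity: the relations [curl], [div], [dV], [dU] that make F an integral
    form a nonlinear system which has to be solved on the whole torus, so local solvability does not
    help. An evolution in the auxiliary parameter s keeps periodicity for free and propagates the
    relations from f = g = 0, where F is the classical integral of a Liouville metric. An extra
    unknown [mu] for 1 / L makes the equations polynomial, so the formal part takes place over a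
    commutative ring with two commuting derivations. Each order in s costs one derivative in x or y;
    hence the majorants are indexed by the total order, and they give analyticity in x and y as
    well. Since f and g start at 0, L changes only at order s^2, whereas the field, which is - L_s /
    2, is of order s; nearness to the initial metric is then easy, but failure to be Liouville has
    to be read off the second order. Rigidity of conformal maps is obtained by real calculus:
    Bernstein's maximum argument gives the derivative estimate that is usually drawn from Cauchy's
    integral formula. *)

Section calculus.
Variable R : realType.
Notation E := 'rV[R]_2.
Implicit Types (f g : E -> R) (x v : E).

Definition lin2 (d0 d1 : R) (v : E) : R := v 0 0 * d0 + v 0 1 * d1.

Lemma lin2_is_linear d0 d1 : linear (lin2 d0 d1).
Proof. by move=> a u v; rewrite /lin2 !mxE /GRing.scale/=; ring. Qed.

HB.instance Definition _ d0 d1 :=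
  GRing.isLinear.Build R E R _ (lin2 d0 d1) (lin2_is_linear d0 d1).

Lemma lin2_continuous d0 d1 : continuous (lin2 d0 d1).
Proof.
move=> v; apply: (@continuousD _ R^o E (fun v => v 0 0 * d0) (fun v => v 0 1 * d1));
by apply: continuousM; [exact: coord_continuous|exact: cst_continuous].
Qed.

Lemma ebaseE (i j : 'I_2) : @ebase R i 0 j = (i == j)%:R.
Proof. by rewrite /ebase !mxE eqxx /= eq_sym. Qed.

Lemma rV2E v : v = v 0 0 *: @ebase R 0 + v 0 1 *: @ebase R 1.
Proof.
apply/rowP => j; rewrite !mxE !eqxx /=.
case: j => [[|[|//]] hj] /=; rewrite ?mulr1 ?mulr0 ?addr0 ?add0r;
  congr (v 0 _); exact/val_inj.
Qed.

Lemma ord2P (P : 'I_2 -> Prop) : P 0 -> P 1 -> forall i, P i.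
Proof.
move=> P0 P1 [[|[|//]] hi].
  by rewrite (_ : Ordinal hi = 0) //; exact/val_inj.
by rewrite (_ : Ordinal hi = 1) //; exact/val_inj.
Qed.

Lemma coord_le v i : `|v 0 i| <= `|v|.
Proof.
rewrite /Num.norm/= mx_normrE.
exact: (le_bigmax_cond _ (fun ij => `|v ij.1 ij.2|) (j := (0, i))).
Qed.

Lemma norm2_le v e : 0 <= e -> (forall i, `|v 0 i| <= e) -> `|v| <= e.
Proof.
move=> e0 ve; rewrite {1}/Num.norm/= mx_normrE; apply: bigmax_le => // -[i j] _ /=.
by rewrite (ord1 i).
Qed.

(** Serves for functions with continuous partials and, later, for sums of series, where only an
    estimate of the remainder is at hand. *)
Lemma differentiable_approx f x d0 d1 :
  (forall e : R, 0 < e -> exists2 d : R, 0 < d & forall v, `|v| < d ->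
     `|f (x + v) - f x - lin2 d0 d1 v| <= e * `|v|) ->
  differentiable f x /\ 'd f x = lin2 d0 d1 :> (E -> R).
Proof.
move=> H.
have H' : (f : E -> R^o) \o shift x = cst (f x : R^o) + (lin2 d0 d1 : E -> R^o) +o_ (0 : E) id.
  apply/(@eqaddoP R E R^o E (nbhs (0 : E))) => e e0.
  have [d d0' Hd] := H e e0; apply/nbhs_ballP; exists d => //= v.
  rewrite -ball_normE /= sub0r normrN => /Hd.
  rewrite [X in _ -> `|X| <= _](_ : _ = f (v + x) - (f x + lin2 d0 d1 v)) //.
  have -> : v + x = x + v by exact: addrC.
  by move=> h; rewrite opprD addrA.
have du := diff_unique (@lin2_continuous d0 d1) H'.
split => //; apply/diff_locallyP; split.
  by rewrite du; exact: lin2_continuous.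
by rewrite du.
Qed.

Lemma line_derive f x v t : derivable f (x + t *: v) v ->
  is_derive t 1 (fun t : R => f (x + t *: v)) ('D_v f (x + t *: v)).
Proof.
move=> df.
have eqn : (fun h : R => h^-1 *: (((fun t : R => f (x + t *: v)) \o shift t) (h *: (1 : R)) - f (x + t *: v)))
  = (fun h : R => h^-1 *: ((f \o shift (x + t *: v)) (h *: v) - f (x + t *: v))).
  apply/funext => h /=; congr (_ *: (f _ - _)).
  by rewrite /GRing.scale /= mulr1 -/(GRing.scale _ _) [(h + t) *: v]scalerDl addrCA.
split.
  by rewrite /derivable eqn.
by rewrite /derive eqn.
Qed.

Lemma line_MVT f x v : (forall t : R, 0 <= t <= 1 -> derivable f (x + t *: v) v) ->
  exists2 t, 0 <= t <= 1 & f (x + v) - f x = 'D_v f (x + t *: v).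
Proof.
move=> df.
have H (t : R) : t \in `[0, 1]%R -> is_derive t (1 : R) (fun t : R => f (x + t *: v)) ('D_v f (x + t *: v)).
  by rewrite in_itv /= => /df; exact: line_derive.
have Ho (t : R) : t \in `]0, 1[%R -> is_derive t (1 : R) (fun t : R => f (x + t *: v)) ('D_v f (x + t *: v)).
  by move=> t01; apply: H; exact: subset_itv_oo_cc.
have Hc : {within `[0, 1], continuous (fun t : R => f (x + t *: v))}.
  by apply: derivable_within_continuous => t t01; have := H t t01; case.
have [t t01 E1] := MVT_segment ler01 Ho Hc.
exists t; first by rewrite in_itv in t01.
by move: E1; rewrite scale1r scale0r addr0 subr0 mulr1.
Qed.

Lemma is_derive_scale f x v c : derivable f x v ->
  is_derive x (c *: v) f (c * 'D_v f x).
Proof.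
move=> df.
have H0 : is_derive (c * 0) (1 : R) (fun t : R => f (x + t *: v)) ('D_v f x).
  by have := @line_derive f x v 0; rewrite mulr0 scale0r addr0 => /(_ df).
have H1 : is_derive (0 : R) (1 : R) (fun t : R => c * t) c.
  apply: is_derive_eq; rewrite /GRing.scale /= mulr1; ring.
have H := @is_derive1_comp _ _ _ _ _ _ H0 H1.
have E0 : (fun h : R => f (h *: (c *: v) + x)) = (fun t => f (x + t *: v)) \o (fun t : R => c * t).
  by apply/funext => h /=; rewrite scalerA addrC mulrC.
split.
  by apply/derivable1P; rewrite E0; case: H.
case: H => _ H; rewrite mulrC -H -E0 /derive.
apply: (congr1 (fun F : R -> R => lim (F @ (0 : R)^'))); apply/funext => h /=.
by rewrite addr0 scale0r add0r /GRing.scale /= mulr1.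
Qed.

Lemma partial_MVT f i (c : R) x : (forall y, derivable f y (@ebase R i)) ->
  exists2 t : R, 0 <= t <= 1 &
    f (x + c *: @ebase R i) - f x = c * partial i f (x + (t * c) *: @ebase R i).
Proof.
move=> df.
have df' y : is_derive y (c *: @ebase R i) f (c * partial i f y).
  exact: is_derive_scale.
have [|t t01 ->] := @line_MVT f x (c *: @ebase R i).
  by move=> t _; case: (df' (x + t *: (c *: @ebase R i))).
exists t => //; rewrite scalerA.
by case: (df' (x + (t * c) *: @ebase R i)).
Qed.

Lemma normZ_ebase (c : R) i : `|c *: @ebase R i| <= `|c|.
Proof.
apply: norm2_le => // j; rewrite mxE ebaseE.
by case: (i == j); rewrite ?mulr1 // mulr0 normr0.
Qed.

(** The increment is split into one step along each axis. The mean value theorem on each step gives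
    a partial derivative at a point near [x], which continuity compares with its value at [x]. *)
Lemma C1_differentiable f :
  (forall i x, derivable f x (@ebase R i)) ->
  (forall i, continuous (partial i f)) ->
  forall x, differentiable f x /\ 'd f x = lin2 (partial 0 f x) (partial 1 f x) :> (E -> R).
Proof.
move=> df cf x; apply: differentiable_approx => e e0.
have e20 : 0 < e / 2 by rewrite divr_gt0.
have near_i i : exists2 d, 0 < d & forall y, `|y - x| < d -> `|partial i f y - partial i f x| <= e / 2.
  have /cvgrPdist_le /(_ _ e20) := cf i x.
  move/nbhs_ballP => [d /= d0 H]; exists d => // y yx.
  rewrite distrC; apply: H.
  by rewrite -ball_normE /= distrC.
have [d0 d00 H0] := near_i 0; have [d1 d10 H1] := near_i 1.
have m0 : 0 < Num.min d0 d1 by rewrite lt_min d00.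
(* Halved because the point reached after two steps is only within 2 |v| of [x]. *)
exists (Num.min d0 d1 / 2) => [|v]; first by rewrite divr_gt0.
rewrite ltr_pdivlMr // mulr_natr mulr2n => vd.
have [vd0 vd1] : `|v| + `|v| < d0 /\ `|v| + `|v| < d1.
  by move: vd; rewrite lt_min => /andP.
have [t0 /andP[t00 t01] E0] := @partial_MVT f 0 (v 0 0) x (df 0).
have [t1 /andP[t10 t11] E1] := @partial_MVT f 1 (v 0 1) (x + v 0 0 *: @ebase R 0) (df 1).
have Ev : x + v = x + v 0 0 *: @ebase R 0 + v 0 1 *: @ebase R 1.
  by rewrite -addrA -rV2E.
have -> : f (x + v) - f x - lin2 (partial 0 f x) (partial 1 f x) v =
   v 0 0 * (partial 0 f (x + (t0 * v 0 0) *: @ebase R 0) - partial 0 f x) +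
   v 0 1 * (partial 1 f (x + v 0 0 *: @ebase R 0 + (t1 * v 0 1) *: @ebase R 1) - partial 1 f x).
  by rewrite !mulrBr -E0 -E1 Ev /lin2; ring.
have tv (t c : R) : 0 <= t -> t <= 1 -> `|c| <= `|v| -> `|t * c| <= `|v|.
  move=> t_0 t_1 cv; rewrite normrM ger0_norm // -[leRHS]mul1r.
  by rewrite ler_pM.
have B0 : `|partial 0 f (x + (t0 * v 0 0) *: @ebase R 0) - partial 0 f x| <= e / 2.
  apply: H0; rewrite addrAC subrr add0r (le_lt_trans _ vd0) //.
  rewrite (le_trans (normZ_ebase _ _)) // (le_trans (tv _ _ _ _ (coord_le _ _))) //.
  by rewrite lerDl.
have B1 : `|partial 1 f (x + v 0 0 *: @ebase R 0 + (t1 * v 0 1) *: @ebase R 1) - partial 1 f x| <= e / 2.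
  have aux (a b : E) : x + a + b - x = a + b.
    by rewrite addrAC [x + a - x]addrAC subrr add0r.
  apply: H1; rewrite aux (le_lt_trans _ vd1) //.
  rewrite (le_trans (ler_normD _ _)) // lerD //.
    by rewrite (le_trans (normZ_ebase _ _)) // coord_le.
  by rewrite (le_trans (normZ_ebase _ _)) // (le_trans (tv _ _ _ _ (coord_le _ _))).
apply: (le_trans (ler_normD _ _)); rewrite (splitr e) mulrDl.
have mn a b c d (ab : `|a : R| <= b) (cd : `|c : R| <= d) : `|c * a| <= b * d.
  by rewrite normrM mulrC ler_pM.
exact: lerD (mn _ _ _ _ B0 (coord_le _ _)) (mn _ _ _ _ B1 (coord_le _ _)).
Qed.

Opaque partial.

Lemma half_triangle (a b c e : R) :
  `|a - b| <= e / 2 -> `|a - c| <= e / 2 -> `|b - c| <= e.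
Proof. by rewrite !ler_norml => /andP[? ?] /andP[? ?]; apply/andP; split; lra. Qed.

(** The second difference of [f] over a small square is symmetric in the two directions. Two mean
    value steps, in either order, identify it with d^2 times one of the mixed partials at a point
    near [x]. *)
Lemma schwarz f :
  (forall i x, derivable f x (@ebase R i)) ->
  (forall i j x, derivable (partial j f) x (@ebase R i)) ->
  (forall i j, continuous (partial i (partial j f))) ->
  partial 0 (partial 1 f) = partial 1 (partial 0 f).
Proof.
move=> df ddf cf; apply/funext => x; apply/eqP; rewrite -subr_eq0 -normr_le0.
apply/ler_addgt0Pl => e e0; rewrite addr0.
have e20 : 0 < e / 2 by rewrite divr_gt0.
have near_i i j : exists2 d, 0 < d & forall y, `|y - x| < d ->
    `|partial i (partial j f) y - partial i (partial j f) x| <= e / 2.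
  have /cvgrPdist_le /(_ _ e20) := cf i j x.
  move/nbhs_ballP => [d /= d0 H]; exists d => // y yx.
  rewrite distrC; apply: H.
  by rewrite -ball_normE /= distrC.
have [d0 d00 H0] := near_i 0 1; have [d1 d10 H1] := near_i 1 0.
pose d := Num.min d0 d1 / 4.
have dgt0 : 0 < d by rewrite divr_gt0 // lt_min d00.
have [dd0 dd1] : d + d < d0 /\ d + d < d1.
  have [a b] : 4 * d <= d0 /\ 4 * d <= d1.
    by rewrite /d mulrC divfK // !ge_min !lexx orbT.
  by split; lra.
have mixed i j : exists2 v, `|v| <= d + d &
    f (x + d *: @ebase R i + d *: @ebase R j) - f (x + d *: @ebase R i) -
    f (x + d *: @ebase R j) + f x = d * d * partial j (partial i f) (x + v).
  pose h y := f (y + d *: @ebase R j) - f y.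
  have dh y : is_derive y (@ebase R i) h (partial i f (y + d *: @ebase R j) - partial i f y).
    apply: is_deriveB; last by apply: derivableP; exact: df.
    split.
      have := df i (y + d *: @ebase R j); rewrite /derivable.
      set F := (X in cvg X) => cF; set G := (X in cvg X).
      suff -> : G = F by [].
      rewrite /G /F; apply: (congr1 (fun F : R -> R => F @ (0 : R)^')).
      by apply/funext => t /=; rewrite addrA.
    apply: (congr1 (fun F : R -> R => lim (F @ (0 : R)^'))).
    by apply/funext => t /=; rewrite addrA.
  have [|t /andP[t0 t1] Eh] := @partial_MVT h i d x.
    by move=> y; case: (dh y).
  have E2 : partial i h (x + (t * d) *: @ebase R i) =
     partial i f (x + (t * d) *: @ebase R i + d *: @ebase R j) - partial i f (x + (t * d) *: @ebase R i).
    by case: (dh (x + (t * d) *: @ebase R i)).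
  have [u /andP[u0 u1] E3] := @partial_MVT (partial i f) j d (x + (t * d) *: @ebase R i) (ddf j i).
  exists ((t * d) *: @ebase R i + (u * d) *: @ebase R j).
    rewrite (le_trans (ler_normD _ _)) // lerD // (le_trans (normZ_ebase _ _)) //;
    by rewrite ger0_norm; [rewrite ler_piMl // ltW | rewrite mulr_ge0 // ltW].
  by rewrite addrA -mulrA -E3 -E2 -Eh /h; ring.
have [v vd Ev] := mixed 0 1; have [w wd Ew] := mixed 1 0.
have E1 : partial 1 (partial 0 f) (x + v) = partial 0 (partial 1 f) (x + w).
  apply: (mulfI (x := d * d)); first by rewrite mulf_neq0 // gt_eqF.
  move: Ev Ew; rewrite (_ : x + d *: @ebase R 0 + d *: @ebase R 1 =
    x + d *: @ebase R 1 + d *: @ebase R 0); last exact: addrAC.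
  move: (f _) (f _) (f _) (f _) (partial _ _ _) (partial _ _ _) => a b c k m n <- <-.
  ring.
have B1 : `|partial 1 (partial 0 f) (x + v) - partial 1 (partial 0 f) x| <= e / 2.
  by apply: H1; rewrite addrAC subrr add0r (le_lt_trans vd).
have B0 : `|partial 0 (partial 1 f) (x + w) - partial 0 (partial 1 f) x| <= e / 2.
  by apply: H0; rewrite addrAC subrr add0r (le_lt_trans wd).
move: B0 B1; rewrite E1; exact: half_triangle.
Qed.

End calculus.

(** * Closure properties of smooth functions; the ring of smooth functions on the torus *)

Section csm.
Variable R : realType.
Notation E := 'rV[R]_2.
Implicit Types (f g : E -> R) (x v : E).

Lemma partialE i f x : partial i f x = 'D_(@ebase R i) f x.
Proof. by []. Qed.

Opaque partial.

(** Equivalent to [smooth], see [csm_smooth] and [smooth_csm]. Differentiability replaces continuity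
    together with derivability along the axes because it is what the product, quotient and chain
    rules need and preserve. *)
Definition csm f := forall w x, differentiable (partials w f) x.

(** Coinduction: smoothness is proved by exhibiting a class of differentiable functions stable under
    partials, without any formula for iterated derivatives of products or composites. *)
Lemma csm_coind (P : (E -> R) -> Prop) :
  (forall f, P f -> (forall x, differentiable f x) /\ forall i, P (partial i f)) ->
  forall f, P f -> csm f.
Proof.
move=> H f Pf w.
by have /H[] : P (partials w f) by elim: w => //= i w /H[].
Qed.

Lemma partials_rcons w i f : partials (rcons w i) f = partials w (partial i f).
Proof. exact: foldr_rcons. Qed.

Lemma partials_cat w w' f : partials (w ++ w') f = partials w (partials w' f).
Proof. exact: foldr_cat. Qed.

Lemma csm_partials f w : csm f -> csm (partials w f).
Proof. by move=> fs w' x; rewrite -partials_cat; exact: fs. Qed.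

Lemma csm_partial f i : csm f -> csm (partial i f).
Proof. exact: (@csm_partials f [:: i]). Qed.

Lemma csm_differentiable f x : csm f -> differentiable f x.
Proof. by move=> /(_ [::]). Qed.

Lemma csm_derivable f x v : csm f -> derivable f x v.
Proof. by move=> fs; apply: diff_derivable; exact: csm_differentiable. Qed.

Lemma csm_continuous f : csm f -> continuous f.
Proof. by move=> fs x; apply: differentiable_continuous; exact: csm_differentiable. Qed.

Lemma csm_smooth f : csm f -> smooth f.
Proof.
move=> fs w; split; first exact/csm_continuous/csm_partials.
by move=> i x; exact/csm_derivable/csm_partials.
Qed.

Lemma smooth_csm f : smooth f -> csm f.
Proof.
move=> fs w x; apply: (proj1 (@C1_differentiable R _ _ _ _)).
  by move=> i; exact: (fs w).2.
by move=> i; exact: (fs (i :: w)).1.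
Qed.

Lemma csm_schwarz i j f : csm f -> partial i (partial j f) = partial j (partial i f).
Proof.
move=> fs; have H : partial 0 (partial 1 f) = partial 1 (partial 0 f).
  apply: schwarz; [|move=> ? ?|move=> ? ?].
  - by move=> *; exact: csm_derivable.
  - by move=> x; exact/csm_derivable/csm_partial.
  - exact/csm_continuous/csm_partial/csm_partial.
move: i j; apply: (@ord2P (fun i => forall j, partial i (partial j f) = partial j (partial i f)));
  apply: ord2P.
- exact: erefl.
- exact: H.
- exact: esym H.
- exact: erefl.
Qed.

Lemma csm_partial_partials i w f : csm f ->
  partial i (partials w f) = partials w (partial i f).
Proof.
move=> fs; elim: w => //= j w IH.
by rewrite csm_schwarz ?IH //; exact: csm_partials.
Qed.

Lemma csm_diffE f x : csm f -> 'd f x = lin2 (partial 0 f x) (partial 1 f x) :> (E -> R).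
Proof.
move=> fs; apply: (proj2 (@C1_differentiable R _ _ _ _)).
  by move=> i y; exact: csm_derivable.
by move=> i; exact/csm_continuous/csm_partial.
Qed.

Lemma csm_deriveE f x v : csm f -> 'D_v f x = v 0 0 * partial 0 f x + v 0 1 * partial 1 f x.
Proof. by move=> fs; rewrite deriveE ?csm_diffE //; exact: csm_differentiable. Qed.

Lemma partial_cst i (a : R) : partial i (cst a) = (cst 0 : E -> R).
Proof. by apply/funext => x; rewrite partialE derive_cst. Qed.

Lemma csm_cst (a : R) : csm (cst a : E -> R).
Proof.
apply: (@csm_coind (fun f => exists a, f = cst a)); last by exists a.
move=> _ [b ->]; split => [x|i]; first exact: differentiable_cst.
by exists 0; rewrite partial_cst.
Qed.

(** The class handed to [csm_coind]: a partial derivative of a product or of an inverse is no longer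
    of that shape, but it is a sum of products of members of this class. *)
Inductive smooth_closure : (E -> R) -> Prop :=
| closure_csm f : csm f -> smooth_closure f
| closure_add f g : smooth_closure f -> smooth_closure g -> smooth_closure (f \+ g)
| closure_mul f g : smooth_closure f -> smooth_closure g -> smooth_closure (f \* g)
| closure_inv f : smooth_closure f -> (forall x, f x != 0) ->
    smooth_closure (fun x => (f x)^-1).

Lemma partialD_diff i f g : (forall x, differentiable f x) -> (forall x, differentiable g x) ->
  partial i (f \+ g) = partial i f \+ partial i g.
Proof.
by move=> df dg; apply/funext => x; rewrite !partialE deriveD //; exact: diff_derivable.
Qed.

Lemma partialM_diff i f g : (forall x, differentiable f x) -> (forall x, differentiable g x) ->
  partial i (f \* g) = (partial i f \* g) \+ (f \* partial i g).
Proof.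
move=> df dg; apply/funext => x; rewrite /= !partialE deriveM; try exact: diff_derivable.
by rewrite /GRing.scale /= addrC (mulrC (g x)).
Qed.

Lemma partialV_diff i f : (forall x, differentiable f x) -> (forall x, f x != 0) ->
  partial i (fun x => (f x)^-1) =
  cst (-1) \* (partial i f \* ((fun x => (f x)^-1) \* (fun x => (f x)^-1))).
Proof.
move=> df f0; apply/funext => x; rewrite /= !partialE.
rewrite (@deriveV _ _ f x _ (f0 x)); last exact: diff_derivable.
rewrite /GRing.scale /= expr2 invfM; move: ('D_ _ _ _) (f x)^-1 => a b; ring.
Qed.

Lemma smooth_closure_csm f : smooth_closure f -> csm f.
Proof.
apply: csm_coind => {}f; elim=> {f}.
- move=> f fs; split => [x|i]; first exact: csm_differentiable.
  exact/closure_csm/csm_partial.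
- move=> f g cf [df pf] cg [dg pg]; split => [x|i]; first exact: differentiableD.
  by rewrite partialD_diff //; exact: closure_add.
- move=> f g cf [df pf] cg [dg pg]; split => [x|i]; first exact: differentiableM.
  rewrite partialM_diff //; apply: closure_add; exact: closure_mul.
- move=> f cf [df pf] f0; split => [x|i]; first exact: differentiableV.
  rewrite partialV_diff //; apply: closure_mul; first exact/closure_csm/csm_cst.
  by apply: closure_mul => //; apply: closure_mul; exact: closure_inv.
Qed.

Lemma csmD f g : csm f -> csm g -> csm (f \+ g).
Proof. by move=> fs gs; apply/smooth_closure_csm/closure_add; exact: closure_csm. Qed.

Lemma csmM f g : csm f -> csm g -> csm (f \* g).
Proof. by move=> fs gs; apply/smooth_closure_csm/closure_mul; exact: closure_csm. Qed.

Lemma csmV f : csm f -> (forall x, f x != 0) -> csm (fun x => (f x)^-1).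
Proof. by move=> fs f0; apply/smooth_closure_csm/closure_inv => //; exact: closure_csm. Qed.

Lemma partialD i f g : csm f -> csm g -> partial i (f \+ g) = partial i f \+ partial i g.
Proof. by move=> fs gs; apply: partialD_diff => x; exact: csm_differentiable. Qed.

Lemma partialM i f g : csm f -> csm g ->
  partial i (f \* g) = (partial i f \* g) \+ (f \* partial i g).
Proof. by move=> fs gs; apply: partialM_diff => x; exact: csm_differentiable. Qed.

Lemma partial_periodic i f : Z2_periodic f -> Z2_periodic (partial i f).
Proof.
move=> fp j x; rewrite !partialE.
apply: (congr1 (fun F : R -> R => lim (F @ (0 : R)^'))); apply/funext => h /=.
by rewrite addrA !fp.
Qed.

Definition torus_smooth : {pred E -> R} := fun f => `[< csm f /\ Z2_periodic f >].

Lemma torus_smoothP f : reflect (csm f /\ Z2_periodic f) (f \in torus_smooth).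
Proof. exact: asboolP. Qed.

Lemma torus_smooth_subring : subring_closed torus_smooth.
Proof.
have M1 : (-1 : E -> R) \in torus_smooth.
  rewrite (_ : -1 = cst (-1)); last exact/funext.
  by apply/torus_smoothP; split => //; exact: csm_cst.
have M f g : f \in torus_smooth -> g \in torus_smooth -> f * g \in torus_smooth.
  move=> /torus_smoothP[fs fp] /torus_smoothP[gs gp]; apply/torus_smoothP; split.
    exact: csmM.
  by move=> i x; rewrite -[LHS]/(f _ * g _) fp gp.
split => //.
  by apply/torus_smoothP; split => //; exact: csm_cst.
move=> f g tf tg; rewrite -mulN1r.
have := M _ _ M1 tg; move: tf => /torus_smoothP[fs fp] /torus_smoothP[gs gp].
apply/torus_smoothP; split; first exact: csmD.
by move=> i x; rewrite -[LHS]/(f _ + (-1 * g) _) fp gp.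
Qed.

HB.instance Definition _ :=
  GRing.isSubringClosed.Build (E -> R) torus_smooth torus_smooth_subring.

(** Bundling turns the torus functions into a commutative ring, on which [tpartial] gives two
    commuting derivations; this is all that the formal part uses. *)
Record tfun := TFun { tval :> E -> R; _ : tval \in torus_smooth }.

HB.instance Definition _ := [isSub for tval].
HB.instance Definition _ := [Choice of tfun by <:].
HB.instance Definition _ := [SubChoice_isSubComNzRing of tfun by <:].

Lemma tfun_csm (u : tfun) : csm u.
Proof. by have /torus_smoothP[] := valP u. Qed.

Lemma tfun_periodic (u : tfun) : Z2_periodic u.
Proof. by have /torus_smoothP[] := valP u. Qed.

Definition mk_tfun f (fs : csm f) (fp : Z2_periodic f) : tfun :=
  TFun (introT (torus_smoothP f) (conj fs fp)).

Definition tpartial i (u : tfun) : tfun :=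
  mk_tfun (csm_partial i (tfun_csm u)) (partial_periodic i (tfun_periodic u)).

Lemma tfun_ext (u v : tfun) : (forall x, u x = v x) -> u = v.
Proof. by move=> uv; apply/val_inj/funext. Qed.

Lemma tpartialD i (u v : tfun) : tpartial i (u + v) = tpartial i u + tpartial i v.
Proof. apply/val_inj; apply: partialD; exact: tfun_csm. Qed.

Lemma tpartialM i (u v : tfun) : tpartial i (u * v) = tpartial i u * v + u * tpartial i v.
Proof. apply/val_inj; apply: partialM; exact: tfun_csm. Qed.

Lemma tpartialC i j (u : tfun) : tpartial i (tpartial j u) = tpartial j (tpartial i u).
Proof. by apply/val_inj; apply: csm_schwarz; exact: tfun_csm. Qed.

End csm.

(** * The deformation as a formal power series *)

(* u stands for \sum_n u n * s^n / n!, so that d/ds is the shift and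
   [hmul_binE] is the product of series; no division is needed in A. *)
Definition hurwitz (A : Type) : Type := nat -> A.

Section hurwitz_ring.
Variable A : comNzRingType.

HB.instance Definition _ := GRing.Zmodule.copy (hurwitz A) (nat -> A).

Implicit Types u v w : hurwitz A.

Definition hshift u : hurwitz A := fun n => u n.+1.

(** The recursion is the Leibniz rule for d/ds, so [hshiftM] holds by definition and the ring axioms
    follow by induction on the order. *)
Fixpoint hmul (n : nat) u v : A :=
  if n is m.+1 then hmul m (hshift u) v + hmul m u (hshift v) else u 0%N * v 0%N.

Definition hmulr u v : hurwitz A := fun n => hmul n u v.
Definition hone : hurwitz A := fun n => (n == 0%N)%:R.

Lemma hmulC n u v : hmul n u v = hmul n v u.
Proof.
elim: n u v => [u v|n IH u v] /=; first by rewrite mulrC.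
by rewrite addrC IH (IH (hshift u)).
Qed.

Lemma hmulDl n u u' v : hmul n (u + u') v = hmul n u v + hmul n u' v.
Proof.
elim: n u u' v => [u u' v|n IH u u' v] /=; first by rewrite -mulrDl.
rewrite -[hshift (u + u')]/(hshift u + hshift u') !IH.
by rewrite addrACA.
Qed.

Lemma hmulDr n u v v' : hmul n u (v + v') = hmul n u v + hmul n u v'.
Proof. by rewrite hmulC hmulDl !(hmulC n _ u). Qed.

Lemma hmul0 n u : hmul n 0 u = 0.
Proof.
have := hmulDl n 0 0 u; rewrite addr0 => /eqP.
by rewrite -subr_eq subrr eq_sym => /eqP.
Qed.

Lemma hmulA n u v w : hmul n u (hmulr v w) = hmul n (hmulr u v) w.
Proof.
elim: n u v w => [u v w|n IH u v w] /=; first by rewrite /hmulr /= mulrA.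
rewrite -[hshift (hmulr v w)]/(hmulr (hshift v) w + hmulr v (hshift w)).
rewrite -[hshift (hmulr u v)]/(hmulr (hshift u) v + hmulr u (hshift v)).
by rewrite hmulDl hmulDr !IH addrA.
Qed.

Lemma hmul1 n u : hmul n hone u = u n.
Proof.
elim: n u => [u|n IH u] /=; first by rewrite mul1r.
by rewrite -[hshift hone]/(0 : hurwitz A) hmul0 add0r IH.
Qed.

Fact hmulrA : associative hmulr.
Proof. by move=> u v w; apply/funext => n; exact: hmulA. Qed.
Fact hmulrC : commutative hmulr.
Proof. by move=> u v; apply/funext => n; exact: hmulC. Qed.
Fact hmul1r : left_id hone hmulr.
Proof. by move=> u; apply/funext => n; exact: hmul1. Qed.
Fact hmulrDl : left_distributive hmulr +%R.
Proof. by move=> u v w; apply/funext => n; exact: hmulDl. Qed.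
Fact hone_neq0 : hone != 0.
Proof. by apply/eqP => /(congr1 (fun u => u 0%N)) /eqP; rewrite oner_eq0. Qed.

HB.instance Definition _ := GRing.Zmodule_isComNzRing.Build (hurwitz A)
  hmulrA hmulrC hmul1r hmulrDl hone_neq0.

Lemma hmulE u v n : (u * v) n = hmul n u v.
Proof. by []. Qed.

Lemma hshiftD u v : hshift (u + v) = hshift u + hshift v.
Proof. by []. Qed.

Lemma hshiftM u v : hshift (u * v) = hshift u * v + u * hshift v.
Proof. by []. Qed.

Lemma hmul_ext n u v u' v' : (forall k, (k <= n)%N -> u k = u' k) ->
  (forall k, (k <= n)%N -> v k = v' k) -> hmul n u v = hmul n u' v'.
Proof.
elim: n u v u' v' => [|n IH] u v u' v' eu ev /=; first by rewrite eu // ev.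
congr (_ + _); apply: IH => k kn;
  rewrite /hshift ?eu ?ev //; exact: leqW.
Qed.

Definition hlift (d : A -> A) u : hurwitz A := fun n => d (u n).

Section derivation.
Variable d : A -> A.
Hypothesis dD : forall a b, d (a + b) = d a + d b.
Hypothesis dM : forall a b, d (a * b) = d a * b + a * d b.

Lemma hliftD u v : hlift d (u + v) = hlift d u + hlift d v.
Proof. by apply/funext => n; exact: dD. Qed.

Lemma hliftM u v : hlift d (u * v) = hlift d u * v + u * hlift d v.
Proof.
apply/funext => n.
rewrite -[LHS]/(d (hmul n u v)) -[RHS]/(hmul n (hlift d u) v + hmul n u (hlift d v)).
elim: n u v => [u v|n IH u v] /=; first by rewrite dM.
by rewrite dD !IH addrACA.
Qed.

End derivation.

Definition vanish n u := forall k, (k < n)%N -> u k = 0.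

Lemma vanishM n u v : vanish n u -> vanish n (v * u).
Proof.
move=> un k kn; rewrite hmulE hmulC (@hmul_ext k u v 0 v) ?hmul0 //.
by move=> j jk; rewrite un // (leq_ltn_trans jk).
Qed.

Lemma vanishD n u v : vanish n u -> vanish n v -> vanish n (u + v).
Proof. by move=> un vn k kn; rewrite -[LHS]/(u k + v k) un // vn // addr0. Qed.

Lemma vanish_lift n d u : d 0 = 0 -> vanish n u -> vanish n (hlift d u).
Proof. by move=> d0 un k kn; rewrite /hlift un. Qed.

Lemma vanish_shift n u : u 0%N = 0 -> vanish n (hshift u) -> vanish n.+1 u.
Proof. by move=> u0 un [//|k] kn; exact: un. Qed.

(** Formal uniqueness for the Cauchy problem: each pass through the hypothesis raises the order of
    vanishing in s by one. It is applied where u_s is 0 or a multiple of u. *)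
Lemma vanish_eq0 u : (forall n, vanish n u -> vanish n (hshift u)) -> u 0%N = 0 -> u = 0.
Proof.
move=> H u0; apply/funext => n.
have : vanish n.+1 u by elim: n.+1 => // m IH; apply: vanish_shift => //; exact: H.
by apply.
Qed.

End hurwitz_ring.

(** Iterating [Phi] from an arbitrary constant sequence, the entry of index n no longer changes
    after n + 1 iterations; the diagonal of the iterates is the solution. *)
Lemma causal_fixpoint (B : Type) (b0 : B) (Phi : (nat -> B) -> nat -> B) :
  (forall n X Y, (forall k, (k < n)%N -> X k = Y k) -> Phi X n = Phi Y n) ->
  exists X, forall n, X n = Phi X n.
Proof.
move=> causal; pose I m := iter m Phi (fun=> b0).
have stable m m' n : (n < m)%N -> (n < m')%N -> I m n = I m' n.
  elim/ltn_ind: n m m' => n IH [//|m] [//|m'] nm nm'; rewrite /I !iterS.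
  apply: causal => k kn; apply: IH => //; exact: leq_trans kn _.
exists (fun n => I n.+1 n) => n; rewrite {1}/I iterS; apply: causal => k kn.
exact: stable.
Qed.

Section formal_deformation.
Variables (A : comNzRingType) (dx dy : A -> A).
Hypothesis dxD : forall a b, dx (a + b) = dx a + dx b.
Hypothesis dyD : forall a b, dy (a + b) = dy a + dy b.
Hypothesis dxM : forall a b, dx (a * b) = dx a * b + a * dx b.
Hypothesis dyM : forall a b, dy (a * b) = dy a * b + a * dy b.
Hypothesis dxy : forall a, dx (dy a) = dy (dx a).

Notation K := (hurwitz A).
Notation Dx := (hlift dx).
Notation Dy := (hlift dy).
Notation S := (@hshift A).

(** [mu] stands for 1 / L, and its equation is that of the s-derivative of 1 / L. With it the
    right-hand sides are polynomial, and their coefficients of order n involve only orders up to n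
    of the unknowns. *)
Lemma formal_deformation_exists (L0 mu0 : A) :
  exists L f g mu : K,
    [/\ [/\ L 0%N = L0, f 0%N = 0, g 0%N = 0 & mu 0%N = mu0],
        S L = Dx f + Dy g, S f = mu * Dx L, S g = mu * Dy L &
        S mu = - (mu * (mu * (Dx f + Dy g)))].
Proof.
pose L' (X : nat -> A * A * A * A) : K := fun n => (X n).1.1.1.
pose f' (X : nat -> A * A * A * A) : K := fun n => (X n).1.1.2.
pose g' (X : nat -> A * A * A * A) : K := fun n => (X n).1.2.
pose m' (X : nat -> A * A * A * A) : K := fun n => (X n).2.
pose Phi X n := if n is k.+1 then
  (Dx (f' X) k + Dy (g' X) k, hmul k (m' X) (Dx (L' X)), hmul k (m' X) (Dy (L' X)),
   - hmul k (m' X) (hmulr (m' X) (Dx (f' X) + Dy (g' X)))) else (L0, 0, 0, mu0).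
have [|X EX] := @causal_fixpoint _ (L0, 0, 0, mu0) Phi.
  move=> [//|n] X Y XY.
  have eL k : (k <= n)%N -> L' X k = L' Y k by move=> kn; rewrite /L' XY.
  have ef k : (k <= n)%N -> f' X k = f' Y k by move=> kn; rewrite /f' XY.
  have eg k : (k <= n)%N -> g' X k = g' Y k by move=> kn; rewrite /g' XY.
  have em k : (k <= n)%N -> m' X k = m' Y k by move=> kn; rewrite /m' XY.
  have efg k : (k <= n)%N -> (Dx (f' X) + Dy (g' X)) k = (Dx (f' Y) + Dy (g' Y)) k.
    by move=> kn; rewrite -[LHS]/(dx (f' X k) + dy (g' X k)) ef // eg.
  rewrite /Phi; congr (_, _, _, _).
  - exact: efg.
  - by apply: hmul_ext => // k kn; rewrite /hlift eL.
  - by apply: hmul_ext => // k kn; rewrite /hlift eL.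
  - congr (- _); apply: hmul_ext => // k kn; apply: hmul_ext => j jk.
      by apply: em; exact: leq_trans kn.
    by apply: efg; exact: leq_trans kn.
exists (L' X), (f' X), (g' X), (m' X); split.
- by rewrite /L' /f' /g' /m' EX.
- by apply/funext => n; rewrite /hshift {1}/L' EX.
- by apply/funext => n; rewrite /hshift {1}/f' EX.
- by apply/funext => n; rewrite /hshift {1}/g' EX.
- by apply/funext => n; rewrite /hshift {1}/m' EX.
Qed.

Variables L f g mu U V T : K.
Hypothesis SL : S L = Dx f + Dy g.
Hypothesis Sf : S f = mu * Dx L.
Hypothesis Sg : S g = mu * Dy L.
Hypothesis Smu : S mu = - (mu * (mu * (Dx f + Dy g))).
Hypothesis SU : S U = Dx f.
Hypothesis SV : S V = Dy g.
Hypothesis ST : S T = Dy f.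
Hypothesis L0 : L 0%N = U 0%N + V 0%N.
Hypothesis muL0 : mu 0%N * L 0%N = 1.
Hypothesis f0 : f 0%N = 0.
Hypothesis g0 : g 0%N = 0.
Hypothesis T0 : T 0%N = 0.
Hypothesis dyU0 : dy (U 0%N) = 0.
Hypothesis dxV0 : dx (V 0%N) = 0.

Let d0 (d : A -> A) : (forall a b, d (a + b) = d a + d b) -> d 0 = 0.
Proof.
by move=> dD; have /eqP := dD 0 0; rewrite addr0 -subr_eq subrr eq_sym => /eqP.
Qed.

Let DxM := hliftM dxD dxM.
Let DyM := hliftM dyD dyM.
Let DxD := hliftD dxD.
Let DyD := hliftD dyD.

Let Dxy u : Dx (Dy u) = Dy (Dx u).
Proof. by apply/funext => n; exact: dxy. Qed.

Let SN (u : K) : S (- u) = - S u. Proof. by []. Qed.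

Lemma formal_L : L = U + V.
Proof.
apply/eqP; rewrite -subr_eq0; apply/eqP.
apply: vanish_eq0 => [n _|]; last by rewrite -[LHS]/(L 0%N - (U 0%N + V 0%N)) L0 subrr.
rewrite hshiftD SN hshiftD SL SU SV subrr; exact: (fun k _ => erefl).
Qed.

(** The difference mu L - 1 solves a linear homogeneous equation in s and starts at 0. *)
Lemma formal_muL : mu * L = 1.
Proof.
apply/eqP; rewrite -subr_eq0; apply/eqP.
apply: vanish_eq0 => [n|]; last by rewrite -[LHS]/(mu 0%N * L 0%N - 1) muL0 subrr.
have -> : S (mu * L - 1) = (- (mu * (Dx f + Dy g))) * (mu * L - 1).
  rewrite hshiftD hshiftM SL Smu -[S (- 1)]/(- (0 : K)); ring.
exact: vanishM.
Qed.

Let Dmu (d : A -> A) : (forall a b, d (a + b) = d a + d b) ->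
  (forall a b, d (a * b) = d a * b + a * d b) ->
  hlift d mu = - (mu * mu * hlift d L).
Proof.
move=> dD dM.
have E1 : hlift d mu * L + mu * hlift d L = 0.
  rewrite -(hliftM dD dM) formal_muL.
  have := hliftM dD dM 1 (1 : K); rewrite !mulr1 mul1r => /eqP.
  by rewrite -subr_eq subrr eq_sym => /eqP.
have := congr1 ( *%R mu) E1; rewrite mulr0 => E2.
transitivity (hlift d mu * (mu * L)); first by rewrite formal_muL mulr1.
apply/eqP; rewrite -subr_eq0; apply/eqP; rewrite -[RHS]E2; ring.
Qed.

(** (f_s, g_s) is the gradient of log L, so the curl of (f, g) does not change with s. *)
Lemma formal_curl : Dx g = Dy f.
Proof.
apply/eqP; rewrite -subr_eq0; apply/eqP.
apply: vanish_eq0 => [n _|]; last first.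
  by rewrite -[LHS]/(dx (g 0%N) - dy (f 0%N)) f0 g0 (d0 dxD) (d0 dyD) subrr.
have -> : S (Dx g - Dy f) = 0; last by move=> k _.
rewrite hshiftD SN -[S (Dx g)]/(Dx (S g)) -[S (Dy f)]/(Dy (S f)) Sf Sg DxM DyM.
rewrite !Dmu // Dxy; ring.
Qed.

Lemma formal_UT : Dy U = Dx T.
Proof.
apply/eqP; rewrite -subr_eq0; apply/eqP.
apply: vanish_eq0 => [n _|]; last first.
  by rewrite -[LHS]/(dy (U 0%N) - dx (T 0%N)) dyU0 T0 (d0 dxD) subrr.
have -> : S (Dy U - Dx T) = 0; last by move=> k _.
by rewrite hshiftD SN -[S (Dy U)]/(Dy (S U)) -[S (Dx T)]/(Dx (S T)) SU ST Dxy subrr.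
Qed.

Lemma formal_VT : Dx V = Dy T.
Proof.
apply/eqP; rewrite -subr_eq0; apply/eqP.
apply: vanish_eq0 => [n _|]; last first.
  by rewrite -[LHS]/(dx (V 0%N) - dy (T 0%N)) dxV0 T0 (d0 dyD) subrr.
have -> : S (Dx V - Dy T) = 0; last by move=> k _.
rewrite hshiftD SN -[S (Dx V)]/(Dx (S V)) -[S (Dy T)]/(Dy (S T)) SV ST.
by rewrite Dxy formal_curl subrr.
Qed.

Let C1 : K := T *+ 2 + f * g.
Let C2 : K := L * Dy f *+ 2 + Dx L * g + Dy L * f.

Let SC1 : S C1 = mu * C2.
Proof.
rewrite /C1 /C2 mulr2n !hshiftD hshiftM ST Sf Sg.
transitivity (mu * L * Dy f *+ 2 + mu * Dx L * g + f * (mu * Dy L)); last by ring.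
by rewrite formal_muL; ring.
Qed.

Let SC2 : S C2 = Dx (Dx C1) + Dy (Dy C1).
Proof.
(* L_xy = U_xy + V_xy is the Laplacian of T. This closes the system for C1 and C2, and is the reason
   for splitting L into U + V. *)
have E1 : Dx (Dy L) = Dx (Dx T) + Dy (Dy T).
  rewrite -formal_UT -formal_VT formal_L DyD DxD; congr (_ + _).
  by rewrite -Dxy.
have E2 : S (L * Dy f) = (Dx f + Dy g) * Dy f + Dx (Dy L) - mu * Dx L * Dy L.
  rewrite hshiftM SL -[S (Dy f)]/(Dy (S f)) Sf DyM Dmu // -Dxy.
  transitivity ((Dx f + Dy g) * Dy f + mu * L * Dx (Dy L) - mu * L * mu * Dx L * Dy L).
    by ring.
  by rewrite formal_muL; ring.
rewrite /C1 /C2 !mulr2n !hshiftD E2 !hshiftM Sf Sg.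
rewrite -[S (Dx L)]/(Dx (S L)) -[S (Dy L)]/(Dy (S L)) SL E1.
rewrite !(DxD, DyD, DxM, DyM) !(Dxy, formal_curl).
ring.
Qed.

(** The two are treated together: derivatives in x and y do not lower the order of vanishing in s,
    so the pair of equations carries the common order from n to n + 1. *)
Let C12 : C1 = 0 /\ C2 = 0.
Proof.
suff H n : vanish n C1 /\ vanish n C2.
  by split; apply/funext => n; [apply: (H n.+1).1|apply: (H n.+1).2].
elim: n => [//|n [v1 v2]]; split; apply: vanish_shift.
- by rewrite -[LHS]/(T 0%N *+ 2 + f 0%N * g 0%N) T0 f0 mul0r addr0 mul0rn.
- by rewrite SC1; exact: vanishM.
- rewrite -[LHS]/(L 0%N * dy (f 0%N) *+ 2 + dx (L 0%N) * g 0%N + dy (L 0%N) * f 0%N).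
  by rewrite f0 g0 (d0 dyD) !mulr0 mul0rn !addr0.
- by rewrite SC2; apply: vanishD; do 2 (apply: vanish_lift; first exact: d0).
Qed.

Lemma formal_T : T *+ 2 + f * g = 0. Proof. exact: C12.1. Qed.

Lemma formal_divergence : L * Dy f *+ 2 + Dx L * g + Dy L * f = 0.
Proof. exact: C12.2. Qed.

End formal_deformation.

(** * Majorants and convergence *)

Section binomial_convolution.
Variable A : comNzRingType.
Implicit Types u v : hurwitz A.

Lemma hmul_binE n u v :
  hmul n u v = \sum_(i < n.+1) (u i * v (n - i)%N) *+ 'C(n, i).
Proof.
elim: n u v => [u v|n IH u v] /=; first by rewrite big_ord1 bin0 mulr1n.
rewrite !IH [RHS]big_ord_recl bin0 mulr1n subn0.
under [X in _ = _ + X]eq_bigr => i _.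
  rewrite /= /bump leq0n add1n binS mulrnDr subSS.
  over.
rewrite big_split /=.
have -> : \sum_(i < n.+1) u i * hshift v (n - i)%N *+ 'C(n, i) =
    u 0%N * v n.+1 + \sum_(i < n.+1) u i.+1 * v (n - i)%N *+ 'C(n, i.+1).
  rewrite [LHS]big_ord_recl /= bin0 mulr1n subn0; congr (_ + _).
  rewrite [RHS]big_ord_recr /= bin_small // mulr0n addr0.
  apply: eq_bigr => i _; rewrite /= /bump leq0n add1n /hshift.
  by rewrite subnS prednK // subn_gt0.
by rewrite addrCA; congr (_ + _); exact: addrC.
Qed.

End binomial_convolution.

Section weights.
Variable R : realType.
Implicit Types (B C : nat -> R).

Lemma hmul_ge0 n B C : (forall k, 0 <= B k) -> (forall k, 0 <= C k) ->
  0 <= hmul n B C.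
Proof. by move=> B0 C0; rewrite hmul_binE sumr_ge0 // => i _; rewrite mulrn_wge0 ?mulr_ge0. Qed.

Lemma hmul_le n B C B' C' : (forall k, 0 <= B k <= B' k) -> (forall k, 0 <= C k <= C' k) ->
  hmul n B C <= hmul n B' C'.
Proof.
move=> BB CC; rewrite !hmul_binE ler_sum // => i _.
have /andP[? ?] := BB i; have /andP[? ?] := CC (n - i)%N.
by rewrite lerMn2r ler_pM ?orbT.
Qed.

Lemma hmulZr n B C (a : R) : hmul n B (fun k => a * C k) = a * hmul n B C.
Proof.
rewrite !hmul_binE mulr_sumr; apply: eq_bigr => i _.
by rewrite mulrCA mulrnAr.
Qed.

Variable r : R.
Hypothesis r0 : 0 < r.

(* The factor (N + 1)^-2 is what keeps the constants in [weight_conv] and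
   [weight_conv3_shift] independent of N, so that the majorants of the
   deformation equations close up. *)
Definition weight N : R := r ^+ N * N`!%:R / N.+1%:R ^+ 2.

Lemma weight_ge0 N : 0 <= weight N.
Proof. by rewrite /weight divr_ge0 ?mulr_ge0 ?exprn_ge0 ?ler0n // ltW. Qed.

Lemma sum_invsq_le N : \sum_(i < N.+1) (i.+1%:R ^- 2 : R) <= 2 - N.+1%:R^-1.
Proof.
elim: N => [|N IH]; first by rewrite big_ord1 expr1n !invr1; lra.
rewrite big_ord_recr /= (le_trans (lerD IH (lexx _))) //.
have n0 : 0 < (N.+1%:R : R) by rewrite ltr0n.
rewrite -(@natr1 _ N.+1); move: (N.+1%:R : R) n0 => t t0.
rewrite -subr_ge0.
have -> : 2 - (t + 1)^-1 - (2 - t^-1 + (t + 1) ^- 2) = t^-1 * (t + 1) ^- 2.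
  by field; rewrite !gt_eqF //; lra.
by rewrite mulr_ge0 // invr_ge0 ?exprn_ge0 //; lra.
Qed.

(** Factorials and powers of [r] cancel against the binomial coefficients. With p = i + 1 and q = N
    - i + 1 one has N + 1 <= p + q and (p + q)^2 <= 2 (p^2 + q^2), so what remains is at most twice
    two sums of inverse squares, each at most 2. *)
Lemma weight_conv N : hmul N weight weight <= 8 * weight N.
Proof.
have E (i : 'I_N.+1) : (weight i * weight (N - i)%N) *+ 'C(N, i) =
    r ^+ N * N`!%:R * (i.+1%:R ^- 2 * (N - i).+1%:R ^- 2).
  have iN : (i <= N)%N by rewrite -ltnS.
  have rN : r ^+ N = r ^+ i * r ^+ (N - i) by rewrite -exprD subnKC.
  rewrite /weight -mulr_natr -(bin_fact iN) !natrM rN.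
  by move: (_ ^- 2) (_ ^- 2) => a b; ring.
rewrite hmul_binE (eq_bigr _ (fun i _ => E i)) -mulr_sumr /weight.
rewrite mulrCA ler_pM2l; last by rewrite mulr_gt0 ?exprn_gt0 // ltr0n fact_gt0.
have n0 : 0 < (N.+1%:R : R) by rewrite ltr0n.
rewrite ler_pdivlMr ?exprn_gt0 // mulr_suml.
apply: (@le_trans _ _ (\sum_(i < N.+1) 2 * (i.+1%:R ^- 2 + (N - i).+1%:R ^- 2))).
  apply: ler_sum => i _.
  have iN : (i <= N)%N by rewrite -ltnS.
  have p0 : 0 < (i.+1%:R : R) by rewrite ltr0n.
  have q0 : 0 < ((N - i).+1%:R : R) by rewrite ltr0n.
  have pq : N.+1%:R <= i.+1%:R + (N - i).+1%:R :> R.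
    by rewrite -natrD ler_nat addSn addnS subnKC.
  move: (i.+1%:R : R) ((N - i).+1%:R : R) (N.+1%:R : R) p0 q0 n0 pq => p q n p0 q0 n0 pq.
  apply: (@le_trans _ _ (p ^- 2 * q ^- 2 * (p + q) ^+ 2)).
    rewrite ler_wpM2l //.
      by rewrite mulr_ge0 // invr_ge0 exprn_ge0 // ltW.
    by rewrite ler_pXn2r // nnegrE ltW // addr_gt0.
  rewrite -subr_ge0.
  have -> : 2 * (p ^- 2 + q ^- 2) - p ^- 2 * q ^- 2 * (p + q) ^+ 2 = (p^-1 - q^-1) ^+ 2.
    by field; rewrite !gt_eqF.
  exact: sqr_ge0.
rewrite -mulr_sumr big_split /=.
have -> : \sum_(i < N.+1) ((N - i).+1%:R ^- 2 : R) = \sum_(i < N.+1) (i.+1%:R ^- 2 : R).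
  rewrite [RHS](reindex_inj rev_ord_inj) /=; apply: eq_bigr => i _.
  by rewrite subSS.
have := sum_invsq_le N; have : 0 <= (N.+1%:R^-1 : R) by rewrite invr_ge0 ler0n.
by move: (\sum_(i < _) _) (_ ^-1) => a b; lra.
Qed.

(** One of the two nonnegative terms in the Leibniz expansion of the convolution of order N + 1. It
    absorbs the spatial derivative on the right of the evolution equations. *)
Lemma weight_conv_shift N : hmul N weight (fun k => weight k.+1) <= 8 * weight N.+1.
Proof.
apply: le_trans (weight_conv N.+1); rewrite /= lerDr.
by apply: hmul_ge0 => k; exact: weight_ge0.
Qed.

Lemma weight_conv3_shift N :
  hmul N weight (hmulr weight (fun k => weight k.+1)) <= 64 * weight N.+1.
Proof.
apply: (@le_trans _ _ (hmul N weight (fun k => 8 * weight k.+1))).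
  apply: hmul_le => k; first by rewrite weight_ge0 lexx.
  apply/andP; split; last exact: weight_conv_shift.
  by apply: hmul_ge0 => j; exact: weight_ge0.
rewrite hmulZr (_ : 64 = 8 * 8); last by ring.
by rewrite -mulrA ler_wpM2l // weight_conv_shift.
Qed.

End weights.

(** * Majorants for series of functions with all their partial derivatives *)

Section stream_bounds.
Variable R : realType.
Notation E := 'rV[R]_2.
Notation T := (tfun R).
Notation HT := (hurwitz (tfun R)).

Lemma partialsD w (f g : E -> R) : csm f -> csm g ->
  partials w (f \+ g) = partials w f \+ partials w g.
Proof.
move=> fs gs; elim: w => //= i w ->; rewrite partialD //; exact: csm_partials.
Qed.

Lemma tvalD (u v : T) : tval (u + v) = tval u \+ tval v.
Proof. by []. Qed.

Lemma tvalN (u : T) : tval (- u) = - tval u.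
Proof. by []. Qed.

Lemma tpartialE i (u : T) : tval (tpartial i u) = partial i u.
Proof. by []. Qed.

Lemma partialsN w (f : E -> R) : csm f -> partials w (- f) = - partials w f.
Proof.
move=> fs; have Nf : csm (- f).
  rewrite (_ : - f = cst (-1) \* f); first by apply: csmM => //; exact: csm_cst.
  by apply/funext => x; rewrite /= mulN1r.
have H : partials w (f \+ (- f)) = cst 0.
  rewrite (_ : _ \+ _ = cst 0); last by apply/funext => x /=; exact: subrr.
  by elim: w => //= i w ->; exact: partial_cst.
move: H; rewrite partialsD // => H; apply/funext => x.
have := congr1 (@^~ x) H; rewrite /= => /eqP.
by rewrite addrC addr_eq0 => /eqP.
Qed.

(** The majorant [B] is taken at the order in s plus the order in x and y, since one order in s
    costs one spatial derivative; the powers of [K] are the slack that absorbs constants. The cutoff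
    [n0] permits induction on the order in s. *)
Definition sbound n0 c K (B : nat -> R) (u : HT) := forall m w x, (m <= n0)%N ->
  `|partials w (u m) x| <= c * K ^+ m * B (m + size w)%N.

Lemma sbound_le n0 n1 c K B u : (n1 <= n0)%N -> sbound n0 c K B u -> sbound n1 c K B u.
Proof. by move=> n10 ub m w x mn; apply: ub; exact: leq_trans n10. Qed.

Lemma sboundD n0 c c' K B u v : sbound n0 c K B u -> sbound n0 c' K B v ->
  sbound n0 (c + c') K B (u + v).
Proof.
move=> ub vb m w x mn; rewrite -[(u + v) m]/(u m + v m) tvalD partialsD;
  [|exact: tfun_csm..].
by rewrite /= !mulrDl (le_trans (ler_normD _ _)) // lerD // ?ub ?vb.
Qed.

Lemma sbound_lift n0 c K B u i : sbound n0 c K B u ->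
  sbound n0 c K (fun k => B k.+1) (hlift (tpartial i) u).
Proof.
move=> ub m w x mn; rewrite /hlift tpartialE -partials_rcons.
by have := ub m (rcons w i) x mn; rewrite size_rcons addnS.
Qed.

Lemma sbound_shift n0 c K B u : sbound n0.+1 c K B u ->
  sbound n0 (c * K) K (fun k => B k.+1) (hshift u).
Proof.
move=> ub m w x mn; rewrite /hshift.
by have := ub m.+1 w x mn; rewrite exprS mulrA addSn.
Qed.

(** Induction on the total order: one derivative, spatial as long as there is one and otherwise in
    s, is distributed by the Leibniz rule, which matches the recursion of [hmul] on the majorants.
    [B] and [C] must be general because each derivative shifts them. *)
Lemma sboundM n0 c c' K B C u v : sbound n0 c K B u -> sbound n0 c' K C v ->
  sbound n0 (c * c') K (fun k => hmul k B C) (u * v).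
Proof.
move=> ub vb m w; move: {2}(m + size w)%N (leqnn (m + size w)) => N.
elim: N n0 c c' B C u v ub vb m w => [|N IH] n0 c c' B C u v ub vb m w mN x mn.
  move: mN; rewrite leqn0 addn_eq0 => /andP[/eqP m0 /eqP/size0nil w0].
  rewrite {}m0 {}w0 in mn *.
  rewrite -[X in X <= _]/(`|u 0%N x * v 0%N x|) -[X in _ <= X]/(c * c' * 1 * (B 0%N * C 0%N)) mulr1 normrM.
  rewrite mulrACA; apply: ler_pM => //.
    by have := ub 0%N [::] x mn; rewrite /= ?addn0 expr0 mulr1.
  by have := vb 0%N [::] x mn; rewrite /= ?addn0 expr0 mulr1.
case/lastP: w mN => [|w i] mN.
  case: m mn mN => [|m] mn mN; last first.
    rewrite -[(u * v) m.+1]/(hmul m (hshift u) v + hmul m u (hshift v)) tvalD /= addn0.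
    case: n0 ub vb mn => // n0 ub vb mn.
    rewrite exprS addn0 ltnS in mN *.
    have b1 := IH _ _ _ _ _ _ _ (sbound_shift ub) (sbound_le (leqnSn _) vb) m [::].
    have b2 := IH _ _ _ _ _ _ _ (sbound_le (leqnSn _) ub) (sbound_shift vb) m [::].
    move: b1 b2; rewrite addn0 => /(_ mN x mn) b1 /(_ mN x mn) b2.
    apply: le_trans (ler_normD _ _) _; apply: le_trans (lerD b1 b2) _.
    rewrite le_eqVlt; apply/orP; left; apply/eqP.
    by rewrite mulrDr; congr (_ + _); ring.
  rewrite -[X in X <= _]/(`|u 0%N x * v 0%N x|) -[X in _ <= X]/(c * c' * 1 * (B 0%N * C 0%N)) mulr1 normrM.
  rewrite mulrACA; apply: ler_pM => //.
    by have := ub 0%N [::] x mn; rewrite /= ?addn0 expr0 mulr1.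
  by have := vb 0%N [::] x mn; rewrite /= ?addn0 expr0 mulr1.
rewrite size_rcons addnS in mN *.
rewrite partials_rcons -tpartialE -[tpartial i ((u * v) m)]/(hlift (tpartial i) (u * v) m).
rewrite (hliftM (@tpartialD R i) (@tpartialM R i)).
rewrite -[(_ + _ : HT) m]/((hlift (tpartial i) u * v) m + (u * hlift (tpartial i) v) m).
rewrite tvalD partialsD; [|exact: tfun_csm..].
have b1 := IH _ _ _ _ _ _ _ (sbound_lift i ub) vb m w mN x mn.
have b2 := IH _ _ _ _ _ _ _ ub (sbound_lift i vb) m w mN x mn.
apply: le_trans (ler_normD _ _) _; apply: le_trans (lerD b1 b2) _.
by rewrite -mulrDr.
Qed.

Lemma sboundW n0 c K B B' u : 0 <= c -> 0 <= K -> (forall k, B k <= B' k) ->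
  sbound n0 c K B u -> sbound n0 c K B' u.
Proof.
move=> c0 K0 BB ub m w x mn; apply: le_trans (ub m w x mn) _.
by rewrite ler_wpM2l // mulr_ge0 // exprn_ge0.
Qed.

Lemma sboundZ n0 c a K B u : sbound n0 c K (fun k => a * B k) u -> sbound n0 (a * c) K B u.
Proof.
move=> ub m w x mn; apply: le_trans (ub m w x mn) _.
by rewrite le_eqVlt; apply/orP; left; apply/eqP; ring.
Qed.

Lemma sboundN n0 c K B u : sbound n0 c K B u -> sbound n0 c K B (- u).
Proof.
move=> ub m w x mn; rewrite -[(- u) m]/(- u m) tvalN partialsN; last exact: tfun_csm.
by rewrite -[(- _) x]/(- partials w (u m) x) normrN ub.
Qed.

(** Going back from u_s to u, the order in s takes the place of the lost derivative in the index of
    [B], and the constant gains a factor 1 / K. Taking [K] large is what makes the estimates close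
    up. *)
Lemma sbound_unshift n0 (c c' K : R) (B : nat -> R) (u : HT) : 0 <= K -> (forall k, 0 <= B k) -> c <= c' * K ->
  (forall w x, `|partials w (u 0%N) x| <= c' * B (size w)) ->
  sbound n0 c K (fun k => B k.+1) (hshift u) -> sbound n0.+1 c' K B u.
Proof.
move=> K0 B0 cc u0 ub [|m] w x mn; first by rewrite expr0 mulr1; exact: u0.
apply: le_trans (ub m w x mn) _.
by rewrite exprS mulrA addSn !ler_wpM2r ?exprn_ge0.
Qed.

Lemma deformation_bounds (r b m : R) (L f g mu : HT) : 0 < r -> 0 < b -> 0 < m ->
  (forall w x, `|partials w (L 0%N) x| <= b * weight r (size w)) ->
  (forall w x, `|partials w (mu 0%N) x| <= m * weight r (size w)) ->
  f 0%N = 0 -> g 0%N = 0 ->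
  hshift L = hlift (tpartial 0) f + hlift (tpartial 1) g ->
  hshift f = mu * hlift (tpartial 0) L -> hshift g = mu * hlift (tpartial 1) L ->
  hshift mu = - (mu * (mu * (hlift (tpartial 0) f + hlift (tpartial 1) g))) ->
  exists2 K, 1 <= K & 2 <= b * K /\ forall n0,
    [/\ sbound n0 b K (weight r) L, sbound n0 1 K (weight r) f,
        sbound n0 1 K (weight r) g & sbound n0 m K (weight r) mu].
Proof.
move=> r0 b0 m0 L0 mu0 f0 g0 SL Sf Sg Smu.
have W0 k : 0 <= weight r k by apply: weight_ge0.
(* Large enough for 2 <= b K in the equation of [L], 8 m b <= K in those of [f] and [g], and 128 m
   <= K in that of [mu]; 8 and 64 are the constants of the convolution lemmas, and 2 counts the
   terms of f_x + g_y. *)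
pose K := 1 + 2 / b + 8 * m * b + 128 * m.
have b2 : 0 < 2 / b by rewrite divr_gt0.
have mb : 0 < m * b by rewrite mulr_gt0.
have K1 : 1 <= K by rewrite /K; lra.
have K0 : 0 <= K by lra.
have Kb : 2 <= b * K.
  rewrite -ler_pdivrMl // mulrC /K; lra.
have Kf : 8 * (m * b) <= 1 * K by rewrite mul1r /K; lra.
have Km : 64 * (m * (m * (1 + 1))) <= m * K.
  rewrite (_ : 64 * _ = m * (128 * m)); last by ring.
  by rewrite ler_wpM2l ?(ltW m0) // /K; lra.
have F0 (u : HT) : u 0%N = 0 -> forall w x, `|partials w (u 0%N) x| <= 1 * weight r (size w).
  move=> -> w x; rewrite mul1r (_ : partials w _ = cst 0) ?normr0 //.
  rewrite (_ : tval 0 = cst 0) //.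
  by elim: w => //= i w ->; exact: partial_cst.
exists K => //; split => //; elim=> [|n [bL bf bg bm]].
  split=> -[|//] w x _; rewrite expr0 mulr1 add0n;
    by [exact: L0|exact: F0|exact: mu0].
have bfg := sboundD (sbound_lift 0 bf) (sbound_lift 1 bg).
split; apply: (sbound_unshift K0 W0).
- exact: Kb.
- exact: L0.
- by rewrite SL -[2]/(1 + 1).
- exact: Kf.
- exact: F0.
- rewrite Sf; apply/sboundZ; apply: sboundW (sboundM bm (sbound_lift 0 bL)) => //.
    exact: ltW.
  by move=> k; exact: weight_conv_shift.
- exact: Kf.
- exact: F0.
- rewrite Sg; apply/sboundZ; apply: sboundW (sboundM bm (sbound_lift 1 bL)) => //.
    exact: ltW.
  by move=> k; exact: weight_conv_shift.
- exact: Km.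
- exact: mu0.
- rewrite Smu; apply/sboundN/sboundZ; apply: sboundW (sboundM bm (sboundM bm bfg)) => //.
    by rewrite !mulr_ge0 // ltW.
  by move=> k; exact: weight_conv3_shift.
Qed.

End stream_bounds.

(** * The initial data and explicit bounds for their derivatives *)

Section initial_data.
Variable R : realType.
Notation E := 'rV[R]_2.
Notation T := (tfun R).

Lemma partial_line (f : E -> R) i x df :
  is_derive (0 : R) (1 : R) (fun h : R => f (x + h *: @ebase R i)) df -> partial i f x = df.
Proof.
case=> _ <-; rewrite partialE.
apply: (congr1 (fun F : R -> R => lim (F @ (0 : R)^'))); apply/funext => h /=.
congr (_ *: (f _ - f _)); last by rewrite scale0r addr0.
by rewrite addrC; congr (_ + _ *: _); rewrite addr0; exact/esym/mulr1.
Qed.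

(** The phase is free because differentiating a cosine advances it by pi / 2: all derivatives stay
    in this family and only amplitudes need bounding. *)
Definition wave i (a b : R) : E -> R := fun x => a * cos (2 * pi * x 0 i + b).

Lemma wave_differentiable i a b x : differentiable (wave i a b) x.
Proof.
have -> : wave i a b = a \*: (cos \o (fun x : E => 2 * pi * x 0 i + b)).
  by apply/funext.
apply: differentiableZ; apply: differentiable_comp.
  apply: differentiableD; last exact: differentiable_cst.
  by apply: (@differentiableZ R E R^o); exact: differentiable_coord.
by apply/derivable1_diffP; exact: derivable_cos.
Qed.

Lemma partial_wave i j a b :
  partial j (wave i a b) = wave i ((i == j)%:R * (2 * pi * a)) (b + pi / 2).
Proof.
apply/funext => x; apply: partial_line; rewrite /wave.
have -> : (fun h : R => a * cos (2 * pi * (x + h *: @ebase R j) 0 i + b)) =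
    (fun h : R => a * cos ((2 * pi * x 0 i + b) + h * (2 * pi * (i == j)%:R))).
  apply/funext => h; rewrite !mxE eqxx /=; congr (_ * cos _).
  by rewrite eq_sym; ring.
apply: is_derive_eq.
rewrite addrA cosDpihalf mul0r addr0 /GRing.scale /=.
by move: (sin _) => s; ring.
Qed.

Lemma csm_wave i a b : csm (wave i a b).
Proof.
apply: (@csm_coind R (fun f => exists a b, f = wave i a b)); last by exists a, b.
move=> _ [a' [b' ->]]; split => [x|j]; first exact: wave_differentiable.
by exists ((i == j)%:R * (2 * pi * a')), (b' + pi / 2); rewrite partial_wave.
Qed.

Lemma wave_bound i a b w x : `|partials w (wave i a b) x| <= `|a| * (2 * pi) ^+ size w.
Proof.
have [a' [b' [-> aa]]] : exists a' b', partials w (wave i a b) = wave i a' b' /\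
    `|a'| <= `|a| * (2 * pi) ^+ size w.
  elim: w => [|j w [a' [b' [E1 aa]]]] /=; first by exists a, b; rewrite expr0 mulr1.
  exists ((i == j)%:R * (2 * pi * a')), (b' + pi / 2); rewrite E1 partial_wave.
  split => //; rewrite normrM exprS mulrCA -[leRHS]mul1r ler_pM //.
    by rewrite normr_nat; case: (i == j).
  by rewrite normrM ger0_norm ?mulr_ge0 ?pi_ge0 // ler_wpM2l // mulr_ge0 // pi_ge0.
by apply: le_trans aa; rewrite /wave normrM ler_piMr // cos_max.
Qed.

Lemma wave_periodic i a b : Z2_periodic (wave i a b).
Proof.
move=> j x; rewrite /wave mxE ebaseE; congr (_ * _).
case: (j == i); last by rewrite addr0.
rewrite -[RHS]cosD2pi; congr cos.
by rewrite -[pi *+ 2]mulr_natl /=; ring.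
Qed.

Definition twave i (a b : R) : T := mk_tfun (@csm_wave i a b) (@wave_periodic i a b).
Definition tconst (a : R) : T :=
  mk_tfun (@csm_cst R a) (fun _ _ => erefl).

Definition U_init : T := tconst 4 + twave 0 1 0.
Definition V_init : T := twave 1 1 0.
Definition L_init : T := U_init + V_init.

Lemma L_initE x : L_init x = 4 + cos (2 * pi * x 0 0) + cos (2 * pi * x 0 1).
Proof. by rewrite -[LHS]/(4 + 1 * cos (_ + 0) + 1 * cos (_ + 0)) !mul1r !addr0. Qed.

Lemma L_init_ge2 x : 2 <= L_init x.
Proof.
rewrite L_initE; have := cos_geN1 (2 * pi * x 0 0); have := cos_geN1 (2 * pi * x 0 1).
by move: (cos _) (cos _) => a b; lra.
Qed.

Lemma L_init_neq0 x : L_init x != 0.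
Proof. by rewrite gt_eqF // (lt_le_trans _ (L_init_ge2 x)). Qed.

Lemma inv_periodic (f : E -> R) : Z2_periodic f -> Z2_periodic (fun x => (f x)^-1).
Proof. by move=> fp i x; rewrite fp. Qed.

Definition mu_init : T :=
  mk_tfun (csmV (@tfun_csm R L_init) L_init_neq0) (inv_periodic (@tfun_periodic R L_init)).

Lemma mu_initE : mu_init * L_init = 1.
Proof.
by apply: tfun_ext => x; rewrite -[LHS]/((L_init x)^-1 * L_init x) mulVf // L_init_neq0.
Qed.

Lemma V_init_dx : tpartial 0 V_init = 0.
Proof.
apply/val_inj; rewrite -[LHS]/(partial 0 (wave 1 1 0)) partial_wave.
by apply/funext => x; rewrite /wave /= !mul0r.
Qed.

Lemma U_init_dy : tpartial 1 U_init = 0.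
Proof.
rewrite tpartialD -[RHS]addr0; congr (_ + _); apply/val_inj.
  by rewrite -[LHS]/(partial 1 (cst 4)) partial_cst.
rewrite -[LHS]/(partial 1 (wave 0 1 0)) partial_wave.
by apply/funext => x; rewrite /wave /= !mul0r.
Qed.

Lemma leibniz_bound (u v : E -> R) (B C : nat -> R) w x : csm u -> csm v ->
  (forall w', (size w' <= size w)%N -> `|partials w' u x| <= B (size w')) ->
  (forall w', (size w' <= size w)%N -> `|partials w' v x| <= C (size w')) ->
  `|partials w (u \* v) x| <= hmul (size w) B C.
Proof.
elim/last_ind: w u v B C => [|w i IH] u v B C us vs uB vC.
  rewrite /= normrM; apply: ler_pM => //.
    by have := uB [::]; apply.
  by have := vC [::]; apply.
rewrite size_rcons in uB vC *.
rewrite partials_rcons partialM // partialsD;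
  [|by apply: csmM => //; exact: csm_partial..].
apply: le_trans (ler_normD _ _) _; apply: lerD; apply: IH => //;
  try exact: csm_partial; move=> w' ww'; rewrite -?partials_rcons.
- by have := uB (rcons w' i); rewrite size_rcons; apply.
- by apply: vC; exact: leqW.
- by apply: uB; exact: leqW.
- by have := vC (rcons w' i); rewrite size_rcons; apply.
Qed.

(** Isolates the term in which all derivatives fall on [v]. When the product is known, here the
    constant 1, this estimates a derivative of [v] by strictly shorter ones. *)
Lemma leibniz_remainder_bound (u v : E -> R) (B C : nat -> R) w x : csm u -> csm v ->
  (forall w', (size w' <= size w)%N -> `|partials w' u x| <= B (size w')) ->
  (forall w', (size w' < size w)%N -> `|partials w' v x| <= C (size w')) ->
  `|partials w (u \* v) x - u x * partials w v x| <=
    hmul (size w) B C - B 0%N * C (size w).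
Proof.
elim/last_ind: w u v B C => [|w i IH] u v B C us vs uB vC.
  by rewrite /= !subrr normr0.
rewrite size_rcons in uB vC *.
rewrite !partials_rcons partialM // partialsD;
  [|by apply: csmM => //; exact: csm_partial..].
rewrite /= -!addrA; apply: le_trans (ler_normD _ _) _; apply: lerD.
  apply: leibniz_bound => //; first exact: csm_partial.
  by move=> w' ww'; rewrite -partials_rcons; have := uB (rcons w' i); rewrite size_rcons; apply.
apply: (IH u (partial i v) B (hshift C)) => //; first exact: csm_partial.
- by move=> w' ww'; apply: uB; exact: leqW.
- by move=> w' ww'; rewrite -partials_rcons; have := vC (rcons w' i); rewrite size_rcons; apply.
Qed.

Lemma partials_cst w (a : R) x : `|partials w (cst a : E -> R) x| <= `|a|.
Proof.
have [b [-> ba]] : exists b, partials w (cst a) = (cst b : E -> R) /\ `|b| <= `|a|.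
  elim: w => [|i w [b [E1 ba]]] /=; first by exists a.
  by exists 0; rewrite E1 partial_cst normr0.
exact: ba.
Qed.

Let c : R := 2 * pi.
(** 32 is 4 times 8: the powers of 4 dominate the factors (j + 1)^2 lost to the denominators of
    [weight], and the inverse powers of 8 leave the convergent geometric series of
    [hmul_pow_weight]. *)
Let r : R := 32 * c.

Let c1 : 1 <= c.
Proof. by have := pi_ge2 R; rewrite /c; lra. Qed.

Lemma L_init_pow w x : `|partials w (L_init : E -> R) x| <= 6 * c ^+ size w.
Proof.
rewrite (_ : tval L_init = (cst 4 \+ wave 0 1 0) \+ wave 1 1 0) //.
have cs1 := csmD (@csm_cst R 4) (csm_wave 0 1 0).
rewrite partialsD //; last exact: csm_wave.
rewrite partialsD //; [|exact: csm_cst|exact: csm_wave].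
have := partials_cst w 4 x; have := wave_bound 0 1 0 w x; have := wave_bound 1 1 0 w x.
have : 1 <= c ^+ size w by rewrite exprn_ege1.
rewrite normr1 !mul1r -/c /= (ger0_norm (_ : 0 <= 4)) //.
move: (partials _ _ _) (partials _ _ _) (partials _ _ _) (c ^+ _) => p q s t t1 h1 h2 h3.
apply: le_trans (ler_normD _ _) _; apply: le_trans (lerD (ler_normD _ _) (lexx _)) _; lra.
Qed.

Let r0 : 0 < r.
Proof. by have := c1; rewrite /r; lra. Qed.

Lemma succ_sq_le_exp j : (j.+1%:R ^+ 2 : R) <= 4 ^+ j.
Proof.
have -> : 4 ^+ j = (2 ^+ j) ^+ 2 :> R.
  by rewrite -exprM mulnC exprM; congr (_ ^+ j); rewrite expr2 -natrM.
by rewrite ler_pXn2r ?nnegrE ?exprn_ge0 ?ler0n // -natrX ler_nat ltn_expl.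
Qed.

Lemma pow_weight k : c ^+ k <= weight r k.
Proof.
rewrite /weight ler_pdivlMr ?exprn_gt0 ?ltr0n // /r.
move: c c1 => c' c1'; rewrite exprMn [32 ^+ k * _]mulrC -!mulrA ler_wpM2l ?exprn_ge0 //.
  by lra.
apply: (@le_trans _ _ (32 ^+ k * 1)); last first.
  by rewrite ler_wpM2l ?exprn_ge0 // ler1n fact_gt0.
rewrite mulr1; apply: le_trans (succ_sq_le_exp k) _.
by rewrite lerXn2r ?nnegrE //; lra.
Qed.

Lemma L_init_bound w x : `|partials w (L_init : E -> R) x| <= 6 * weight r (size w).
Proof.
by apply: le_trans (L_init_pow w x) _; rewrite ler_wpM2l // pow_weight.
Qed.

(** The term of index j >= 1 is at most 6 times 8^-j times [weight r k], and these powers sum to at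
    most 1 / 3. The resulting constant 2 matches the lower bound of [L_init]. *)
Lemma hmul_pow_weight k :
  hmul k (fun j => 6 * c ^+ j) (weight r) - 6 * c ^+ 0 * weight r k <= 2 * weight r k.
Proof.
rewrite hmul_binE big_ord_recl /= bin0 mulr1n subn0 addrC addKr.
apply: (@le_trans _ _ (\sum_(i < k) 6 * weight r k * (8^-1) ^+ i.+1)).
  apply: ler_sum => i _; rewrite /bump leq0n add1n.
  move: (i.+1) (ltn_ord i) => j jk.
  rewrite /weight -(bin_fact jk) -mulr_natr !natrM.
  have -> : r ^+ k = r ^+ j * r ^+ (k - j) by rewrite -exprD subnKC.
  rewrite -subr_ge0.
  set p : R := (k - j).+1%:R; set q : R := k.+1%:R.
  have p0 : 0 < p by rewrite ltr0n.
  have q0 : 0 < q by rewrite ltr0n.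
  have -> : 6 * (r ^+ j * r ^+ (k - j) * ('C(k, j)%:R * (j`!%:R * (k - j)`!%:R)) / q ^+ 2) * 8^-1 ^+ j
     - 6 * c ^+ j * (r ^+ (k - j) * (k - j)`!%:R / p ^+ 2) * 'C(k, j)%:R =
     6 * r ^+ (k - j) * (k - j)`!%:R * 'C(k, j)%:R * c ^+ j * (q ^- 2 * p ^- 2) *
     (4 ^+ j * j`!%:R * p ^+ 2 - q ^+ 2).
    have -> : r ^+ j = c ^+ j * 4 ^+ j * 8 ^+ j.
      by rewrite -!exprMn /r; congr (_ ^+ j); move: c => c'; ring.
    rewrite exprVn; move: (c ^+ j) (r ^+ (k - j)) => cj rkj.
    have e8 : (8 ^+ j : R) != 0 by rewrite expf_neq0.
    by field; rewrite e8 !gt_eqF.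
  rewrite mulr_ge0 //.
    by rewrite !mulr_ge0 ?invr_ge0 ?exprn_ge0 ?ler0n // ltW //; have := c1; lra.
  rewrite subr_ge0.
  apply: (@le_trans _ _ (j.+1%:R ^+ 2 * p ^+ 2)).
    rewrite -exprMn ler_pXn2r ?nnegrE ?mulr_ge0 ?ler0n //.
    rewrite -natrM ler_nat; nia.
  apply: ler_wpM2r; first by rewrite exprn_ge0 // ltW.
  apply: le_trans (succ_sq_le_exp j) _.
  by rewrite -[leLHS]mulr1 ler_wpM2l ?exprn_ge0 // ler1n fact_gt0.
rewrite -mulr_sumr mulrAC ler_wpM2r ?weight_ge0 //.
have H : \sum_(i < k) 8^-1 ^+ i.+1 <= 1 / 3 - (8^-1) ^+ k / 3 :> R.
  elim: k => [|k IH]; first by rewrite big_ord0; lra.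
  rewrite big_ord_recr /= (le_trans (lerD IH (lexx _))) // exprS.
  have : 0 <= (8^-1 ^+ k : R) by rewrite exprn_ge0 // invr_ge0.
  by move: (_ ^+ k) => t t0; lra.
have : 0 <= (8^-1 ^+ k : R) by rewrite exprn_ge0 // invr_ge0.
move: H; move: (\sum_(i < k) _) (8^-1 ^+ k) => s t ? ?; lra.
Qed.

(** Differentiating L mu = 1 along a nonempty word, L times the derivative of mu is minus the
    Leibniz remainder, which involves shorter words only. Division by L >= 2 then reproduces the
    majorant. *)
Lemma mu_init_bound w x : `|partials w (mu_init : E -> R) x| <= 1 * weight r (size w).
Proof.
rewrite mul1r; move: {2}(size w) (erefl (size w)) => k.
elim/ltn_ind: k w x => k IH w x wk.
have H := @leibniz_remainder_bound L_init mu_init (fun j => 6 * c ^+ j) (weight r) w x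
  (tfun_csm _) (tfun_csm _).
have {}H : `|partials w (L_init \* mu_init) x - L_init x * partials w mu_init x| <=
    hmul (size w) (fun j => 6 * c ^+ j) (weight r) - 6 * c ^+ 0 * weight r (size w).
  apply: H => w' ww'; first exact: L_init_pow.
  by apply: (IH (size w')) => //; rewrite -wk.
have L2 := L_init_ge2 x.
have {}H := le_trans H (hmul_pow_weight (size w)).
move: H; rewrite (_ : tval L_init \* tval mu_init = cst 1); last first.
  by apply/funext => y /=; rewrite mulfV // L_init_neq0.
case: w wk => [|i w] wk.
  move=> _; have L1 : 1 <= L_init x by apply: le_trans L2; lra.
  have L0 : 0 < L_init x by apply: lt_le_trans L1.
  rewrite -[leLHS]/(`|(L_init x)^-1|) -[leRHS]/(1 * 1 / 1 ^+ 2).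
  by rewrite ger0_norm ?invr_ge0 ?(ltW L0) // !(expr1n, invr1, mulr1) invf_le1.
have -> : partials (i :: w) (cst 1 : E -> R) = cst 0.
  rewrite /=; suff [b ->] : exists b, partials w (cst 1 : E -> R) = cst b by rewrite partial_cst.
  elim: (w) => [|j w' [b E1]] /=; first by exists 1.
  by exists 0; rewrite E1 partial_cst.
rewrite /cst sub0r normrN normrM ger0_norm; last by lra.
move=> H; rewrite -(@ler_pM2l _ 2) //; apply: le_trans H.
by rewrite ler_wpM2r.
Qed.

End initial_data.

(** * Numerical series dominated by geometric ones *)

Section geometric_sums.
Variable R : realType.
Implicit Types (a b : nat -> R) (M : R).

Definition geo_le M a := forall n, `|a n| <= M * 2 ^- n.

Definition Sum a : R := limn (series a).

Lemma geo_le_ge0 M a : geo_le M a -> 0 <= M.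
Proof. by move=> /(_ 0%N); rewrite expr0 invr1 mulr1; exact: le_trans. Qed.

Lemma half_geoE M n : M * 2 ^- n = geometric M (2^-1) n.
Proof. by rewrite /geometric /= exprVn. Qed.

Lemma half_lt1 : `|2^-1 : R| < 1.
Proof. by rewrite ger0_norm ?invr_ge0 // invf_lt1 // ltr1n. Qed.

Lemma cvg_half_geo M : series (fun n => M * 2 ^- n) @ \oo --> 2 * M.
Proof.
rewrite (_ : (fun n => _) = geometric M (2^-1)).
  rewrite (_ : 2 * M = M * (1 - 2^-1)^-1); first exact: cvg_geometric_series half_lt1.
  by field.
by apply/funext => n; exact: half_geoE.
Qed.

Lemma geo_normed_cvg M a : geo_le M a -> cvgn [normed series a].
Proof.
move=> aM; apply: (series_le_cvg _ _ aM).
- by move=> n.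
- by move=> n; rewrite mulr_ge0 ?(geo_le_ge0 aM) // invr_ge0 exprn_ge0.
- by apply/cvg_ex; exists (2 * M); exact: cvg_half_geo.
Qed.

Lemma geo_cvg M a : geo_le M a -> cvgn (series a).
Proof. by move=> /geo_normed_cvg; exact: normed_cvg. Qed.

Lemma Sum_le M a : geo_le M a -> `|Sum a| <= 2 * M.
Proof.
move=> aM; apply: le_trans (lim_series_norm (geo_normed_cvg aM)) _.
rewrite -(cvg_lim (@Rhausdorff R) (@cvg_half_geo M)).
apply: lim_series_le => //; first exact: geo_normed_cvg aM.
by apply/cvg_ex; exists (2 * M); exact: cvg_half_geo.
Qed.

Lemma geoD M N a b : geo_le M a -> geo_le N b -> geo_le (M + N) (fun n => a n + b n).
Proof.
by move=> aM bN n; rewrite mulrDl (le_trans (ler_normD _ _)) // lerD.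
Qed.

Lemma geoZ M k a : geo_le M a -> geo_le (`|k| * M) (fun n => k * a n).
Proof. by move=> aM n; rewrite normrM -mulrA ler_wpM2l. Qed.

Lemma geoN M a : geo_le M a -> geo_le M (fun n => - a n).
Proof. by move=> aM n; rewrite normrN. Qed.

Lemma SumD M N a b : geo_le M a -> geo_le N b ->
  Sum (fun n => a n + b n) = Sum a + Sum b.
Proof. by move=> /geo_cvg ca /geo_cvg cb; exact: lim_seriesD. Qed.

Lemma SumZ M k a : geo_le M a -> Sum (fun n => k * a n) = k * Sum a.
Proof. by move=> /geo_cvg ca; exact: lim_seriesZ. Qed.

Lemma SumN M a : geo_le M a -> Sum (fun n => - a n) = - Sum a.
Proof. by move=> /geo_cvg ca; exact: lim_seriesN. Qed.

End geometric_sums.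

(** * Term-by-term differentiation *)

Section sum_of_smooth.
Variable R : realType.
Notation E := 'rV[R]_2.

Opaque partial.

Lemma norm_lin_le (a b c d p q : R) : `|a| <= p -> `|b| <= p -> `|c| <= q -> `|d| <= q ->
  `|a * c + b * d| <= 2 * q * p.
Proof.
move=> ap bp cq dq; apply: le_trans (ler_normD _ _) _; rewrite !normrM.
rewrite (_ : 2 * q * p = p * q + p * q); last by ring.
by apply: lerD; apply: ler_pM.
Qed.

(** Two mean value steps along the segment; each directional derivative costs a factor 2 in the sup
    norm, whence the 4. *)
Lemma second_order_bound (f : E -> R) (B : R) x v : csm f ->
  (forall i j (t : R), 0 <= t <= 1 -> `|partial i (partial j f) (x + t *: v)| <= B) ->
  `|f (x + v) - f x - lin2 (partial 0 f x) (partial 1 f x) v| <= 4 * B * `|v| ^+ 2.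
Proof.
move=> fs fB.
have B0 : 0 <= B.
  by apply: le_trans (fB 0 0 0 _); [exact: normr_ge0|rewrite lexx ler01].
have [|t /andP[t0 t1] ->] := @line_MVT R f x v.
  by move=> t _; exact: csm_derivable.
have tv : `|t *: v| <= `|v| by rewrite normrZ ger0_norm // ler_piMl.
have H i : `|partial i f (x + t *: v) - partial i f x| <= 2 * B * `|v|.
  have fis := csm_partial i fs.
  have [|u /andP[u0 u1] ->] := @line_MVT R (partial i f) x (t *: v).
    by move=> u _; exact: csm_derivable.
  have ut : 0 <= u * t <= 1 by rewrite mulr_ge0 // mulr_ile1.
  rewrite csm_deriveE // norm_lin_le //; try exact: le_trans (coord_le _ _) tv.
    by rewrite scalerA; exact: fB.
  by rewrite scalerA; exact: fB.
rewrite csm_deriveE // /lin2.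
have -> : v 0 0 * partial 0 f (x + t *: v) + v 0 1 * partial 1 f (x + t *: v) -
    (v 0 0 * partial 0 f x + v 0 1 * partial 1 f x) =
  v 0 0 * (partial 0 f (x + t *: v) - partial 0 f x) +
  v 0 1 * (partial 1 f (x + t *: v) - partial 1 f x).
  by move: (partial _ _ _) (partial _ _ _) (partial _ _ _) (partial _ _ _) => p q p' q'; ring.
rewrite (_ : 4 * B * _ = 2 * (2 * B * `|v|) * `|v|); last by ring.
exact: (norm_lin_le (coord_le _ _) (coord_le _ _) (H 0) (H 1)).
Qed.

(** The bound is uniform in the point and depends on the word only through its length, so the notion
    is stable under partials, with [M] shifted. *)
Definition geo_family (h : nat -> E -> R) (M : nat -> R) :=
  (forall n, csm (h n)) /\ forall w x, geo_le (M (size w)) (fun n => partials w (h n) x).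

Lemma geo_family_partial h M i : geo_family h M ->
  geo_family (fun n => partial i (h n)) (fun k => M k.+1).
Proof.
move=> [hs hM]; split => [n|w x n]; first exact: csm_partial.
by have := hM (rcons w i) x n; rewrite partials_rcons size_rcons.
Qed.

(** The first-order remainders of the terms are summed: each is at most 4 [M 2] |v|^2 2^-n, so their
    total is quadratic in v. *)
Lemma geo_family_diff h M x : geo_family h M ->
  differentiable (fun y => Sum (fun n => h n y)) x /\
  'd (fun y => Sum (fun n => h n y)) x =
  lin2 (Sum (fun n => partial 0 (h n) x)) (Sum (fun n => partial 1 (h n) x)) :> (E -> R).
Proof.
move=> [hs hM]; pose C := 8 * M 2%N.
have M2 : 0 <= M 2%N := geo_le_ge0 (hM [:: 0; 0] x).
apply: differentiable_approx => e e0; exists (e / (C + 1)).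
  by rewrite divr_gt0 // /C; lra.
move=> v ve.
pose rem n := h n (x + v) - h n x - lin2 (partial 0 (h n) x) (partial 1 (h n) x) v.
have remM : geo_le (4 * M 2%N * `|v| ^+ 2) rem.
  move=> n; have := @second_order_bound (h n) (M 2%N * 2 ^- n) x v (hs n).
  rewrite (_ : 4 * (M 2%N * 2 ^- n) * _ = 4 * M 2%N * `|v| ^+ 2 * 2 ^- n); last by ring.
  by apply=> i j t _; exact: (hM [:: i; j] (x + t *: v) n).
have h0 y : geo_le (M 0%N) (fun n => h n y) := hM [::] y.
have h1 i : geo_le (M 1%N) (fun n => partial i (h n) x) := hM [:: i] x.
have remE : Sum rem = Sum (fun n => h n (x + v)) - Sum (fun n => h n x) -
    lin2 (Sum (fun n => partial 0 (h n) x)) (Sum (fun n => partial 1 (h n) x)) v.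
  rewrite /lin2 -(SumZ (v 0 0) (h1 0)) -(SumZ (v 0 1) (h1 1)).
  rewrite -(SumD (geoZ (v 0 0) (h1 0)) (geoZ (v 0 1) (h1 1))).
  rewrite -(SumN (h0 x)) -(SumD (h0 (x + v)) (geoN (h0 x))).
  rewrite -(SumN (geoD (geoZ (v 0 0) (h1 0)) (geoZ (v 0 1) (h1 1)))).
  by rewrite -(SumD (geoD (h0 (x + v)) (geoN (h0 x)))
     (geoN (geoD (geoZ (v 0 0) (h1 0)) (geoZ (v 0 1) (h1 1))))).
rewrite -remE; apply: le_trans (Sum_le remM) _.
rewrite (_ : 2 * _ = (C * `|v|) * `|v|); last by rewrite /C; ring.
rewrite ler_wpM2r //.
have C0 : 0 <= C by rewrite /C mulr_ge0.
have C1 : 0 < C + 1 by lra.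
move: ve; rewrite ltr_pdivlMr // => ve.
apply: le_trans (ltW ve); rewrite mulrC ler_wpM2l //; lra.
Qed.

Lemma geo_family_partialE h M i x : geo_family h M ->
  partial i (fun y => Sum (fun n => h n y)) x = Sum (fun n => partial i (h n) x).
Proof.
move=> hM; have [df dE] := geo_family_diff x hM.
rewrite partialE deriveE // dE /lin2 !ebaseE.
by move: i; apply: ord2P; rewrite /= !(mul1r, mul0r, addr0, add0r).
Qed.

Lemma geo_family_csm h M : geo_family h M -> csm (fun y => Sum (fun n => h n y)).
Proof.
move=> hM; apply: (@csm_coind R (fun F => exists h M, geo_family h M /\
  F = fun y => Sum (fun n => h n y))); last by exists h, M.
move=> _ [h' [M' [hM' ->]]]; split => [x|i]; first exact: (geo_family_diff x hM').1.
exists (fun n => partial i (h' n)), (fun k => M' k.+1); split.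
  exact: geo_family_partial.
by apply/funext => x; exact: geo_family_partialE hM'.
Qed.

Lemma geo_family_partials h M w x : geo_family h M ->
  partials w (fun y => Sum (fun n => h n y)) x = Sum (fun n => partials w (h n) x).
Proof.
elim/last_ind: w h M => [//|w i IH] h M hM.
rewrite partials_rcons.
have -> : (fun n => partials (rcons w i) (h n) x) =
    (fun n => partials w (partial i (h n)) x).
  by apply/funext => n; rewrite partials_rcons.
rewrite -(IH _ _ (geo_family_partial i hM)); congr (partials w _ x).
by apply/funext => y; exact: geo_family_partialE hM.
Qed.

End sum_of_smooth.

(** * Cauchy products *)

Section cauchy_product.
Variable R : realType.
Implicit Types (a b : nat -> R) (M N : R).

Lemma Sum_tail M a m : geo_le M a ->
  Sum a = \sum_(n < m) a n + Sum (fun n => a (n + m)%N).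
Proof.
move=> aM; have ca := geo_cvg aM.
have tM : geo_le M (fun n => a (n + m)%N).
  move=> n; apply: le_trans (aM _) _; rewrite ler_wpM2l ?(geo_le_ge0 aM) //.
  by rewrite lef_pV2 ?posrE ?exprn_gt0 // ler_weXn2l ?ler1n // leq_addr.
apply: (@cvg_lim _ (@Rhausdorff R)).
apply: (@cvg_trans _ (series a (n + m)%N @[n --> \oo])).
  by rewrite -(cvg_shiftn m); exact: cvg_id.
rewrite (_ : (fun n => _) = (fun n => \sum_(k < m) a k + series (fun n => a (n + m)%N) n)).
  by apply: cvgD; [exact: cvg_cst|exact: geo_cvg tM].
apply/funext => n; rewrite series_addn /series /= big_mkord; congr (_ + _).
by rewrite -{1}(add0n m) big_addn addnK.
Qed.

(** The ratio 1 / 4 for the factors pays for the n + 1 terms of a Cauchy product, as (n + 1) 4^-n <=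
    2^-n; the product is then still dominated in the sense of [geo_le]. *)
Definition quarter_le M a := forall n, `|a n| <= M * 4 ^- n.

Lemma quarter_le_ge0 M a : quarter_le M a -> 0 <= M.
Proof. by move=> /(_ 0%N); rewrite expr0 invr1 mulr1; exact: le_trans. Qed.

Lemma quarter_geo M a : quarter_le M a -> geo_le M a.
Proof.
move=> aM n; apply: le_trans (aM n) _; rewrite ler_wpM2l ?(quarter_le_ge0 aM) //.
by rewrite lef_pV2 ?posrE ?exprn_gt0 // lerXn2r ?nnegrE // ler_nat.
Qed.

Definition cauchy_prod a b n := \sum_(i < n.+1) a i * b (n - i)%N.

Lemma cauchy_prod_bound M N a b n : quarter_le M a -> quarter_le N b ->
  \sum_(i < n.+1) `|a i * b (n - i)%N| <= M * N * 2 ^- n.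
Proof.
move=> aM bN; have M0 := quarter_le_ge0 aM; have N0 := quarter_le_ge0 bN.
apply: (@le_trans _ _ (\sum_(i < n.+1) M * N * 4 ^- n)).
  apply: ler_sum => i _; rewrite normrM.
  rewrite (_ : M * N * 4 ^- n = (M * 4 ^- i) * (N * 4 ^- (n - i))).
    by apply: ler_pM.
  rewrite mulrACA -invfM -exprD subnKC //; by rewrite -ltnS.
rewrite sumr_const card_ord (_ : _ *+ n.+1 = M * N * (4 ^- n * n.+1%:R)); last first.
  by rewrite -mulr_natr mulrA.
rewrite ler_wpM2l ?mulr_ge0 //.
rewrite mulrC ler_pdivrMr ?exprn_gt0 // (_ : 4 = 2 * 2 :> R); last by rewrite -natrM.
rewrite exprMn mulrA mulVf ?mul1r ?expf_neq0 //.
by rewrite -natrX ler_nat ltn_expl.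
Qed.

Lemma cauchy_prod_geo M N a b : quarter_le M a -> quarter_le N b ->
  geo_le (M * N) (cauchy_prod a b).
Proof.
move=> aM bN n; apply: le_trans (ler_norm_sum _ _ _) _; exact: cauchy_prod_bound.
Qed.

(** Partial sums are values at 1 of polynomials p and q. The product of the partial sums exceeds the
    partial sum of the Cauchy product by the coefficients of p q of degree n to 2 n - 1, which form
    a geometric tail. *)
Lemma Sum_cauchy_prod M N a b : quarter_le M a -> quarter_le N b ->
  Sum (cauchy_prod a b) = Sum a * Sum b.
Proof.
move=> aM bN; have M0 := quarter_le_ge0 aM; have N0 := quarter_le_ge0 bN.
pose D n := series a n * series b n - series (cauchy_prod a b) n.
have DE n : `|D n| <= (M * N * 2) * 2 ^- n.
  pose p := \poly_(i < n) a i; pose q := \poly_(i < n) b i.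
  have pE : series a n = p.[1].
    rewrite /p horner_poly /series /= big_mkord; apply: eq_bigr => i _.
    by rewrite expr1n mulr1.
  have qE : series b n = q.[1].
    rewrite /q horner_poly /series /= big_mkord; apply: eq_bigr => i _.
    by rewrite expr1n mulr1.
  have szpq : (size (p * q)%R <= n + n)%N.
    apply: leq_trans (size_polyMleq _ _) _.
    have := size_poly n a; have := size_poly n b; rewrite -/p -/q.
    by move: (size p) (size q) => ? ?; lia.
  have EC : series (cauchy_prod a b) n = \sum_(i < n) (p * q)`_i.
    rewrite /series /= big_mkord; apply: eq_bigr => i _.
    rewrite coefM; apply: eq_bigr => j _.
    rewrite !coef_poly.
    have -> : (j < n)%N by rewrite (leq_ltn_trans _ (ltn_ord i)) // -ltnS.
    by have -> : (i - j < n)%N by rewrite (leq_ltn_trans _ (ltn_ord i)) // leq_subr.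
  have -> : D n = \sum_(i < n) (p * q)`_(n + i).
    rewrite /D pE qE -hornerM (horner_coef_wide _ szpq) EC.
    under eq_bigr do rewrite expr1n mulr1.
    by rewrite big_split_ord /= [X in X - _]addrC addrK.
  apply: le_trans (ler_norm_sum _ _ _) _.
  apply: (@le_trans _ _ (\sum_(i < n) M * N * 2 ^- n * 2 ^- i)).
    apply: ler_sum => i _.
    apply: (@le_trans _ _ (M * N * 2 ^- (n + i))); last by rewrite exprD invfM mulrA.
    rewrite coefM; apply: le_trans (ler_norm_sum _ _ _) _.
    apply: le_trans (cauchy_prod_bound (n + i) aM bN).
    apply: ler_sum => j _; rewrite !coef_poly.
    by case: ifP => _; case: ifP => _; rewrite ?mul0r ?mulr0 ?normr0.
  rewrite -mulr_sumr (_ : M * N * 2 * _ = M * N * 2 ^- n * 2); last by ring.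
  rewrite ler_wpM2l ?mulr_ge0 ?invr_ge0 ?exprn_ge0 //.
  have H k : \sum_(i < k) (2 ^- i : R) <= 2 - 2 * 2 ^- k.
    elim: k => [|k IH]; first by rewrite big_ord0 expr0 invr1 mulr1 subrr.
    rewrite big_ord_recr /= (le_trans (lerD IH (lexx _))) // exprS invfM.
    by move: (2 ^- k) => t; lra.
  apply: le_trans (H n) _.
  have : 0 <= (2 ^- n : R) by rewrite invr_ge0 exprn_ge0.
  by move: (2 ^- n) => t; lra.
have D0 : D @ \oo --> 0.
  apply/cvgr0Pnorm_le => e e0.
  have : (fun n => M * N * 2 * 2 ^- n) @ \oo --> (0 : R).
    rewrite (_ : (fun n => _) = geometric (M * N * 2) (2^-1)).
      exact/cvg_geometric/half_lt1.
    by apply/funext => n; rewrite half_geoE.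
  move=> /cvgr0Pnorm_le /(_ e e0); apply: filterS => n; apply: le_trans.
  by rewrite [leRHS]ger0_norm // mulr_ge0 ?invr_ge0 ?exprn_ge0 // mulr_ge0 // mulr_ge0.
apply: (@cvg_lim _ (@Rhausdorff R)).
rewrite (_ : series _ = (fun n => series a n * series b n - D n)); last first.
  by apply/funext => n; rewrite /D opprB addrC subrK.
rewrite -[X in _ --> X]subr0; apply: cvgB => //; apply: cvgM.
- exact: geo_cvg (quarter_geo aM).
- exact: geo_cvg (quarter_geo bN).
Qed.

End cauchy_product.

(** * Evaluating a formal series at a small parameter *)

Section evaluation.
Variable R : realType.
Notation E := 'rV[R]_2.
Notation HT := (hurwitz (tfun R)).

Lemma partialsZ w (a : R) (f : E -> R) : csm f ->
  partials w (fun x => a * f x) = (fun x => a * partials w f x).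
Proof.
move=> fs; elim: w => //= i w ->.
rewrite (_ : (fun x => _) = cst a \* partials w f) //.
rewrite partialM; [|exact: csm_cst|exact: csm_partials].
by rewrite partial_cst; apply/funext => x /=; rewrite mul0r add0r.
Qed.

Lemma csmZ (a : R) (f : E -> R) : csm f -> csm (fun x => a * f x).
Proof. by move=> fs; apply: (@csmM R (cst a) f) => //; exact: csm_cst. Qed.

(** Separates the two factorials. The one in m is cancelled by s^m / m!, so that [ev] converges once
    |s| rho is small; the one in the length of the word is the growth rate of derivatives of
    analytic functions. *)
Definition ebound (rho c : R) (u : HT) := forall m w x,
  `|partials w (u m) x| <= c * (size w)`!%:R * rho ^+ size w * (m`!%:R * rho ^+ m).

Lemma binS_le_exp m k : ('C(m + k, k) <= 2 ^ (m + k))%N.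
Proof.
rewrite -[2%N]/(1 + 1)%N Pascal (bigD1 (inord k)) //= inordK; last by rewrite ltnS leq_addl.
by rewrite !exp1n !muln1 leq_addr.
Qed.

(** (m + k)! <= 2^(m + k) m! k! separates the factorials, at the price of the factor 2 in the new
    constant; the denominator of [weight] is dropped. *)
Lemma sbound_ebound (c K r : R) u : 0 <= c -> 1 <= K -> 0 < r ->
  (forall n0, sbound n0 c K (weight r) u) -> ebound (2 * K * r) c u.
Proof.
move=> c0 K1 r0 ub m w x; apply: le_trans (ub m m w x (leqnn _)) _.
have K0 : 0 <= K by lra.
rewrite -!mulrA ler_wpM2l //; set k := size w.
have -> : k`!%:R * ((2 * (K * r)) ^+ k * (m`!%:R * (2 * (K * r)) ^+ m)) =
    K ^+ m * (K ^+ k * r ^+ (m + k) * (2 ^+ (m + k) * (m`!%:R * k`!%:R))).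
  rewrite !exprMn !exprD.
  by move: (2 ^+ k) (2 ^+ m) (K ^+ k) (K ^+ m) (r ^+ k) (r ^+ m) => *; ring.
rewrite ler_wpM2l ?exprn_ge0 // /weight.
apply: (@le_trans _ _ (r ^+ (m + k) * (m + k)`!%:R)).
  rewrite ler_pdivrMr ?exprn_gt0 ?ltr0n // ler_peMr ?mulr_ge0 ?exprn_ge0 ?ler0n ?(ltW r0) //.
  by rewrite exprn_ege1 // ler1n.
rewrite [leRHS](_ : _ = K ^+ k * (r ^+ (m + k) * (2 ^+ (m + k) * (m`!%:R * k`!%:R)))); last by ring.
have rr : 0 <= r ^+ (m + k) by rewrite exprn_ge0 // ltW.
apply: (@le_trans _ _ (1 * (r ^+ (m + k) * (2 ^+ (m + k) * (m`!%:R * k`!%:R))))).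
  rewrite mul1r ler_wpM2l // -(@bin_fact (m + k) k) ?leq_addl // addnK.
  by rewrite -natrX -!natrM ler_nat [(k`! * _)%N]mulnC leq_mul2r binS_le_exp orbT.
apply: ler_wpM2r; last exact: exprn_ege1.
by apply: mulr_ge0 => //; rewrite !mulr_ge0 ?exprn_ge0 ?ler0n.
Qed.

(** The extra factor k + 1 in (k + 1)! is absorbed by 2^k, hence the doubled constant; this is why
    later conditions on s involve 2 rho. *)
Lemma ebound_lift rho c u i : 0 <= c -> 0 <= rho -> ebound rho c u ->
  ebound (2 * rho) (c * rho) (hlift (tpartial i) u).
Proof.
move=> c0 rho0 ub m w x; rewrite /hlift tpartialE -partials_rcons.
apply: le_trans (ub m _ x) _; rewrite size_rcons; set k := size w.
have kf : 0 <= (k`!%:R : R) by rewrite ler0n.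
have mf : 0 <= (m`!%:R : R) by rewrite ler0n.
have rk : 0 <= rho ^+ k by rewrite exprn_ge0.
have rm : 0 <= rho ^+ m by rewrite exprn_ge0.
apply: ler_pM.
- by rewrite !mulr_ge0 ?exprn_ge0 ?ler0n.
- by rewrite mulr_ge0.
- rewrite factS natrM exprS exprMn.
  rewrite [leLHS](_ : _ = c * rho * k`!%:R * rho ^+ k * k.+1%:R); last by ring.
  rewrite [leRHS](_ : _ = c * rho * k`!%:R * rho ^+ k * 2 ^+ k); last by ring.
  by rewrite ler_wpM2l ?mulr_ge0 // -natrX ler_nat ltn_expl.
- rewrite ler_wpM2l // exprMn ler_peMl // exprn_ege1 //; lra.
Qed.

Lemma ebound_ge0 rho c u : ebound rho c u -> 0 <= c.
Proof.
move=> /(_ 0%N [::] 0); rewrite /= fact0 !expr0 !mulr1; exact: le_trans.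
Qed.

Variable s : R.

Definition ev (u : HT) : E -> R := fun x => Sum (fun n => s ^+ n / n`!%:R * u n x).

Lemma ev_term_bound rho c u w x m n : 0 <= rho -> `|s| * rho <= 4^-1 -> ebound rho c u ->
  `|s ^+ (n + m) / (n + m)`!%:R * partials w (u (n + m)%N) x| <=
  c * (size w)`!%:R * rho ^+ size w * (`|s| * rho) ^+ m * 4 ^- n.
Proof.
move=> rho0 srho ub; have c0 := ebound_ge0 ub.
rewrite normrM normf_div normrX normr_nat.
apply: (@le_trans _ _ (`|s| ^+ (n + m) / (n + m)`!%:R *
   (c * (size w)`!%:R * rho ^+ size w * ((n + m)`!%:R * rho ^+ (n + m))))).
  by rewrite ler_wpM2l // divr_ge0 // exprn_ge0.
have -> : `|s| ^+ (n + m) / (n + m)`!%:R *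
   (c * (size w)`!%:R * rho ^+ size w * ((n + m)`!%:R * rho ^+ (n + m))) =
   c * (size w)`!%:R * rho ^+ size w * (`|s| * rho) ^+ m * (`|s| * rho) ^+ n.
  have f0 : ((n + m)`!%:R : R) != 0 by rewrite pnatr_eq0 -lt0n fact_gt0.
  rewrite -[RHS]mulrA -exprD (addnC m) exprMn; by field.
rewrite ler_wpM2l ?mulr_ge0 ?exprn_ge0 ?ler0n ?mulr_ge0 //.
by rewrite -exprVn lerXn2r ?nnegrE ?mulr_ge0 ?invr_ge0.
Qed.

Section with_bound.
Variables (rho c : R) (u : HT).
Hypothesis rho0 : 0 <= rho.
Hypothesis srho : `|s| * rho <= 4^-1.
Hypothesis ub : ebound rho c u.

Lemma ev_quarter w x : quarter_le (c * (size w)`!%:R * rho ^+ size w)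
  (fun n => s ^+ n / n`!%:R * partials w (u n) x).
Proof.
by move=> n; have := ev_term_bound w x 0 n rho0 srho ub; rewrite addn0 expr0 mulr1.
Qed.

Lemma ev_family : geo_family (fun n x => s ^+ n / n`!%:R * u n x)
  (fun k => c * k`!%:R * rho ^+ k).
Proof.
split=> [n|w x n]; first by apply: csmZ; exact: tfun_csm.
rewrite partialsZ; last exact: tfun_csm.
exact: (quarter_geo (ev_quarter w x)).
Qed.

Lemma ev_csm : csm (ev u).
Proof. exact: geo_family_csm ev_family. Qed.

Lemma ev_partials w x : partials w (ev u) x = Sum (fun n => s ^+ n / n`!%:R * partials w (u n) x).
Proof.
rewrite /ev (geo_family_partials w x ev_family); congr Sum; apply/funext => n.
by rewrite partialsZ //; exact: tfun_csm.
Qed.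

Lemma ev_partial i : partial i (ev u) = ev (hlift (tpartial i) u).
Proof. by apply/funext => x; exact: (ev_partials [:: i] x). Qed.

Lemma ev_bound w x : `|partials w (ev u) x| <= 2 * (c * (size w)`!%:R * rho ^+ size w).
Proof. by rewrite ev_partials; exact: Sum_le (quarter_geo (ev_quarter w x)). Qed.

Lemma ev_taylor w x m :
  `|partials w (ev u) x - \sum_(n < m) s ^+ n / n`!%:R * partials w (u n) x| <=
  2 * (c * (size w)`!%:R * rho ^+ size w * (`|s| * rho) ^+ m).
Proof.
rewrite ev_partials (Sum_tail m (quarter_geo (ev_quarter w x))) addrC addKr.
by apply/Sum_le/quarter_geo => n; exact: ev_term_bound.
Qed.

Lemma ev_periodic : Z2_periodic (ev u).
Proof.
move=> i x; rewrite /ev; congr Sum; apply/funext => n.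
by rewrite tfun_periodic.
Qed.

End with_bound.

Lemma ev_mul_term (u v : HT) x n : s ^+ n / n`!%:R * (u * v) n x =
  cauchy_prod (fun k => s ^+ k / k`!%:R * u k x) (fun k => s ^+ k / k`!%:R * v k x) n.
Proof.
rewrite hmulE hmul_binE /cauchy_prod.
have -> : tval (\sum_(i < n.+1) (u i * v (n - i)%N) *+ 'C(n, i)) x =
    \sum_(i < n.+1) (u i x * v (n - i)%N x) *+ 'C(n, i).
  rewrite -[LHS]/((@tval R (\sum_(i < n.+1) (u i * v (n - i)%N) *+ 'C(n, i))) x).
  elim/big_ind2: _ => // [f a g b <- <-|i _] //.
  elim: ('C(n, i)) => [|k IH]; first by rewrite !mulr0n.
  by rewrite !mulrS -IH.
rewrite mulr_sumr; apply: eq_bigr => i _ /=.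
have iN : (i <= n)%N by rewrite -ltnS.
rewrite -mulr_natr -(bin_fact iN) !natrM.
have -> : s ^+ n = s ^+ i * s ^+ (n - i) by rewrite -exprD subnKC.
have h1 : ('C(n, i)%:R : R) != 0 by rewrite pnatr_eq0 -lt0n bin_gt0.
have h2 : (i`!%:R : R) != 0 by rewrite pnatr_eq0 -lt0n fact_gt0.
have h3 : ((n - i)`!%:R : R) != 0 by rewrite pnatr_eq0 -lt0n fact_gt0.
move: (u i x) (v (n - i)%N x) (s ^+ i) (s ^+ (n - i)) => p q a b.
by field; rewrite h1 h2 h3.
Qed.

(** Convergence is recorded with the value because a product of streams is only shown to be
    geometrically dominated, not to satisfy [ebound]. Formal identities are carried over to values
    through this relation. *)
Definition evaluates (u : HT) x (y : R) :=
  (exists M, geo_le M (fun n => s ^+ n / n`!%:R * u n x)) /\ ev u x = y.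

Lemma evaluates_zero x y : evaluates 0 x y -> y = 0.
Proof.
move=> [_ <-]; rewrite /ev (_ : (fun n => _) = fun=> 0).
  by rewrite /Sum /series /=; under eq_fun do rewrite big1 //; exact: (@lim_cst _ (@Rhausdorff R)).
by apply/funext => n; exact: mulr0.
Qed.

Lemma evaluatesD u v x y z : evaluates u x y -> evaluates v x z -> evaluates (u + v) x (y + z).
Proof.
move=> [[M uM] <-] [[N vN] <-].
have E1 : (fun n => s ^+ n / n`!%:R * (u + v) n x) =
    (fun n => s ^+ n / n`!%:R * u n x + s ^+ n / n`!%:R * v n x).
  by apply/funext => n; rewrite -[(u + v) n x]/(u n x + v n x) mulrDr.
split; first by exists (M + N); rewrite E1; exact: geoD.
by rewrite /ev E1 (SumD uM vN).
Qed.

Section bounded_streams.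
Variables (rho c c' : R) (u v : HT).
Hypothesis rho0 : 0 <= rho.
Hypothesis srho : `|s| * rho <= 4^-1.
Hypothesis ub : ebound rho c u.
Hypothesis vb : ebound rho c' v.

Lemma evaluates_bounded x : evaluates u x (ev u x).
Proof.
split=> //; exists (c * (size (Nil 'I_2))`!%:R * rho ^+ size (Nil 'I_2)).
exact: quarter_geo (ev_quarter rho0 srho ub [::] x).
Qed.

Lemma evaluatesM x : evaluates (u * v) x (ev u x * ev v x).
Proof.
have gu := ev_quarter rho0 srho ub [::] x.
have gv := ev_quarter rho0 srho vb [::] x.
have E1 : (fun n => s ^+ n / n`!%:R * (u * v) n x) =
    cauchy_prod (fun k => s ^+ k / k`!%:R * u k x) (fun k => s ^+ k / k`!%:R * v k x).
  by apply/funext => n; exact: ev_mul_term.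
split; last by rewrite /ev E1 (Sum_cauchy_prod gu gv).
by eexists; rewrite E1; exact: cauchy_prod_geo gu gv.
Qed.

End bounded_streams.


End evaluation.

(** * Taylor expansion and real analyticity *)

Section taylor.
Variable R : realType.

(** Induction on n: with [p] the Taylor polynomial and [q] the bound, the case of [G 1] says that q
    - (G 0 - p) and q + (G 0 - p) have nonnegative derivatives, and both vanish at 0. *)
Lemma taylor_bound (n : nat) (G : nat -> R -> R) (B : R) :
  (forall k (t : R), is_derive t (1 : R) (G k) (G k.+1 t)) ->
  (forall t : R, 0 <= t <= 1 -> `|G n t| <= B) ->
  forall t : R, 0 <= t <= 1 ->
    `|G 0%N t - \sum_(k < n) G k 0 / k`!%:R * t ^+ k| <= B * t ^+ n / n`!%:R.
Proof.
elim: n G => [|n IH] G dG GB t t01.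
  by rewrite big_ord0 subr0 expr0 mulr1 fact0 divr1 GB.
have {}IH := IH (fun k => G k.+1) (fun k => dG k.+1) GB.
pose p := \poly_(k < n.+1) (G k 0 / k`!%:R).
have pE x : p.[x] = \sum_(k < n.+1) G k 0 / k`!%:R * x ^+ k by rewrite horner_poly.
have dpE x : p^`().[x] = \sum_(k < n) G k.+1 0 / k`!%:R * x ^+ k.
  rewrite (_ : p^`() = \poly_(k < n) (G k.+1 0 / k`!%:R)) ?horner_poly //.
  apply/polyP => k; rewrite coef_deriv !coef_poly ltnS; case: ifP => _; last by rewrite mul0rn.
  rewrite factS natrM -mulr_natr.
  have h1 : (k.+1%:R : R) != 0 by rewrite pnatr_eq0.
  have h2 : (k`!%:R : R) != 0 by rewrite pnatr_eq0 -lt0n fact_gt0.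
  by move: (G k.+1 0) => g; field; rewrite nat1r h1 h2.
have p0 : p.[0] = G 0%N 0.
  rewrite pE big_ord_recl /= expr0 fact0 divr1 mulr1 big1 ?addr0 // => i _.
  by rewrite exprS mul0r mulr0.
pose q := B / n.+1`!%:R *: 'X^(n.+1) : {poly R}.
have qE x : q.[x] = B * x ^+ n.+1 / n.+1`!%:R.
  by rewrite /q hornerZ hornerXn mulrAC.
have dqE x : q^`().[x] = B * x ^+ n / n`!%:R.
  rewrite /q derivZ derivXn hornerZ hornerMn hornerXn /= factS natrM -mulr_natr.
  have h1 : (n.+1%:R : R) != 0 by rewrite pnatr_eq0.
  have h2 : (n`!%:R : R) != 0 by rewrite pnatr_eq0 -lt0n fact_gt0.
  by field; rewrite nat1r h1 h2.
have key (sg : R) : sg = 1 \/ sg = -1 -> sg * (G 0%N t - p.[t]) <= q.[t].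
  move=> sg1; have /andP[t0 t1] := t01.
  pose D x := q.[x] - sg * (G 0%N x - p.[x]).
  pose dD x := q^`().[x] - sg * (G 1%N x - p^`().[x]).
  have D' (x : R) : is_derive x (1 : R) D (dD x).
    apply: is_deriveB; apply: (@is_deriveZ _ _ _ (fun x => G 0%N x - p.[x]) sg).
  have Dc : {within `[0, t], continuous D}.
    by apply: derivable_within_continuous => x _; case: (D' x).
  have [c ct] := MVT_segment t0 (fun x _ => D' x) Dc.
  have q0 : q.[0] = 0 by rewrite qE exprS mul0r mulr0 mul0r.
  rewrite {2}/D q0 p0 subrr mulr0 !subr0 => Dt.
  rewrite -subr_ge0 -[leRHS]/(D t) Dt mulr_ge0 // /dD subr_ge0 dqE dpE.
  have c01 : 0 <= c <= 1.
    by move: ct; rewrite in_itv /= => /andP[-> ct] /=; exact: le_trans ct t1.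
  by have := IH c c01; rewrite ler_norml => /andP[h1 h2]; case: sg1 => ->; lra.
rewrite -pE -qE ler_norml; apply/andP; split.
  by have := key (-1) (or_intror erefl); lra.
by have := key 1 (or_introl erefl); lra.
Qed.

End taylor.

Section analytic.
Variable R : realType.
Notation E := 'rV[R]_2.

Opaque partial.

Definition dirD (h : E) (F : E -> R) : E -> R :=
  fun x => h 0 0 * partial 0 F x + h 0 1 * partial 1 F x.

Lemma csm_dirD h F : csm F -> csm (dirD h F).
Proof.
move=> Fs; apply: csmD; apply: (csmM (@csm_cst R _)); exact: csm_partial.
Qed.

Lemma csm_iter_dirD h F n : csm F -> csm (iter n (dirD h) F).
Proof. by move=> Fs; elim: n => //= n; exact: csm_dirD. Qed.

Definition mixed (f : E -> R) i j : E -> R := partials (nseq i 0 ++ nseq j 1) f.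

Lemma csm_mixed f i j : csm f -> csm (mixed f i j).
Proof. exact: csm_partials. Qed.

Lemma partial0_mixed f i j : partial 0 (mixed f i j) = mixed f i.+1 j.
Proof. by []. Qed.

Lemma partial1_mixed f i j : csm f -> partial 1 (mixed f i j) = mixed f i j.+1.
Proof.
move=> fs; rewrite /mixed !partials_cat csm_partial_partials //; exact: csm_partials.
Qed.

Lemma dirD_lin h (a b : R) F G : csm F -> csm G ->
  dirD h (fun x => a * F x + b * G x) = (fun x => a * dirD h F x + b * dirD h G x).
Proof.
move=> Fs Gs; apply/funext => x; rewrite /dirD.
have H i : partial i (fun x => a * F x + b * G x) x = a * partial i F x + b * partial i G x.
  rewrite -[fun x => _]/((cst a \* F) \+ (cst b \* G)).
  rewrite partialD; [|by apply: csmM => //; exact: csm_cst..].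
  rewrite !partialM //; try exact: csm_cst.
  by rewrite !partial_cst /= !mul0r !add0r.
by rewrite !H; move: (partial _ _ _) (partial _ _ _) (partial _ _ _) (partial _ _ _) => *; ring.
Qed.

Lemma iter_dirD_lin h (a b : R) F G n : csm F -> csm G ->
  iter n (dirD h) (fun x => a * F x + b * G x) =
  (fun x => a * iter n (dirD h) F x + b * iter n (dirD h) G x).
Proof.
by move=> Fs Gs; elim: n => //= n ->; rewrite dirD_lin //; exact: csm_iter_dirD.
Qed.

(** The binomial theorem for two commuting derivations. It identifies the terms of degree n of the
    double power series with the n-th derivative along [h]. *)
Lemma iter_dirD_mixed f h n i j x : csm f ->
  iter n (dirD h) (mixed f i j) x =
  \sum_(k < n.+1) 'C(n, k)%:R * (h 0 0 ^+ k * h 0 1 ^+ (n - k)) * mixed f (i + k) (j + (n - k)) x.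
Proof.
move=> fs; elim: n i j => [|n IH] i j.
  by rewrite big_ord1 bin0 !expr0 !mulr1 mul1r !addn0.
rewrite iterSr.
have -> : dirD h (mixed f i j) =
    (fun y => h 0 0 * mixed f i.+1 j y + h 0 1 * mixed f i j.+1 y).
  by rewrite /dirD partial0_mixed partial1_mixed.
rewrite iter_dirD_lin; [|exact: csm_mixed..].
rewrite !IH [RHS]big_ord_recl bin0 !subn0 addn0 mul1r expr0 mul1r.
under [X in _ = _ + X]eq_bigr => k _.
  rewrite /= /bump leq0n add1n binS natrD subSS mulrDl mulrDl.
  over.
rewrite big_split /= addrA addrC; congr (_ + _).
  rewrite mulr_sumr; apply: eq_bigr => k _; rewrite exprS addSnnS.
  by move: (mixed _ _ _ _) => z; ring.
rewrite mulr_sumr [LHS]big_ord_recl /= bin0 !subn0 addn0 expr0 mul1r.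
rewrite mul1r mulrA -exprS addSnnS; congr (_ + _).
rewrite [RHS]big_ord_recr /= bin_small // !mul0r addr0.
apply: eq_bigr => k _; rewrite /= /bump leq0n add1n.
have -> : (n - k = (n - k.+1).+1)%N by rewrite subnS prednK // subn_gt0.
rewrite (exprS (h 0 1)) addSnnS.
by move: (mixed _ _ _ _) => z; ring.
Qed.

(** Taylor expansion along the segment from a to x. The radius 1 / (8 rho) makes (|h_0| + |h_1|) rho
    at most 1 / 4, so the terms of degree n and the remainder after n terms are at most C 2^-n. *)
Lemma analytic_of_bound (f : E -> R) (C rho : R) : csm f -> 0 < rho ->
  (forall w x, `|partials w f x| <= C * (size w)`!%:R * rho ^+ size w) ->
  real_analytic f.
Proof.
move=> fs rho0 fC a.
have C0 : 0 <= C.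
  by have := fC [::] a; rewrite /= fact0 expr0 !mulr1; exact: le_trans.
exists (8 * rho)^-1, (fun i j => mixed f i j a / (i`!%:R * j`!%:R)).
split; first by rewrite invr_gt0 mulr_gt0.
move=> x xa term; pose h : E := x - a.
have hE k : h 0 k = x 0 k - a 0 k by rewrite !mxE.
pose q := (`|h 0 0| + `|h 0 1|) * rho.
have q4 : q <= 4^-1.
  have := ltW (xa 0); have := ltW (xa 1); rewrite -!hE /q.
  rewrite -ler_pdivlMr // (_ : 4^-1 / rho = (8 * rho)^-1 + (8 * rho)^-1); last first.
    by field; rewrite gt_eqF.
  by move=> h1 h0; apply: lerD.
have q0 : 0 <= q by rewrite /q mulr_ge0 ?addr_ge0 // ltW.
have Dbound n y : `|iter n (dirD h) f y| <= C * n`!%:R * q ^+ n.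
  rewrite -[f in iter n _ f]/(mixed f 0 0) iter_dirD_mixed //.
  apply: le_trans (ler_norm_sum _ _ _) _.
  rewrite /q [`|h 0 0| + _]addrC exprMn exprDn mulr_suml mulr_sumr.
  apply: ler_sum => k _; rewrite !normrM normr_nat !normrX.
  have kn : (k <= n)%N by rewrite -ltnS.
  have := fC (nseq (0 + k) 0 ++ nseq (0 + (n - k)) 1) y.
  rewrite -/(mixed f (0 + k) (0 + (n - k))) size_cat !size_nseq !add0n subnKC // => H.
  apply: le_trans (ler_wpM2l _ H) _; first by rewrite !mulr_ge0 ?ler0n ?exprn_ge0.
  rewrite le_eqVlt; apply/orP; left; apply/eqP; rewrite -mulr_natr.
  by move: (rho ^+ n) (`|h 0 0| ^+ k) (`|h 0 1| ^+ (n - k)) => *; ring.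
have termE n (i : 'I_n.+1) : term i (n - i)%N = n`!%:R^-1 *
    ('C(n, i)%:R * (h 0 0 ^+ i * h 0 1 ^+ (n - i)) * mixed f (0 + i) (0 + (n - i)) a).
  have ni : (i <= n)%N by rewrite -ltnS.
  rewrite /term -!hE !add0n -(bin_fact ni) !natrM.
  have h1 : ('C(n, i)%:R : R) != 0 by rewrite pnatr_eq0 -lt0n bin_gt0.
  have h2 : (i`!%:R : R) != 0 by rewrite pnatr_eq0 -lt0n fact_gt0.
  have h3 : ((n - i)`!%:R : R) != 0 by rewrite pnatr_eq0 -lt0n fact_gt0.
  move: (mixed _ _ _ _) (h 0 0 ^+ _) (h 0 1 ^+ _) => *.
  by field; rewrite h1 h2 h3.
have absE n : \sum_(i < n.+1) `|term i (n - i)%N| <= C * 2 ^- n.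
  apply: (@le_trans _ _ (C * q ^+ n)); last first.
    rewrite ler_wpM2l // -exprVn lerXn2r ?nnegrE ?invr_ge0 //.
    by apply: le_trans q4 _; rewrite lef_pV2 ?posrE // ler_nat.
  rewrite /q [`|h 0 0| + _]addrC exprMn exprDn mulr_suml mulr_sumr.
  apply: ler_sum => k _; rewrite termE !normrM normfV !normr_nat !normrX.
  have kn : (k <= n)%N by rewrite -ltnS.
  have := fC (nseq (0 + k) 0 ++ nseq (0 + (n - k)) 1) a.
  rewrite -/(mixed f (0 + k) (0 + (n - k))) size_cat !size_nseq !add0n subnKC // => H.
  rewrite mulrA; apply: le_trans (ler_wpM2l _ H) _.
    by rewrite !mulr_ge0 ?invr_ge0 ?ler0n ?exprn_ge0.
  rewrite le_eqVlt; apply/orP; left; apply/eqP; rewrite -mulr_natr.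
  have h2 : (n`!%:R : R) != 0 by rewrite pnatr_eq0 -lt0n fact_gt0.
  by move: (rho ^+ n) (`|h 0 0| ^+ k) (`|h 0 1| ^+ (n - k)) => *; field.
split.
  have g : geo_le C (fun n => \sum_(i < n.+1) `|term i (n - i)%N|).
    by move=> n; rewrite ger0_norm ?sumr_ge0.
  exact: geo_cvg g.
have sumE n : \sum_(i < n.+1) term i (n - i)%N = iter n (dirD h) f a / n`!%:R.
  rewrite -[f in iter n _ f]/(mixed f 0 0) iter_dirD_mixed // mulr_suml.
  by apply: eq_bigr => i _; rewrite termE mulrC.
have rem n : `|f x - series (fun n => \sum_(i < n.+1) term i (n - i)%N) n| <= C * 2 ^- n.
  have dG k (t : R) : is_derive t (1 : R) (fun t : R => iter k (dirD h) f (a + t *: h))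
      (iter k.+1 (dirD h) f (a + t *: h)).
    have fk := csm_iter_dirD h k fs.
    rewrite iterS /dirD -csm_deriveE //; apply: line_derive; exact: csm_derivable.
  have := @taylor_bound R n (fun k t => iter k (dirD h) f (a + t *: h))
    (C * n`!%:R * q ^+ n) dG (fun t _ => Dbound n _) 1.
  rewrite ler01 lexx => /(_ isT) H.
  rewrite (_ : f x = f (a + 1 *: h)); last by rewrite scale1r /h addrC subrK.
  apply: le_trans (le_trans _ H) _.
    rewrite le_eqVlt; apply/orP; left; apply/eqP; congr (`|_ - _|).
    rewrite /series /= big_mkord; apply: eq_bigr => k _.
    by rewrite sumE scale0r addr0 expr1n mulr1.
  rewrite expr1n mulr1.
  have h2 : (n`!%:R : R) != 0 by rewrite pnatr_eq0 -lt0n fact_gt0.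
  rewrite [leLHS](_ : _ = C * q ^+ n); last by move: (q ^+ n) => z; field.
  rewrite ler_wpM2l // -exprVn lerXn2r ?nnegrE ?invr_ge0 //.
  by apply: le_trans q4 _; rewrite lef_pV2 ?posrE // ler_nat.
apply/cvgrPdist_le => e e0.
have : (fun n => C * 2 ^- n) @ \oo --> (0 : R).
  rewrite (_ : (fun n => _) = geometric C (2^-1)).
    exact/cvg_geometric/half_lt1.
  by apply/funext => n; rewrite half_geoE.
move=> /cvgr0Pnorm_le /(_ e e0); apply: filterS => n; apply: le_trans.
by rewrite [leRHS]ger0_norm ?rem // mulr_ge0 ?invr_ge0 ?exprn_ge0.
Qed.

End analytic.

(** * Chain rule and second-derivative test *)

Section plane_calculus.
Variable R : realType.
Notation E := 'rV[R]_2.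

Opaque partial.

Lemma csm_comp_diff (f e0 e1 : E -> R) x : csm f -> csm e0 -> csm e1 ->
  let e := fun x => e0 x *: @ebase R 0 + e1 x *: @ebase R 1 in
  differentiable (fun x => f (e x)) x /\
  forall i, partial i (fun x => f (e x)) x =
    partial 0 f (e x) * partial i e0 x + partial 1 f (e x) * partial i e1 x.
Proof.
move=> fs e0s e1s e.
have d0 := csm_differentiable x e0s; have d1 := csm_differentiable x e1s.
have df := csm_differentiable (e x) fs.
have dz0 : differentiable (fun z => e0 z *: @ebase R 0) x by exact: differentiableZl.
have dz1 : differentiable (fun z => e1 z *: @ebase R 1) x by exact: differentiableZl.
have de : differentiable e x by exact: differentiableD.
have dfe : differentiable (fun x => f (e x)) x by exact: (differentiable_comp de df).
split => // i.
have E1 v : 'd e x v = 'd e0 x v *: @ebase R 0 + 'd e1 x v *: @ebase R 1.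
  have -> : 'd e x v = ('d (fun z => e0 z *: @ebase R 0) x \+ 'd (fun z => e1 z *: @ebase R 1) x) v.
    exact: (congr1 (@^~ v) (diffD dz0 dz1)).
  have Z0 := congr1 (@^~ v) (diffZl (@ebase R 0) d0).
  have Z1 := congr1 (@^~ v) (diffZl (@ebase R 1) d1).
  exact: (congr2 +%R Z0 Z1).
have E2 : partial i (fun x => f (e x)) x = 'd f (e x) ('d e x (@ebase R i)).
  rewrite partialE deriveE //.
  exact: (congr1 (@^~ (@ebase R i)) (diff_comp de df)).
have [p [q [-> -> E3]]] : exists p q, [/\ partial i e0 x = p, partial i e1 x = q &
    'd e x (@ebase R i) = p *: @ebase R 0 + q *: @ebase R 1].
  exists ('d e0 x (@ebase R i)), ('d e1 x (@ebase R i)); split; last exact: E1.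
  - by rewrite partialE; exact: deriveE.
  - by rewrite partialE; exact: deriveE.
rewrite E2 csm_diffE // E3 /lin2.
move: (partial 0 f (e x)) (partial 1 f (e x)) => a b.
by rewrite !mxE !eqxx /=; ring.
Qed.

(** Invariant for [csm_coind]: the chain rule produces sums of products of functions composed with
    [e] and of plain smooth functions. *)
Inductive comp_closure (e : E -> E) : (E -> R) -> Prop :=
| comp_closure_comp f : csm f -> comp_closure e (fun x => f (e x))
| comp_closure_csm f : csm f -> comp_closure e f
| comp_closure_add f g : comp_closure e f -> comp_closure e g -> comp_closure e (f \+ g)
| comp_closure_mul f g : comp_closure e f -> comp_closure e g -> comp_closure e (f \* g).

Lemma csm_comp (f e0 e1 : E -> R) : csm f -> csm e0 -> csm e1 ->
  csm (fun x => f (e0 x *: @ebase R 0 + e1 x *: @ebase R 1)).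
Proof.
move=> fs e0s e1s; pose e := fun x => e0 x *: @ebase R 0 + e1 x *: @ebase R 1.
apply: (@csm_coind R (comp_closure e)); last exact: (@comp_closure_comp e).
move=> {fs}{}f; elim=> {f}.
- move=> f fs; split => [x|i]; first exact: (csm_comp_diff x fs e0s e1s).1.
  rewrite (_ : partial i _ = ((fun x => partial 0 f (e x)) \* partial i e0) \+
     ((fun x => partial 1 f (e x)) \* partial i e1)); last first.
    apply/funext => x; have H := (csm_comp_diff x fs e0s e1s).2 i.
    by rewrite /=; etransitivity; [exact H|reflexivity].
  have Hc k := comp_closure_comp e (csm_partial k fs).
  have He0 := comp_closure_csm e (csm_partial i e0s).
  have He1 := comp_closure_csm e (csm_partial i e1s).
  exact: (comp_closure_add (comp_closure_mul (Hc 0) He0) (comp_closure_mul (Hc 1) He1)).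
- move=> f fs; split => [x|i]; first exact: csm_differentiable.
  exact/comp_closure_csm/csm_partial.
- move=> f g cf [df pf] cg [dg pg]; split => [x|i]; first exact: differentiableD.
  by rewrite partialD_diff //; exact: comp_closure_add.
- move=> f g cf [df pf] cg [dg pg]; split => [x|i]; first exact: differentiableM.
  rewrite partialM_diff //; apply: comp_closure_add; exact: comp_closure_mul.
Qed.

(** Otherwise h' would vanish at 0 and be positive just to the right of it, so that h would exceed
    its value at 0 there. *)
Lemma second_derivative_test (h h1 : R -> R) (h2 d : R) : 0 < d ->
  (forall t : R, is_derive t (1 : R) h (h1 t)) -> is_derive (0 : R) (1 : R) h1 h2 ->
  (forall t, `|t| < d -> h t <= h 0) -> h2 <= 0.
Proof.
move=> d0 dh dh1 hmax; rewrite leNgt; apply/negP => h20.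
have h10 : h1 0 = 0.
  have d0' : (0 : R) \in `]- d, d[%R by rewrite in_itv /= oppr_lt0 d0.
  have dab : - d <= d by rewrite (le_trans _ (ltW d0)) // oppr_le0 ltW.
  have dd (t : R) : t \in `]- d, d[%R -> derivable h t 1 by case: (dh t).
  have hm (t : R) : t \in `]- d, d[%R -> h t <= h 0.
    by rewrite in_itv /= => /andP[? ?]; apply: hmax; rewrite ltr_norml; apply/andP.
  have := derive1_at_max dab dd d0' hm.
  by case: (dh 0) => _ E1 [_]; rewrite E1.
have h2' : 0 < h2 / 2 by rewrite divr_gt0.
have [e e0 He] : exists2 e, 0 < e & forall t, 0 < t < e -> 0 < h1 t.
  case: dh1 => dr dE.
  have : (t^-1 *: ((h1 \o shift 0) (t *: (1 : R)) - h1 0)) @[t --> (0 : R)^'] --> h2.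
    by rewrite -dE /derive; exact: dr.
  move=> /cvgrPdist_lt /(_ _ h2') /nbhs_ballP [e /= e0 H].
  exists e => // t /andP[t0 te].
  have := H t; rewrite -ball_normE /= sub0r normrN (gtr0_norm t0) => /(_ te).
  rewrite gt_eqF // => /(_ isT).
  rewrite h10 addr0 subr0 /GRing.scale /= mulr1 ltr_norml => /andP[_].
  rewrite ltrBlDr -ltrBlDl (_ : h2 - h2 / 2 = h2 / 2); last by field.
  move=> /(lt_trans h2'); by rewrite pmulr_rgt0 // invr_gt0.
pose t := Num.min d e / 2.
have m0 : 0 < Num.min d e by rewrite lt_min d0.
have t0 : 0 < t by rewrite divr_gt0.
have tm : t < Num.min d e by rewrite ltr_pdivrMr // ltr_pMr // ltr1n.
have [td te] : t < d /\ t < e by move: tm; rewrite lt_min => /andP.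
have hc : {within `[0, t], continuous h}.
  by apply: derivable_within_continuous => x _; case: (dh x).
have [c] := MVT t0 (fun x _ => dh x) hc.
rewrite in_itv /= => /andP[c0 ct] E1.
have : h t <= h 0 by apply: hmax; rewrite gtr0_norm.
rewrite -subr_le0 E1 subr0 pmulr_lle0 // leNgt => /negP; apply.
by apply: He; rewrite c0 (lt_trans ct).
Qed.

End plane_calculus.

(** * Conformal diffeomorphisms of the plane are affine *)

Section bernstein.
Variable R : realType.
Notation E := 'rV[R]_2.

Opaque partial.

(** The second-derivative test for the auxiliary function of the gradient estimate, along one axis.
    Here [r] is the squared radius, [X] the offset in the direction of motion and [Y] the square of
    the other offset. *)
Lemma bernstein_line (U V A C U1 V1 A1 C1 : R -> R) (u2 v2 a2 c2 X Y r k d : R) : 0 < d ->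
  (forall t : R, is_derive t (1 : R) U (U1 t)) -> (forall t : R, is_derive t (1 : R) V (V1 t)) ->
  (forall t : R, is_derive t (1 : R) A (A1 t)) -> (forall t : R, is_derive t (1 : R) C (C1 t)) ->
  is_derive (0 : R) (1 : R) U1 u2 -> is_derive (0 : R) (1 : R) V1 v2 ->
  is_derive (0 : R) (1 : R) A1 a2 -> is_derive (0 : R) (1 : R) C1 c2 ->
  let eta t := r - (X + t) ^+ 2 - Y in
  let w t := eta t ^+ 2 * (A t ^+ 2 + C t ^+ 2) + k * (U t ^+ 2 + V t ^+ 2) in
  (forall t, `|t| < d -> w t <= w 0) ->
  (8 * X ^+ 2 - 4 * eta 0) * (A 0 ^+ 2 + C 0 ^+ 2)
  - 16 * X * eta 0 * (A 0 * A1 0 + C 0 * C1 0)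
  + 2 * eta 0 ^+ 2 * (A1 0 ^+ 2 + A 0 * a2 + C1 0 ^+ 2 + C 0 * c2)
  + 2 * k * (U1 0 ^+ 2 + U 0 * u2 + V1 0 ^+ 2 + V 0 * v2) <= 0.
Proof.
move=> d0 dU dV dA dC dU1 dV1 dA1 dC1 eta w wmax.
pose w1 t := (- 4 * (X + t)) * eta t * (A t ^+ 2 + C t ^+ 2)
  + eta t ^+ 2 * (2 * (A t * A1 t + C t * C1 t)) + k * (2 * (U t * U1 t + V t * V1 t)).
have dw (t : R) : is_derive t (1 : R) w (w1 t).
  rewrite /w /eta; apply: is_derive_eq; rewrite /w1 /eta /GRing.scale /=.
  by move: (U t) (V t) (A t) (C t) (U1 t) (V1 t) (A1 t) (C1 t) => *; ring.
apply: (second_derivative_test d0 dw _ wmax).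
rewrite /w1 /eta; apply: is_derive_eq; rewrite /GRing.scale /=.
by move: (U 0) (V 0) (A 0) (C 0) (U1 0) (V1 0) (A1 0) (C1 0) => *; ring.
Qed.

(** With z = X + i Y and F' = A + i C, the difference of the two sides is 4 |eta F'' - 2 conj(z)
    F'|^2. The coefficient 12 r, produced by the 3 r of the auxiliary function, is the one that
    completes this square. *)
Lemma bernstein_algebra (A C A1 C1 X Y eta r : R) : 0 <= eta ->
  eta = r - X ^+ 2 - Y ^+ 2 ->
  4 * r * (A ^+ 2 + C ^+ 2) <=
  (8 * X ^+ 2 - 4 * eta) * (A ^+ 2 + C ^+ 2) - 16 * X * eta * (A * A1 + C * C1)
  + (8 * Y ^+ 2 - 4 * eta) * (A ^+ 2 + C ^+ 2) - 16 * Y * eta * (A * - C1 + C * A1)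
  + 4 * eta ^+ 2 * (A1 ^+ 2 + C1 ^+ 2) + 12 * r * (A ^+ 2 + C ^+ 2).
Proof.
move=> eta0 etaE; rewrite -subr_ge0.
set D := (X in 0 <= X).
have -> : D = 4 * ((eta * A1 - 2 * (X * A + Y * C)) ^+ 2 + (eta * C1 - 2 * (X * C - Y * A)) ^+ 2).
  by rewrite /D etaE; ring.
by rewrite mulr_ge0 // addr_ge0 // sqr_ge0.
Qed.

(** The two inequalities are the tests along both axes. In their sum the terms with [a2], [c2], [U]
    and [V] cancel, because the functions are harmonic, and [bernstein_algebra] bounds the rest from
    below. *)
Lemma bernstein_conclude (A C A1 C1 a2 c2 U V X Y eta r : R) : 0 < r -> 0 <= eta ->
  eta = r - X ^+ 2 - Y ^+ 2 ->
  (8 * X ^+ 2 - 4 * (r - X ^+ 2 - Y ^+ 2)) * (A ^+ 2 + C ^+ 2)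
  - 16 * X * (r - X ^+ 2 - Y ^+ 2) * (A * A1 + C * C1)
  + 2 * (r - X ^+ 2 - Y ^+ 2) ^+ 2 * (A1 ^+ 2 + A * a2 + C1 ^+ 2 + C * c2)
  + 2 * (3 * r) * (A ^+ 2 + U * A1 + C ^+ 2 + V * C1) <= 0 ->
  (8 * Y ^+ 2 - 4 * (r - Y ^+ 2 - X ^+ 2)) * (A ^+ 2 + C ^+ 2)
  - 16 * Y * (r - Y ^+ 2 - X ^+ 2) * (A * - C1 + C * A1)
  + 2 * (r - Y ^+ 2 - X ^+ 2) ^+ 2 * ((- C1) ^+ 2 + A * - a2 + A1 ^+ 2 + C * - c2)
  + 2 * (3 * r) * ((- C) ^+ 2 + U * - A1 + A ^+ 2 + V * - C1) <= 0 ->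
  A ^+ 2 + C ^+ 2 <= 0.
Proof.
move=> r0 eta0 etaE; rewrite (addrAC r (- Y ^+ 2)) -etaE => h0 h1.
have h2 := bernstein_algebra A C A1 C1 eta0 etaE.
have h3 := lerD h0 h1; rewrite addr0 in h3.
have h4 : 4 * r * (A ^+ 2 + C ^+ 2) <= 0.
  apply: le_trans h2 (le_trans _ h3).
  by rewrite le_eqVlt; apply/orP; left; apply/eqP; ring.
by move: h4; rewrite pmulr_rle0 // mulr_gt0.
Qed.

Definition holo (U V : E -> R) :=
  [/\ csm U, csm V, forall x, partial 0 U x = partial 1 V x &
      forall x, partial 1 U x = - partial 0 V x].

Lemma partial_opp i (f : E -> R) : csm f -> partial i (fun x => - f x) = (fun x => - partial i f x).
Proof.
move=> fs; apply/funext => x; rewrite !partialE.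
by rewrite -[fun x => _]/(- f) deriveN //; exact: csm_derivable.
Qed.

Lemma holo_deriv U V : holo U V -> holo (partial 0 U) (partial 0 V).
Proof.
move=> [Us Vs CR0 CR1]; split; try exact: csm_partial.
  by move=> x; rewrite (csm_schwarz 1 0 Vs) (_ : partial 1 V = partial 0 U) //; apply/funext.
move=> x; rewrite (csm_schwarz 1 0 Us) (_ : partial 1 U = fun x => - partial 0 V x).
  by rewrite partial_opp //; exact: csm_partial.
exact/funext.
Qed.

Lemma csm_coord i : csm (fun x : E => x 0 i).
Proof.
apply: (@csm_coind R (fun f => f = (fun x => x 0 i) \/ exists a, f = cst a)); last by left.
move=> _ [->|[a ->]]; split => [x|j]; right || idtac.
- exact: differentiable_coord.
- exists ((j == i)%:R); apply/funext => x.
  rewrite partialE deriveE; last exact: differentiable_coord.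
  have -> : (fun x : E => x 0 i) = lin2 ((i == 0)%:R : R) ((i == 1)%:R).
    by move: i; apply: ord2P; apply/funext => y; rewrite /lin2 /= ?mulr1 ?mulr0 ?addr0 ?add0r.
  rewrite diff_lin; last exact: lin2_continuous.
  rewrite -[LHS]/(lin2 (i == 0)%:R (i == 1)%:R (@ebase R j)) /lin2 !ebaseE /=.
  move: j i; apply: ord2P; apply: ord2P; by rewrite /= ?mulr1 ?mulr0 ?addr0 ?add0r.
- exact: differentiable_cst.
- by exists 0; rewrite partial_cst.
Qed.

Lemma csm_sqr_coordB i (a : R) : csm (fun x : E => (x 0 i - a) ^+ 2).
Proof.
have h : csm (fun x : E => x 0 i - a) by exact: (csmD (csm_coord i) (csm_cst (- a))).
exact: (csmM h h).
Qed.

Definition disc (p : E) (r : R) : set E :=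
  [set x | (x 0 0 - p 0 0) ^+ 2 + (x 0 1 - p 0 1) ^+ 2 <= r ^+ 2].

Lemma disc_compact p r : 0 < r -> compact (disc p r).
Proof.
move=> r0; apply: bounded_closed_compact.
  exists (`|p| + r); split => [|M pM x /= xd]; first exact: num_real.
  apply: le_trans (ltW pM); rewrite -[x](subrK p) addrC.
  apply: le_trans (ler_normD _ _) _; rewrite lerD2l.
  have r0' := ltW r0.
  apply: norm2_le => // i; rewrite !mxE.
  rewrite -ler_sqr ?nnegrE // real_normK ?num_real //.
  apply: le_trans xd; move: i; apply: ord2P.
    by rewrite lerDl sqr_ge0.
  by rewrite lerDr sqr_ge0.
apply: (@closed_comp _ _ (fun x : E => (x 0 0 - p 0 0) ^+ 2 + (x 0 1 - p 0 1) ^+ 2)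
   [set y | y <= r ^+ 2]); last exact: closed_le.
move=> x _; apply: csm_continuous; apply: csmD; exact: csm_sqr_coordB.
Qed.

Lemma line_coord (x : E) i t j : (x + t *: @ebase R i) 0 j = x 0 j + t * (i == j)%:R.
Proof. by rewrite !mxE eqxx /= eq_sym. Qed.

(* Bernstein's method: with F = U + i V and eta = r^2 - |x - p|^2, the function
   w = eta^2 |F'|^2 + 3 r^2 |F|^2 has Laplacian at least 4 r^2 |F'|^2 in the disc,
   so eta F' = 0 where w is maximal and the maximum is at most 3 r^2 B. *)
Lemma holo_gradient_estimate U V p r B : holo U V -> 0 < r ->
  (forall x, disc p r x -> U x ^+ 2 + V x ^+ 2 <= B) ->
  partial 0 U p ^+ 2 + partial 0 V p ^+ 2 <= 3 * B / r ^+ 2.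
Proof.
move=> hUV r0 UVB; have [Us Vs CR0 CR1] := hUV.
have hUV1 := holo_deriv hUV; have [As Cs CA0 CA1] := hUV1.
have [A1s C1s CB0 CB1] := holo_deriv hUV1.
pose A := partial 0 U; pose C := partial 0 V.
pose A1 := partial 0 A; pose C1 := partial 0 C.
pose eta (x : E) := r ^+ 2 - (x 0 0 - p 0 0) ^+ 2 - (x 0 1 - p 0 1) ^+ 2.
pose w x := eta x ^+ 2 * (A x ^+ 2 + C x ^+ 2) + 3 * r ^+ 2 * (U x ^+ 2 + V x ^+ 2).
have ws : csm w.
  have sq (f : E -> R) : csm f -> csm (fun x => f x ^+ 2) by move=> fs; exact: (csmM fs fs).
  have etas : csm eta.
    rewrite (_ : eta = (cst (r ^+ 2) \+ (cst (-1) \* (fun x => (x 0 0 - p 0 0) ^+ 2))) \+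
       (cst (-1) \* (fun x => (x 0 1 - p 0 1) ^+ 2))).
      apply: csmD; last by apply: csmM; [exact: csm_cst|exact: csm_sqr_coordB].
      apply: csmD; first exact: csm_cst.
      by apply: csmM; [exact: csm_cst|exact: csm_sqr_coordB].
    by apply/funext => x; rewrite /eta /= !mulN1r.
  apply: csmD; apply: csmM.
  - exact: sq.
  - by apply: csmD; apply: sq.
  - exact: csm_cst.
  - by apply: csmD; apply: sq.
have D0 : disc p r !=set0 by exists p; rewrite /disc /= !subrr expr0n addr0 sqr_ge0.
have [c] := EVT_max_rV D0 (@disc_compact p r r0) (continuous_subspaceT (csm_continuous ws)).
rewrite inE => cD cmax.
have wp : w p = (r ^+ 2) ^+ 2 * (A p ^+ 2 + C p ^+ 2) + 3 * r ^+ 2 * (U p ^+ 2 + V p ^+ 2).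
  by rewrite /w /eta !subrr expr0n !subr0.
have r20 : 0 < r ^+ 2 by rewrite exprn_gt0.
suff wc : w c <= 3 * r ^+ 2 * B.
  have pD : p \in disc p r by rewrite inE /disc /= !subrr expr0n addr0 sqr_ge0.
  have := le_trans (cmax p pD) wc; rewrite wp => H.
  rewrite ler_pdivlMr // -(ler_pM2l r20).
  have : 0 <= 3 * r ^+ 2 * (U p ^+ 2 + V p ^+ 2) by rewrite !mulr_ge0 // ?addr_ge0 ?sqr_ge0 // ltW.
  move: H; rewrite -/A -/C; move: (A p ^+ 2 + C p ^+ 2) (U p ^+ 2 + V p ^+ 2) (r ^+ 2) => a u s.
  by move=> h1 h2; move: h1 h2; rewrite expr2; lra.
have wle : A c ^+ 2 + C c ^+ 2 <= 0 \/ eta c = 0 -> w c <= 3 * r ^+ 2 * B.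
  have := UVB c cD; rewrite /w => Bc [AC|->].
    have -> : A c ^+ 2 + C c ^+ 2 = 0.
      by apply/eqP; rewrite eq_le AC /= addr_ge0 // sqr_ge0.
    by rewrite mulr0 add0r ler_wpM2l // mulr_ge0 // ltW.
  by rewrite expr0n mul0r add0r ler_wpM2l // mulr_ge0 // ltW.
apply: wle.
have eta0 : 0 <= eta c by rewrite /eta -addrA -opprD subr_ge0.
have [eta1|] := ltP 0 (eta c); last by move=> h; right; apply/eqP; rewrite eq_le h.
left.
have etas : continuous eta.
  move=> x; apply: csm_continuous.
  rewrite (_ : eta = (cst (r ^+ 2) \+ (cst (-1) \* (fun x => (x 0 0 - p 0 0) ^+ 2))) \+
     (cst (-1) \* (fun x => (x 0 1 - p 0 1) ^+ 2))).
    apply: csmD; last by apply: csmM; [exact: csm_cst|exact: csm_sqr_coordB].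
    apply: csmD; first exact: csm_cst.
    by apply: csmM; [exact: csm_cst|exact: csm_sqr_coordB].
  by apply/funext => y; rewrite /eta /= !mulN1r.
(* The maximum is interior where eta > 0, so both axis lines through [c] stay in the disc for a
   while. *)
have [d d0 dD] : exists2 d : R, 0 < d & forall y : E, `|y - c| < d -> y \in disc p r.
  have /cvgrPdist_lt /(_ _ eta1) /nbhs_ballP [d /= d0 H] := etas c.
  exists d => // y yc; rewrite inE /disc /=.
  have := H y; rewrite -ball_normE /= distrC => /(_ yc).
  rewrite ltr_norml => /andP[_]; rewrite ltrBlDr -ltrBlDl subrr /eta => h.
  by rewrite -subr_ge0 opprD addrA ltW.
have line_max i t : `|t| < d -> w (c + t *: @ebase R i) <= w c.
  move=> td; apply: cmax; apply: dD; rewrite addrAC subrr add0r.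
  exact: le_lt_trans (normZ_ebase _ _) td.
have L (f : E -> R) i (t : R) : csm f ->
    is_derive t (1 : R) (fun t => f (c + t *: @ebase R i)) (partial i f (c + t *: @ebase R i)).
  by move=> fs; rewrite partialE; apply: line_derive; exact: csm_derivable.
have L0 (f g : E -> R) i : csm f -> (forall x, partial i f x = g x) ->
    is_derive (0 : R) (1 : R) (fun t => f (c + t *: @ebase R i)) (g c).
  move=> fs fg; have := L f i 0 fs; rewrite fg scale0r addr0; exact.
have z0 i : c + (0 : R) *: @ebase R i = c by rewrite scale0r addr0.
set X := c 0 0 - p 0 0; set Y := c 0 1 - p 0 1.
have etaE : eta c = r ^+ 2 - X ^+ 2 - Y ^+ 2 by [].
have w0 (t : R) : w (c + t *: @ebase R 0) =
    (r ^+ 2 - (X + t) ^+ 2 - Y ^+ 2) ^+ 2 *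
      (A (c + t *: @ebase R 0) ^+ 2 + C (c + t *: @ebase R 0) ^+ 2) +
    3 * r ^+ 2 * (U (c + t *: @ebase R 0) ^+ 2 + V (c + t *: @ebase R 0) ^+ 2).
  by rewrite /w /eta !line_coord /= mulr1 mulr0 addr0 (addrAC (c 0 0)).
have w1 (t : R) : w (c + t *: @ebase R 1) =
    (r ^+ 2 - (Y + t) ^+ 2 - X ^+ 2) ^+ 2 *
      (A (c + t *: @ebase R 1) ^+ 2 + C (c + t *: @ebase R 1) ^+ 2) +
    3 * r ^+ 2 * (U (c + t *: @ebase R 1) ^+ 2 + V (c + t *: @ebase R 1) ^+ 2).
  rewrite /w /eta !line_coord /= mulr1 mulr0 addr0 (addrAC (c 0 1)).
  by rewrite [_ - X ^+ 2 - _]addrAC.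
have A1E x : partial 1 A x = - C1 x := CA1 x.
have C1E x : partial 1 C x = A1 x := esym (CA0 x).
have b0 := @bernstein_line _ _ _ _ _ _ _ _ _ _ _ _ X (Y ^+ 2) (r ^+ 2) (3 * r ^+ 2) d d0
  (fun t => L U 0 t Us) (fun t => L V 0 t Vs) (fun t => L A 0 t As) (fun t => L C 0 t Cs)
  (L0 A A1 0 As (fun=> erefl)) (L0 C C1 0 Cs (fun=> erefl))
  (L0 A1 (partial 0 A1) 0 A1s (fun=> erefl)) (L0 C1 (partial 0 C1) 0 C1s (fun=> erefl)).
have opp1 (f g : E -> R) : csm g -> (forall x, partial 1 f x = - g x) ->
    forall x, partial 1 (partial 1 f) x = - partial 1 g x.
  move=> gs fg x; rewrite (_ : partial 1 f = fun x => - g x) ?partial_opp //; exact/funext.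
have U11 x : partial 1 (partial 1 U) x = - A1 x by rewrite (opp1 _ C Cs CR1) C1E.
have V11 x : partial 1 (partial 1 V) x = - C1 x.
  have Vf : partial 1 V = A by apply/funext => y; exact: esym (CR0 y).
  exact: etrans (congr1 (fun f => partial 1 f x) Vf) (A1E x).
have A11 x : partial 1 (partial 1 A) x = - partial 0 A1 x.
  by rewrite (opp1 _ C1 C1s A1E) -CB0.
have C11 x : partial 1 (partial 1 C) x = - partial 0 C1 x.
  have Cf : partial 1 C = A1 by apply/funext => y; exact: C1E.
  exact: etrans (congr1 (fun f => partial 1 f x) Cf) (CB1 x).
have b1 := @bernstein_line _ _ _ _ _ _ _ _ _ _ _ _ Y (X ^+ 2) (r ^+ 2) (3 * r ^+ 2) d d0
  (fun t => L U 1 t Us) (fun t => L V 1 t Vs) (fun t => L A 1 t As) (fun t => L C 1 t Cs)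
  (L0 _ (fun x => - A1 x) 1 (csm_partial 1 Us) U11) (L0 _ (fun x => - C1 x) 1 (csm_partial 1 Vs) V11)
  (L0 _ (fun x => - partial 0 A1 x) 1 (csm_partial 1 As) A11)
  (L0 _ (fun x => - partial 0 C1 x) 1 (csm_partial 1 Cs) C11).
have P0 (t : R) : `|t| < d -> (r ^+ 2 - (X + t) ^+ 2 - Y ^+ 2) ^+ 2 *
      (A (c + t *: @ebase R 0) ^+ 2 + C (c + t *: @ebase R 0) ^+ 2) +
    3 * r ^+ 2 * (U (c + t *: @ebase R 0) ^+ 2 + V (c + t *: @ebase R 0) ^+ 2) <=
    (r ^+ 2 - (X + 0) ^+ 2 - Y ^+ 2) ^+ 2 *
      (A (c + (0 : R) *: @ebase R 0) ^+ 2 + C (c + (0 : R) *: @ebase R 0) ^+ 2) +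
    3 * r ^+ 2 * (U (c + (0 : R) *: @ebase R 0) ^+ 2 + V (c + (0 : R) *: @ebase R 0) ^+ 2).
  by move=> td; rewrite -w0 -w0 z0; exact: line_max.
have P1 (t : R) : `|t| < d -> (r ^+ 2 - (Y + t) ^+ 2 - X ^+ 2) ^+ 2 *
      (A (c + t *: @ebase R 1) ^+ 2 + C (c + t *: @ebase R 1) ^+ 2) +
    3 * r ^+ 2 * (U (c + t *: @ebase R 1) ^+ 2 + V (c + t *: @ebase R 1) ^+ 2) <=
    (r ^+ 2 - (Y + 0) ^+ 2 - X ^+ 2) ^+ 2 *
      (A (c + (0 : R) *: @ebase R 1) ^+ 2 + C (c + (0 : R) *: @ebase R 1) ^+ 2) +
    3 * r ^+ 2 * (U (c + (0 : R) *: @ebase R 1) ^+ 2 + V (c + (0 : R) *: @ebase R 1) ^+ 2).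
  by move=> td; rewrite -w1 -w1 z0; exact: line_max.
move: (b0 P0) (b1 P1); rewrite /= !z0 !addr0 A1E C1E CR1 -(CR0 c).
exact: (bernstein_conclude r20 eta0 etaE).
Qed.

End bernstein.

(** * Entire functions *)

Section complex_functions.
Variable R : realType.
Notation E := 'rV[R]_2.
Notation C := (complex R).
Notation re := (@complex.Re R).
Notation im := (@complex.Im R).
Implicit Types F G : E -> C.

Opaque partial.

Lemma complex_ext (z w : C) : re z = re w -> im z = im w -> z = w.
Proof. by case: z w => [a b] [c d] /= -> ->. Qed.

Lemma reM (z w : C) : re (z * w) = re z * re w - im z * im w.
Proof. by case: z w => [a b] [c d]. Qed.

Lemma imM (z w : C) : im (z * w) = re z * im w + im z * re w.
Proof. by case: z w => [a b] [c d]. Qed.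

Lemma reD (z w : C) : re (z + w) = re z + re w.
Proof. by case: z w => [a b] [c d]. Qed.

Lemma imD (z w : C) : im (z + w) = im z + im w.
Proof. by case: z w => [a b] [c d]. Qed.

Lemma reN (z : C) : re (- z) = - re z. Proof. by case: z. Qed.
Lemma imN (z : C) : im (- z) = - im z. Proof. by case: z. Qed.

Definition sqnorm (z : C) : R := re z ^+ 2 + im z ^+ 2.

Lemma sqnormM z w : sqnorm (z * w) = sqnorm z * sqnorm w.
Proof. by rewrite /sqnorm reM imM; move: (re z) (im z) (re w) (im w) => *; ring. Qed.

Lemma sqnorm_ge0 z : 0 <= sqnorm z.
Proof. by rewrite addr_ge0 // sqr_ge0. Qed.

Lemma sqnorm_eq0 z : (sqnorm z == 0) = (z == 0).
Proof.
rewrite /sqnorm paddr_eq0 ?sqr_ge0 // !sqrf_eq0; apply/andP/eqP.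
  by move=> [/eqP r0 /eqP i0]; apply: complex_ext.
by move=> ->.
Qed.

Lemma sqnorm_gt0 z : (0 < sqnorm z) = (z != 0).
Proof. by rewrite lt_def sqnorm_ge0 andbT sqnorm_eq0. Qed.

Definition reF F : E -> R := fun x => re (F x).
Definition imF F : E -> R := fun x => im (F x).

Definition holomorphic F := holo (reF F) (imF F).

(** For a holomorphic function the complex derivative is its derivative along the real axis. *)
Definition cderiv F : E -> C := fun x => Complex (partial 0 (reF F) x) (partial 0 (imF F) x).

Lemma holomorphic_cderiv F : holomorphic F -> holomorphic (cderiv F).
Proof. exact: holo_deriv. Qed.

Lemma holomorphic_cst (a : C) : holomorphic (fun=> a) /\ cderiv (fun=> a) = (fun=> 0).
Proof.
have p i (b : R) x : partial i (fun=> b : R) x = 0 by rewrite (@partial_cst R i b).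
split; last by apply/funext => x; rewrite /cderiv /reF /imF !p.
split; [exact: csm_cst|exact: csm_cst|move=> x|move=> x]; rewrite /reF /imF !p //.
by rewrite oppr0.
Qed.

Lemma holomorphicD F G : holomorphic F -> holomorphic G ->
  holomorphic (fun x => F x + G x) /\
  cderiv (fun x => F x + G x) = (fun x => cderiv F x + cderiv G x).
Proof.
move=> [Fr Fi F0 F1] [Gr Gi G0 G1].
have Er : reF (fun x => F x + G x) = reF F \+ reF G by apply/funext => x; exact: reD.
have Ei : imF (fun x => F x + G x) = imF F \+ imF G by apply/funext => x; exact: imD.
split.
  split; rewrite ?Er ?Ei; try exact: csmD.
    by move=> x; rewrite !partialD //= F0 G0.
  by move=> x; rewrite !partialD //= F1 G1 opprD.
by apply/funext => x; rewrite /cderiv Er Ei !partialD.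
Qed.

Lemma holomorphicM F G : holomorphic F -> holomorphic G ->
  holomorphic (fun x => F x * G x) /\
  cderiv (fun x => F x * G x) = (fun x => cderiv F x * G x + F x * cderiv G x).
Proof.
move=> [Fr Fi F0 F1] [Gr Gi G0 G1].
have Er : reF (fun x => F x * G x) =
    (reF F \* reF G) \+ (cst (-1) \* (imF F \* imF G)).
  by apply/funext => x; rewrite /reF /imF /= reM mulN1r.
have Ei : imF (fun x => F x * G x) = (reF F \* imF G) \+ (imF F \* reF G).
  by apply/funext => x; exact: imM.
have c1 : csm (cst (-1) : E -> R) by exact: csm_cst.
have s1 := csmM Fr Gr; have s2 := csmM c1 (csmM Fi Gi).
have s3 := csmM Fr Gi; have s4 := csmM Fi Gr.
have pr i x : partial i (reF (fun x => F x * G x)) x =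
    partial i (reF F) x * reF G x + reF F x * partial i (reF G) x
    - (partial i (imF F) x * imF G x + imF F x * partial i (imF G) x).
  rewrite Er partialD // !partialM //; last exact: csmM.
  by rewrite partial_cst /= mul0r add0r mulN1r.
have pi i x : partial i (imF (fun x => F x * G x)) x =
    partial i (reF F) x * imF G x + reF F x * partial i (imF G) x
    + (partial i (imF F) x * reF G x + imF F x * partial i (reF G) x).
  by rewrite Ei partialD // !partialM.
split.
  split.
  - by rewrite Er; exact: csmD.
  - by rewrite Ei; exact: csmD.
  - move=> x; rewrite pr pi F1 G1 F0 G0.
    by move: (partial _ _ _) (partial _ _ _) (partial _ _ _) (partial _ _ _) => *; ring.
  - move=> x; rewrite pr pi F1 G1 -F0 -G0.
    by move: (partial _ _ _) (partial _ _ _) (partial _ _ _) (partial _ _ _) => *; ring.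
apply/funext => x; apply: complex_ext; rewrite ?reD ?imD ?reM ?imM /= ?pr ?pi /reF /imF;
by move: (partial _ _ _) (partial _ _ _) (partial _ _ _) (partial _ _ _) => *; ring.
Qed.

Lemma holomorphicN F : holomorphic F ->
  holomorphic (fun x => - F x) /\ cderiv (fun x => - F x) = (fun x => - cderiv F x).
Proof.
move=> hF; have [h1 d1] := holomorphic_cst (-1).
have [h2 d2] := holomorphicM h1 hF.
have E1 : (fun x => - F x) = (fun x => -1 * F x) by apply/funext => x; rewrite mulN1r.
rewrite E1 d2; split => //; apply/funext => x.
by rewrite d1 mul0r add0r mulN1r.
Qed.

Lemma holomorphicV F : holomorphic F -> (forall x, F x != 0) ->
  holomorphic (fun x => (F x)^-1) /\
  cderiv (fun x => (F x)^-1) = (fun x => - cderiv F x * (F x)^-1 * (F x)^-1).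
Proof.
move=> hF Fneq0; have [Fr Fi F0 F1] := hF.
pose n := (reF F \* reF F) \+ (imF F \* imF F).
have n0 x : n x != 0.
  by rewrite (_ : n x = sqnorm (F x)) ?sqnorm_eq0 // /sqnorm !expr2.
have ns : csm n by apply: csmD; exact: csmM.
have nV := csmV ns n0.
have c1 : csm (cst (-1) : E -> R) by exact: csm_cst.
have Er : reF (fun x => (F x)^-1) = reF F \* (fun x => (n x)^-1).
  by apply/funext => x; rewrite /n /reF /imF /=; case: (F x) => a b /=; rewrite !expr2.
have Ei : imF (fun x => (F x)^-1) = cst (-1) \* (imF F \* (fun x => (n x)^-1)).
  by apply/funext => x; rewrite /n /reF /imF /=; case: (F x) => a b /=; rewrite mulN1r !expr2.
have s1 := csmM Fr nV; have s2 := csmM c1 (csmM Fi nV).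
have pn i x : partial i n x = 2 * (reF F x * partial i (reF F) x + imF F x * partial i (imF F) x).
  rewrite /n partialD; [|exact: csmM|exact: csmM]; rewrite !partialM //=.
  by move: (partial _ _ _) (partial _ _ _) => *; ring.
have pV i x : partial i (fun x => (n x)^-1) x = - partial i n x * (n x)^-1 * (n x)^-1.
  rewrite partialV_diff //= ?mulN1r ?mulNr ?mulrA //.
  by move=> y; exact: csm_differentiable.
have pr i x : partial i (reF (fun x => (F x)^-1)) x =
    partial i (reF F) x * (n x)^-1 + reF F x * (- partial i n x * (n x)^-1 * (n x)^-1).
  by rewrite Er partialM //= pV.
have pi i x : partial i (imF (fun x => (F x)^-1)) x =
    - (partial i (imF F) x * (n x)^-1 + imF F x * (- partial i n x * (n x)^-1 * (n x)^-1)).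
  rewrite Ei partialM //; last exact: csmM.
  by rewrite partialM //= partial_cst /= mul0r add0r mulN1r pV.
have nE x : n x = reF F x * reF F x + imF F x * imF F x by [].
split.
  split.
  - by rewrite Er.
  - by rewrite Ei.
  - move=> x; rewrite pr pi !pn F1 -F0; have := n0 x; rewrite nE.
    by move: (partial _ _ _) (partial _ _ _) (reF F x) (imF F x) => p q a b h; field.
  - move=> x; rewrite pr pi !pn F1 -F0; have := n0 x; rewrite nE.
    by move: (partial _ _ _) (partial _ _ _) (reF F x) (imF F x) => p q a b h; field.
apply/funext => x.
have V : (F x)^-1 = Complex (reF F x / n x) (- (imF F x / n x)).
  by apply: complex_ext; rewrite /n /reF /imF /=; case: (F x) => a b /=; rewrite !expr2.
apply: complex_ext; rewrite !(reM, imM, reN, imN) V /= ?pr ?pi !pn;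
  have := n0 x; rewrite nE;
by move: (partial _ _ _) (partial _ _ _) (reF F x) (imF F x) => p q a b h; field.
Qed.

Lemma const_of_partials (f : E -> R) : csm f -> (forall i x, partial i f x = 0) ->
  forall x y, f x = f y.
Proof.
move=> fs f0 x y; have [|t _] := @line_MVT R f y (x - y).
  by move=> t _; exact: csm_derivable.
rewrite csm_deriveE // !f0 !mulr0 addr0 (addrC y) subrK => /eqP.
by rewrite subr_eq0 => /eqP.
Qed.

Lemma cderiv0_const F : holomorphic F -> (forall x, cderiv F x = 0) -> forall x y, F x = F y.
Proof.
move=> [Fr Fi F0 F1] d0 x y.
have r0 z : partial 0 (reF F) z = 0 by have := congr1 re (d0 z).
have i0 z : partial 0 (imF F) z = 0 by have := congr1 im (d0 z).
apply: complex_ext.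
  apply: (const_of_partials Fr); apply: ord2P => z; first exact: r0.
  by rewrite F1 i0 oppr0.
apply: (const_of_partials Fi); apply: ord2P => z; first exact: i0.
by rewrite -F0 r0.
Qed.

Lemma cderiv_estimate F p r B : holomorphic F -> 0 < r ->
  (forall x, disc p r x -> sqnorm (F x) <= B) -> sqnorm (cderiv F p) <= 3 * B / r ^+ 2.
Proof. exact: holo_gradient_estimate. Qed.

Lemma liouville_bounded F B : holomorphic F -> (forall x, sqnorm (F x) <= B) ->
  forall x y, F x = F y.
Proof.
move=> hF FB; apply: cderiv0_const => // p; apply/eqP; rewrite -sqnorm_eq0.
have B0 : 0 <= B := le_trans (sqnorm_ge0 _) (FB p).
rewrite eq_le sqnorm_ge0 andbT; apply/ler_addgt0Pl => e e0; rewrite addr0.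
(* As r >= 1, r^2 >= r >= 3 B / e, so the gradient estimate on this radius gives at most e. *)
pose r : R := 1 + 3 * B / e.
have h0 : 0 <= 3 * B / e by rewrite divr_ge0 ?mulr_ge0 // ltW.
have r1 : 1 <= r by rewrite lerDl.
have r0 : 0 < r by apply: lt_le_trans r1.
apply: le_trans (cderiv_estimate hF r0 (fun x _ => FB x)) _.
rewrite ler_pdivrMr ?exprn_gt0 // -ler_pdivrMl // mulrC.
apply: (@le_trans _ _ r); first by rewrite /r lerDr.
by rewrite expr2 ler_peMr // ltW.
Qed.

End complex_functions.

(** * The complex exponential *)

Section exponential.
Variable R : realType.
Notation E := 'rV[R]_2.
Notation C := (complex R).
Notation re := (@complex.Re R).
Notation im := (@complex.Im R).

Opaque partial.

(** The real part of a e^(z + i b). As for [wave], the free phase makes the family stable under both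
    partials; the phase - pi / 2 gives the imaginary part of e^z. *)
Definition expcos (a b : R) : E -> R := fun x => a * expR (x 0 0) * cos (x 0 1 + b).

Lemma expcos_differentiable a b x : differentiable (expcos a b) x.
Proof.
have -> : expcos a b = a \*: (((@expR R) \o (fun x : E => x 0 0)) \* ((@cos R) \o (fun x : E => x 0 1 + b))).
  by apply/funext => y; rewrite /expcos /= -mulrA.
apply: differentiableZ; apply: differentiableM; apply: differentiable_comp.
- exact: differentiable_coord.
- by apply/derivable1_diffP; exact: derivable_expR.
- by apply: differentiableD; [exact: differentiable_coord|exact: differentiable_cst].
- by apply/derivable1_diffP; exact: derivable_cos.
Qed.

Lemma partial0_expcos a b : partial 0 (expcos a b) = expcos a b.
Proof.
apply/funext => x; apply: partial_line; rewrite /expcos.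
have -> : (fun h : R => a * expR ((x + h *: @ebase R 0) 0 0) * cos ((x + h *: @ebase R 0) 0 1 + b)) =
    (fun h : R => a * expR (x 0 0 + h) * cos (x 0 1 + b)).
  by apply/funext => h; rewrite !line_coord /= mulr1 mulr0 addr0.
apply: is_derive_eq; rewrite addr0 /GRing.scale /=.
by move: (cos _) (expR _) => *; ring.
Qed.

Lemma partial1_expcos a b : partial 1 (expcos a b) = expcos a (b + pi / 2).
Proof.
apply/funext => x; apply: partial_line; rewrite /expcos.
have -> : (fun h : R => a * expR ((x + h *: @ebase R 1) 0 0) * cos ((x + h *: @ebase R 1) 0 1 + b)) =
    (fun h : R => a * expR (x 0 0) * cos ((x 0 1 + b) + h)).
  by apply/funext => h; rewrite !line_coord /= mulr1 mulr0 addr0 addrAC.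
apply: is_derive_eq; rewrite addr0 addrA cosDpihalf /GRing.scale /=.
by move: (sin _) (expR _) => *; ring.
Qed.

Lemma csm_expcos a b : csm (expcos a b).
Proof.
apply: (@csm_coind R (fun f => exists a b, f = expcos a b)); last by exists a, b.
move=> _ [a' [b' ->]]; split => [x|]; first exact: expcos_differentiable.
apply: ord2P; first by rewrite partial0_expcos; exists a', b'.
by rewrite partial1_expcos; exists a', (b' + pi / 2).
Qed.

Definition cexp (x : E) : C := Complex (expR (x 0 0) * cos (x 0 1)) (expR (x 0 0) * sin (x 0 1)).

Lemma reF_cexp : reF cexp = expcos 1 0.
Proof. by apply/funext => x; rewrite /reF /expcos /= mul1r addr0. Qed.

Lemma imF_cexp : imF cexp = expcos 1 (- (pi / 2)).
Proof. by apply/funext => x; rewrite /imF /expcos /= mul1r cosBpihalf. Qed.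

Lemma holomorphic_cexp : holomorphic cexp /\ cderiv cexp = cexp.
Proof.
have s0 x : expcos 1 (- (pi / 2) + pi / 2) x = expcos 1 0 x by rewrite addNr.
split.
  split; rewrite ?reF_cexp ?imF_cexp; try exact: csm_expcos.
    by move=> x; rewrite partial0_expcos partial1_expcos s0.
  move=> x; rewrite partial1_expcos partial0_expcos /expcos !mul1r add0r.
  by rewrite cosDpihalf cosBpihalf mulrN.
apply/funext => x; rewrite /cderiv reF_cexp imF_cexp !partial0_expcos.
by rewrite -reF_cexp -imF_cexp /reF /imF; case: (cexp x).
Qed.

Lemma sqnorm_cexp x : sqnorm (cexp x) = expR (x 0 0) ^+ 2.
Proof.
rewrite /sqnorm /= !exprMn -mulrDr.
by rewrite cos2Dsin2 mulr1.
Qed.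

Lemma cexp_neq0 x : cexp x != 0.
Proof. by rewrite -sqnorm_gt0 sqnorm_cexp exprn_gt0 // expR_gt0. Qed.

Definition toE (z : C) : E := re z *: @ebase R 0 + im z *: @ebase R 1.
Definition toC (x : E) : C := Complex (x 0 0) (x 0 1).

Lemma toE0 z : toE z 0 0 = re z.
Proof. by rewrite /toE !mxE /= mulr1 mulr0 addr0. Qed.

Lemma toE1 z : toE z 0 1 = im z.
Proof. by rewrite /toE !mxE /= mulr1 mulr0 add0r. Qed.

Lemma toEK z : toC (toE z) = z.
Proof. by apply: complex_ext; rewrite /= ?toE0 ?toE1. Qed.

Lemma toCK x : toE (toC x) = x.
Proof. by rewrite [RHS]rV2E. Qed.

Lemma cexp_surj (z : C) : z != 0 -> exists x, cexp x = z.
Proof.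
move=> z0; have n0 : 0 < sqnorm z by rewrite sqnorm_gt0.
pose r := Num.sqrt (sqnorm z).
have r0 : 0 < r by rewrite sqrtr_gt0.
have r2 : r ^+ 2 = re z ^+ 2 + im z ^+ 2 by rewrite sqr_sqrtr // ltW.
pose c := re z / r.
have c2 : c ^+ 2 = 1 - (im z / r) ^+ 2.
  by rewrite /c !expr_div_n r2 -[1](divff (x := r ^+ 2)) ?r2 -?mulrBl ?addrK // -r2 expf_neq0 // gt_eqF.
have c1 : -1 <= c <= 1.
  by rewrite -ler_norml -(@ler_sqr _ `|c|) ?nnegrE // real_normK ?num_real // c2 expr1n gerBl sqr_ge0.
have ex : expR (ln r) = r by rewrite lnK // posrE.
have cz (t : R) : cos t = c -> sin t = im z / r -> exists x, cexp x = z.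
  move=> ct st; exists (toE (Complex (ln r) t)); rewrite /cexp toE0 toE1 /= ex ct st.
  by apply: complex_ext; rewrite /= /c mulrC divfK // gt_eqF.
have sq : Num.sqrt (1 - c ^+ 2) = `|im z| / r.
  rewrite c2 opprB addrC subrK sqrtr_sqr normf_div [`|r|]ger0_norm //; exact: ltW.
have [i0|i0] := leP 0 (im z).
  by apply: (cz (acos c)); rewrite ?acosK ?sin_acos // sq ger0_norm.
apply: (cz (- acos c)); first by rewrite cosN acosK.
by rewrite sinN sin_acos // sq ltr0_norm // mulNr opprK.
Qed.

(** Composition with e^z replaces the punctured plane by the whole plane: quotients by W - W 0
    become entire, so Liouville's theorem applies without a discussion of isolated singularities. *)
Lemma holomorphic_comp_cexp (W : E -> C) : holomorphic W ->
  holomorphic (fun x => W (toE (cexp x))) /\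
  cderiv (fun x => W (toE (cexp x))) = (fun x => cexp x * cderiv W (toE (cexp x))).
Proof.
move=> [Wr Wi W0 W1].
have [[er ei e0 e1] ed] := holomorphic_cexp.
have Pr i x := (csm_comp_diff x Wr er ei).2 i.
have Pi i x := (csm_comp_diff x Wi er ei).2 i.
have ed0 x : partial 0 (reF cexp) x = reF cexp x by have := congr1 re (congr1 (@^~ x) ed).
have ed1 x : partial 0 (imF cexp) x = imF cexp x by have := congr1 im (congr1 (@^~ x) ed).
have pr i x : partial i (reF (fun x => W (toE (cexp x)))) x =
    partial 0 (reF W) (toE (cexp x)) * partial i (reF cexp) x +
    partial 1 (reF W) (toE (cexp x)) * partial i (imF cexp) x by exact: Pr.
have pi i x : partial i (imF (fun x => W (toE (cexp x)))) x =
    partial 0 (imF W) (toE (cexp x)) * partial i (reF cexp) x +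
    partial 1 (imF W) (toE (cexp x)) * partial i (imF cexp) x by exact: Pi.
split.
  split.
  - exact: (csm_comp Wr er ei).
  - exact: (csm_comp Wi er ei).
  - move=> x; rewrite pr pi W1 -W0 -(e0 x) (e1 x) ed0 ed1.
    by move: (partial _ _ _) (partial _ _ _) (reF cexp x) (imF cexp x) => *; ring.
  - move=> x; rewrite pr pi W1 -W0 -(e0 x) (e1 x) ed0 ed1.
    by move: (partial _ _ _) (partial _ _ _) (reF cexp x) (imF cexp x) => *; ring.
apply/funext => x; apply: complex_ext.
  rewrite reM -[LHS]/(partial 0 (reF (fun x => W (toE (cexp x)))) x) pr W1 ed0 ed1 /=.
  rewrite -[expR _ * cos _]/(reF cexp x) -[expR _ * sin _]/(imF cexp x).
  by move: (partial _ _ _) (partial _ _ _) (reF cexp x) (imF cexp x) => *; ring.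
rewrite imM -[LHS]/(partial 0 (imF (fun x => W (toE (cexp x)))) x) pi -W0 ed0 ed1 /=.
rewrite -[expR _ * cos _]/(reF cexp x) -[expR _ * sin _]/(imF cexp x).
by move: (partial _ _ _) (partial _ _ _) (reF cexp x) (imF cexp x) => *; ring.
Qed.

End exponential.

(** * Entire maps with a smooth left inverse are affine *)

Section plane_automorphisms.
Variable R : realType.
Notation E := 'rV[R]_2.
Notation C := (complex R).
Notation re := (@complex.Re R).
Notation im := (@complex.Im R).

Opaque partial.

Lemma four_le_sum (a b c d : R) : 0 <= a -> 0 <= b -> 0 <= c -> 0 <= d ->
  [/\ a <= a + b + (c + d), b <= a + b + (c + d), c <= a + b + (c + d) & d <= a + b + (c + d)].
Proof. by move=> *; split; lra. Qed.

Lemma disc_bound (f : E -> R) p r : csm f -> 0 < r ->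
  exists2 B, 0 <= B & forall x, disc p r x -> `|f x| <= B.
Proof.
move=> fs r0.
have D0 : disc p r !=set0 by exists p; rewrite /disc /= !subrr expr0n addr0 sqr_ge0.
have nc : continuous (fun x => f x ^+ 2) by exact: csm_continuous (csmM fs fs).
have [c _ cmax] := EVT_max_rV D0 (@disc_compact R p r r0) (continuous_subspaceT nc).
exists `|f c| => // x xD.
rewrite -ler_sqr ?nnegrE // !real_normK ?num_real //.
by apply: cmax; rewrite inE.
Qed.

Lemma sup_le_sqnorm (x : E) : `|x| ^+ 2 <= sqnorm (toC x).
Proof.
have h i : `|x 0 i| <= Num.sqrt (sqnorm (toC x)).
  rewrite -ler_sqr ?nnegrE ?sqrtr_ge0 // sqr_sqrtr ?sqnorm_ge0 // real_normK ?num_real //.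
  by rewrite /sqnorm /=; move: i; apply: ord2P; rewrite ?lerDl ?lerDr sqr_ge0.
have H := norm2_le (sqrtr_ge0 _) h.
by rewrite -[leRHS]sqr_sqrtr ?sqnorm_ge0 // ler_sqr ?nnegrE ?sqrtr_ge0.
Qed.

Lemma sqnorm_le_sup (x : E) : sqnorm (toC x) <= 2 * `|x| ^+ 2.
Proof.
have h i : x 0 i ^+ 2 <= `|x| ^+ 2.
  by rewrite -(@real_normK _ (x 0 i)) ?num_real // ler_sqr ?nnegrE // coord_le.
rewrite /sqnorm /= (_ : 2 * _ = `|x| ^+ 2 + `|x| ^+ 2); last by ring.
by apply: lerD.
Qed.

Lemma disc_sqnorm (p x : E) r : disc p r x <-> sqnorm (toC (x - p)) <= r ^+ 2.
Proof. by rewrite /disc /sqnorm /= !mxE. Qed.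

Variables (W : E -> C) (psi0 psi1 : E -> R).
Hypothesis hW : holomorphic W.
Hypotheses (psi0s : csm psi0) (psi1s : csm psi1).
Hypothesis psiK : forall x, toE (Complex (psi0 (toE (W x))) (psi1 (toE (W x)))) = x.

Let W_inj x y : W x = W y -> x = y.
Proof. by move=> Wxy; rewrite -(psiK x) Wxy psiK. Qed.

Let psiE0 x : psi0 (toE (W x)) = x 0 0.
Proof. by rewrite -[in RHS](psiK x) toE0. Qed.

Let psiE1 x : psi1 (toE (W x)) = x 0 1.
Proof. by rewrite -[in RHS](psiK x) toE1. Qed.

Let toE_sub (z w : C) : toC (toE z - toE w) = z - w.
Proof. by apply: complex_ext; rewrite /= !mxE ?reD ?imD ?reN ?imN; case: z w => a b [c d] /=; rewrite !mulr1 !mulr0 ?addr0 ?add0r. Qed.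

(** Continuity of the left inverse at [W 0]: where [W z] is close to [W 0], z itself is close to
    0. *)
Let far : exists2 d, 0 < d & forall z, 1 <= sqnorm (toC z) -> d <= sqnorm (W z - W 0).
Proof.
have near (f : E -> R) : csm f -> exists2 d, 0 < d & forall y, `|y - toE (W 0)| < d ->
    `|f y - f (toE (W 0))| < 2^-1.
  move=> fs; have h : 0 < 2^-1 :> R by rewrite invr_gt0.
  have /cvgrPdist_lt /(_ _ h) := @csm_continuous R f fs (toE (W 0)).
  move/nbhs_ballP => [d /= d0 H]; exists d => // y yx.
  by rewrite distrC; apply: H; rewrite -ball_normE /= distrC.
have [d0 d00 H0] := near _ psi0s; have [d1 d10 H1] := near _ psi1s.
pose d := Num.min d0 d1; have dgt0 : 0 < d by rewrite lt_min d00.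
exists (d ^+ 2); first by rewrite exprn_gt0.
move=> z z1; rewrite leNgt; apply/negP => Wd.
have wd : `|toE (W z) - toE (W 0)| < d.
  rewrite -ltr_sqr ?nnegrE ?(ltW dgt0) //.
  by apply: le_lt_trans (sup_le_sqnorm _) _; rewrite toE_sub.
have [dd0 dd1] : d <= d0 /\ d <= d1 by rewrite !ge_min !lexx orbT.
have := H0 _ (lt_le_trans wd dd0); have := H1 _ (lt_le_trans wd dd1).
rewrite !psiE0 !psiE1 !mxE !subr0.
have half (a : R) : `|a| < 2^-1 -> a ^+ 2 < 2^-1.
  move=> h; rewrite -real_normK ?num_real //; apply: le_lt_trans (h).
  by rewrite expr2 ler_piMl // ltW // (lt_trans h) // invf_lt1 // ltr1n.
move=> /half h1 /half h0; move: z1; rewrite /sqnorm /= leNgt => /negP; apply.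
by rewrite (splitr 1) div1r; exact: ltrD.
Qed.

(** The mean value theorem for the left inverse, whose partials are bounded on a disc about [W 0]
    chosen to contain the segments from [W 0] to [W z]. *)
Let lipschitz r : 0 < r -> exists2 M, 0 <= M & forall z, sqnorm (toC z) <= r ^+ 2 ->
  sqnorm (toC z) <= M * sqnorm (W z - W 0).
Proof.
move=> r0; have [Wr Wi _ _] := hW.
have [B0 B00 H0] := disc_bound 0 Wr r0; have [B1 B10 H1] := disc_bound 0 Wi r0.
pose s : R := 1 + 2 * ((B0 + `|re (W 0)|) + (B1 + `|im (W 0)|)).
have h0 : 0 <= B0 + `|re (W 0)| by rewrite addr_ge0.
have h1 : 0 <= B1 + `|im (W 0)| by rewrite addr_ge0.
have s0 : 0 < s by rewrite /s; lra.
have psiB (f : E -> R) : csm f -> exists2 B, 0 <= B & forall i y, disc (toE (W 0)) s y -> `|partial i f y| <= B.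
  move=> fs; have [C0 C00 D0] := disc_bound (toE (W 0)) (csm_partial 0 fs) s0.
  have [C1 C10 D1] := disc_bound (toE (W 0)) (csm_partial 1 fs) s0.
  exists (C0 + C1); first exact: addr_ge0.
  apply: ord2P => y yD.
    by apply: le_trans (D0 y yD) _; rewrite lerDl.
  by apply: le_trans (D1 y yD) _; rewrite lerDr.
have [C0 C00 D0] := psiB _ psi0s; have [C1 C10 D1] := psiB _ psi1s.
exists (4 * C0 ^+ 2 + 4 * C1 ^+ 2); first by rewrite addr_ge0 // mulr_ge0 // sqr_ge0.
move=> z zr; have zD : disc 0 r z by apply/disc_sqnorm; rewrite subr0.
pose h := toE (W z) - toE (W 0).
have h_le : `|h| <= s / 2.
  have s2 : 0 <= s / 2 by rewrite divr_ge0 // ltW.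
  apply: norm2_le => //; apply: ord2P; rewrite /h !mxE /= !mulr1 !mulr0 ?addr0 ?add0r.
    apply: le_trans (ler_normB _ _) _; have := H0 z zD; rewrite /reF /s.
    by move: `|re (W z)| => a; lra.
  apply: le_trans (ler_normB _ _) _; have := H1 z zD; rewrite /imF /s.
  by move: `|im (W z)| => a; lra.
have hD (t : R) : 0 <= t <= 1 -> disc (toE (W 0)) s (toE (W 0) + t *: h).
  move=> /andP[t0 t1]; apply/disc_sqnorm; rewrite addrC addKr.
  apply: le_trans (sqnorm_le_sup _) _; rewrite normrZ (ger0_norm t0) exprMn.
  have e1 : `|h| ^+ 2 <= (s / 2) ^+ 2 by rewrite ler_sqr ?nnegrE // divr_ge0 // ltW.
  have e2 : t ^+ 2 <= 1 by rewrite expr_le1.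
  apply: (@le_trans _ _ (2 * (1 * (s / 2) ^+ 2))).
    by rewrite ler_wpM2l // ler_pM // sqr_ge0.
  by rewrite mul1r expr_div_n; have := sqr_ge0 s; move: (s ^+ 2) => q; lra.
have key (f : E -> R) B : csm f -> 0 <= B -> (forall i y, disc (toE (W 0)) s y -> `|partial i f y| <= B) ->
    (f (toE (W z)) - f (toE (W 0))) ^+ 2 <= 4 * B ^+ 2 * sqnorm (W z - W 0).
  move=> fs B0' fB; have [|t t01] := @line_MVT R f (toE (W 0)) h.
    by move=> t _; exact: csm_derivable.
  have -> : toE (W 0) + h = toE (W z) by rewrite /h addrC subrK.
  rewrite csm_deriveE // => ->.
  have hB : `|h 0 0 * partial 0 f (toE (W 0) + t *: h) + h 0 1 * partial 1 f (toE (W 0) + t *: h)|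
      <= 2 * B * `|h|.
    by apply: norm_lin_le; [exact: coord_le|exact: coord_le|apply: fB; exact: hD|apply: fB; exact: hD].
  rewrite -real_normK ?num_real //.
  apply: (@le_trans _ _ ((2 * B * `|h|) ^+ 2)).
    by rewrite ler_sqr ?nnegrE // !mulr_ge0.
  rewrite exprMn (_ : (2 * B) ^+ 2 = 4 * B ^+ 2); last by ring.
  by rewrite ler_wpM2l ?mulr_ge0 ?sqr_ge0 // -toE_sub sup_le_sqnorm.
have := key _ _ psi0s C00 D0; have := key _ _ psi1s C10 D1.
rewrite !psiE0 !psiE1 !mxE !subr0 => k1 k0.
by rewrite mulrDl /sqnorm /=; exact: lerD.
Qed.

(** The expansion is centred at z and evaluated at 0, so that W'(z) appears: in the logarithmic
    coordinate the left side is Phi - Phi', the numerator of [P]. *)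
Let taylor2 r : 0 < r -> exists2 M, 0 <= M & forall z, sqnorm (toC z) <= r ^+ 2 ->
  sqnorm (W z - W 0 - toC z * cderiv W z) <= M * sqnorm (toC z) ^+ 2.
Proof.
move=> r0; have [Wr Wi W0 W1] := hW.
have ddB (f : E -> R) : csm f -> exists2 B, 0 <= B & forall i j y, disc 0 r y -> `|partial i (partial j f) y| <= B.
  move=> fs; have b i j := disc_bound 0 (csm_partial i (csm_partial j fs)) r0.
  have [C0 C00 D0] := b 0 0; have [C1 C10 D1] := b 0 1.
  have [C2 C20 D2] := b 1 0; have [C3 C30 D3] := b 1 1.
  exists (C0 + C1 + (C2 + C3)); first by rewrite !addr_ge0.
  have [q0 q1 q2 q3] := four_le_sum C00 C10 C20 C30.
  move=> i j y yD; move: i j; apply: ord2P; apply: ord2P.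
  - exact: le_trans (D0 y yD) q0.
  - exact: le_trans (D1 y yD) q1.
  - exact: le_trans (D2 y yD) q2.
  - exact: le_trans (D3 y yD) q3.
have key (f : E -> R) : csm f -> exists2 B, 0 <= B & forall z, sqnorm (toC z) <= r ^+ 2 ->
    (f z - f 0 - (z 0 0 * partial 0 f z + z 0 1 * partial 1 f z)) ^+ 2 <= B * sqnorm (toC z) ^+ 2.
  move=> fs; have [B B0 fB] := ddB f fs; exists (16 * B ^+ 2).
    by rewrite mulr_ge0 // sqr_ge0.
  move=> z zr.
  have := @second_order_bound R f B z (- z) fs; rewrite subrr normrN.
  have -> : f 0 - f z - lin2 (partial 0 f z) (partial 1 f z) (- z) =
      - (f z - f 0 - (z 0 0 * partial 0 f z + z 0 1 * partial 1 f z)).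
    by rewrite /lin2 !mxE; move: (partial _ _ _) (partial _ _ _) => *; ring.
  rewrite normrN => H.
  rewrite -real_normK ?num_real //.
  apply: (@le_trans _ _ ((4 * B * `|z| ^+ 2) ^+ 2)).
    rewrite ler_sqr ?nnegrE ?mulr_ge0 ?sqr_ge0 // H // => i j t /andP[t0 t1].
    apply: fB; apply/disc_sqnorm; rewrite subr0.
    have -> : toC (z + t *: - z) = Complex (1 - t) 0 * toC z.
      by apply: complex_ext; rewrite ?reM ?imM /= !mxE; ring.
    rewrite sqnormM; apply: le_trans zr; rewrite ler_piMl ?sqnorm_ge0 //.
    rewrite /sqnorm /= expr0n addr0 expr_le1 ?subr_ge0 //; lra.
  rewrite exprMn (_ : (4 * B) ^+ 2 = 16 * B ^+ 2); last by ring.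
  by rewrite ler_wpM2l ?mulr_ge0 ?sqr_ge0 // ler_sqr ?nnegrE ?sqr_ge0 ?sqnorm_ge0 // sup_le_sqnorm.
have [B0 B00 H0] := key _ Wr; have [B1 B10 H1] := key _ Wi.
exists (B0 + B1); first exact: addr_ge0.
move=> z zr; have := H0 z zr; have := H1 z zr.
rewrite W1 -(W0 z) => h1 h0; rewrite mulrDl; apply: le_trans (lerD h0 h1).
rewrite le_eqVlt; apply/orP; left; apply/eqP.
rewrite /sqnorm !(reD, imD, reN, imN, reM, imM) /=.
rewrite -[re (W z)]/(reF W z) -[im (W z)]/(imF W z) -[re (W 0)]/(reF W 0) -[im (W 0)]/(imF W 0).
by move: (partial _ _ _) (partial _ _ _) (reF _ _) (imF _ _) (reF _ _) (imF _ _) => *; ring.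
Qed.

(* Phi is W - W 0 in the logarithmic coordinate.  It has no zero, kappa = e^z / Phi
   satisfies kappa' = e^z P, and P is bounded: for Re x <= 1 by Taylor expansion
   of W at 0, and for Re x >= 1 because kappa = O(e^z), by the gradient estimate.
   Hence P is constant and z = (a + b z) (W - W 0), where b = 0 since W is
   injective and defined at - a / b. *)
Let Phi x := W (toE (cexp x)) - W 0.

Let hPhi : holomorphic Phi /\ cderiv Phi = (fun x => cexp x * cderiv W (toE (cexp x))).
Proof.
have [h1 d1] := holomorphic_comp_cexp hW; have [h2 d2] := holomorphic_cst (- W 0).
have [h3 d3] := holomorphicD h1 h2; split => //.
by rewrite /Phi d3 d1 d2; apply/funext => x; rewrite addr0.
Qed.

Let Phi_neq0 x : Phi x != 0.
Proof.
rewrite subr_eq0; apply/eqP => /W_inj /(congr1 (@toC R)); rewrite toEK => c0.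
have := cexp_neq0 x; rewrite c0 (_ : toC (0 : E) = 0) ?eqxx //.
by apply: complex_ext; rewrite /= mxE.
Qed.

Let P x := (Phi x - cderiv Phi x) * ((Phi x)^-1 * (Phi x)^-1).
Let kappa x := cexp x * (Phi x)^-1.

Let hP : holomorphic P.
Proof.
have [h1 d1] := hPhi; have [h2 d2] := holomorphicV h1 Phi_neq0.
have [h3 _] := holomorphicN (holomorphic_cderiv h1).
have [h4 _] := holomorphicD h1 h3; have [h5 _] := holomorphicM h2 h2.
by have [h6 _] := holomorphicM h4 h5.
Qed.

Let hkappa : holomorphic kappa /\ cderiv kappa = (fun x => cexp x * P x).
Proof.
have [h1 d1] := hPhi; have [h2 d2] := holomorphicV h1 Phi_neq0.
have [h3 d3] := holomorphic_cexp R; have [h4 d4] := holomorphicM h3 h2.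
split => //; rewrite /kappa d4 d3 d2; apply/funext => x; rewrite /P.
by have := Phi_neq0 x; move: (Phi x) (cderiv Phi x) (cexp x) => p q c p0; field.
Qed.

Let P_bounded : exists B, forall x, sqnorm (P x) <= B.
Proof.
have [d d0 farW] := far; have e0 : 0 < expR 1 :> R by exact: expR_gt0.
have [M M0 lipW] := lipschitz e0; have [T T0 taylorW] := taylor2 e0.
exists (T * M ^+ 2 + 3 * expR 1 ^+ 2 / d) => x.
have TM : 0 <= T * M ^+ 2 by rewrite mulr_ge0 // sqr_ge0.
have ed : 0 <= 3 * expR 1 ^+ 2 / d by rewrite divr_ge0 ?(ltW d0) // mulr_ge0 // sqr_ge0.
have PhiV y : sqnorm (Phi y)^-1 = (sqnorm (Phi y))^-1.
  have p0 : sqnorm (Phi y) != 0 by rewrite sqnorm_eq0.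
  apply: (mulfI p0); rewrite -sqnormM divff // divff // /sqnorm /=.
  by rewrite expr1n expr0n addr0.
(* For Re x <= 1, |Phi - Phi'| is at most a constant times |e^x|^2, and |e^x| at most a constant
   times |Phi|, which compensates the denominator Phi^2. *)
have [x1|x1] := leP (x 0 0) 1.
  apply: (@le_trans _ _ (T * M ^+ 2)); last by rewrite lerDl.
  set z := toE (cexp x); have zE : toC z = cexp x by rewrite toEK.
  have zr : sqnorm (toC z) <= expR 1 ^+ 2.
    by rewrite zE sqnorm_cexp ler_sqr ?nnegrE ?expR_ge0 // ler_expR.
  have := taylorW z zr; have := lipW z zr.
  rewrite zE -[W z - W 0]/(Phi x) /P hPhi.2 -/z !sqnormM !PhiV.
  have p0 : 0 < sqnorm (Phi x) by rewrite sqnorm_gt0.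
  move: (sqnorm_ge0 (cexp x)) p0; move: (sqnorm (cexp x)) (sqnorm (Phi x)) (sqnorm (_ - _)).
  move=> n p q n0 p0 np qn.
  rewrite -invfM -expr2 ler_pdivrMr ?exprn_gt0 //; apply: le_trans qn _.
  rewrite -mulrA -exprMn ler_wpM2l //.
  by rewrite ler_sqr ?nnegrE // mulr_ge0 // ltW.
apply: (@le_trans _ _ (3 * expR 1 ^+ 2 / d)); last by rewrite lerDr.
(* On the unit disc about a point with real part above 1 the real part stays positive; hence |e^y|
   >= 1 and [far] bounds 1 / Phi. *)
have kB y : disc x 1 y -> sqnorm (kappa y) <= expR (x 0 0 + 1) ^+ 2 / d.
  move=> yD; have yx : `|y 0 0 - x 0 0| <= 1.
    rewrite -(@ler_sqr _ `|_|) ?nnegrE // real_normK ?num_real //.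
    by apply: le_trans yD; rewrite lerDl sqr_ge0.
  move: yx; rewrite ler_norml => /andP[y0 y1].
  have cy : 1 <= sqnorm (toC (toE (cexp y))).
    rewrite toEK sqnorm_cexp exprn_ege1 // -expR0 ler_expR; lra.
  rewrite /kappa sqnormM PhiV sqnorm_cexp.
  apply: ler_pM; rewrite ?sqr_ge0 ?invr_ge0 ?sqnorm_ge0 //.
    by rewrite ler_sqr ?nnegrE ?expR_ge0 // ler_expR; lra.
  by rewrite lef_pV2 ?posrE ?sqnorm_gt0 // farW.
have := cderiv_estimate hkappa.1 ltr01 kB.
rewrite hkappa.2 sqnormM sqnorm_cexp expr1n divr1 expRD exprMn.
have c0 : 0 < expR (x 0 0) ^+ 2 :> R by rewrite exprn_gt0 // expR_gt0.
move: c0; move: (expR (x 0 0) ^+ 2) (sqnorm (P x)) (expR 1 ^+ 2) => c p e c0.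
by rewrite (_ : 3 * (c * e / d) = c * (3 * e / d)) ?ler_pM2l //; ring.
Qed.

Lemma plane_automorphism_affine : exists2 k : C, k != 0 & forall x, W x = W 0 + k * toC x.
Proof.
have [B PB] := P_bounded; have Pc := liouville_bounded hP PB.
pose b := P 0; have PE x : P x = b by exact: Pc.
have [hk dk] := hkappa; have [he de] := holomorphic_cexp R.
have [hb db] := holomorphic_cst (- b); have [h1 d1] := holomorphicM hb he.
have [h2 d2] := holomorphicD hk h1.
have d0 x : cderiv (fun x => kappa x + - b * cexp x) x = 0.
  by rewrite d2 d1 dk db de PE mul0r add0r mulNr mulrC subrr.
have kc := cderiv0_const h2 d0.
pose a := kappa 0 + - b * cexp 0.
have kE x : cexp x = (a + b * cexp x) * Phi x.
  have := kc x 0; rewrite -/a /kappa => <-; rewrite mulNr subrK.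
  by rewrite mulrVK // unitfE.
have W_eq (z : C) : z != 0 -> z = (a + b * z) * (W (toE z) - W 0).
  by move=> /cexp_surj[x <-]; exact: kE.
have i1 : (1 : C) != 0 := oner_neq0 _.
have i2 : (2 : C) != 0 by rewrite pnatr_eq0.
have toE_inj : injective (@toE R) := can_inj (@toEK R).
have b0 : b = 0.
  apply/eqP; apply: contraT => bn0.
  (* For a = 0 the function W - W 0 would equal 1 / b both at 1 and at 2, against injectivity. *)
  have [a0|an0] := eqVneq a 0.
    have W1 := W_eq 1 i1; have W2 := W_eq 2 i2.
    have : W (toE 1) = W (toE 2).
      apply: (addIr (- W 0)); apply: (mulfI bn0).
      move: W1 W2; rewrite a0 !add0r mulr1 => <- W2.
      by apply: (mulfI i2); rewrite mulr1 {1}W2 mulrA (mulrC 2).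
    move=> /W_inj /toE_inj /eqP; rewrite -subr_eq0 (_ : 1 - 2 = -1 :> C) ?oppr_eq0 ?(negbTE i1) //.
    by ring.
  (* At z = - a / b the right side of [W_eq] vanishes although z does not. *)
  have z0 : - a / b != 0 by rewrite mulf_neq0 ?oppr_eq0 ?invr_eq0.
  have := W_eq _ z0; rewrite mulrCA divff // mulr1 subrr mul0r => /eqP.
  by rewrite (negbTE z0).
have W_eq' (z : C) : z != 0 -> z = a * (W (toE z) - W 0).
  by move=> /W_eq; rewrite b0 mul0r addr0.
have a0 : a != 0.
  by apply/eqP => a0; have /eqP := W_eq' 1 i1; rewrite a0 mul0r oner_eq0.
exists a^-1; first by rewrite invr_eq0.
move=> x; have [x0|xn0] := eqVneq (toC x) 0.
  by rewrite x0 mulr0 addr0 -[x]toCK x0; congr W; rewrite -[0 in RHS]toCK; congr toE;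
     apply: complex_ext; rewrite /= mxE.
have := W_eq' _ xn0; rewrite toCK => ->.
by rewrite mulKf // addrC subrK.
Qed.

End plane_automorphisms.

(** * Conformal factors of Liouville metrics *)

Section Liouville_scalar.
Variable R : realType.
Notation E := 'rV[R]_2.
Notation re := (@complex.Re R).
Notation im := (@complex.Im R).

Opaque partial.

Lemma sum_ord2 (V : nmodType) (F : 'I_2 -> V) : \sum_(i < 2) F i = F 0 + F 1.
Proof. by rewrite big_ord_recl big_ord1; congr (_ + F _); exact: val_inj. Qed.

(** Intermediate values along segments from 0. Applied to the Jacobian, [e] records whether the
    diffeomorphism preserves orientation. *)
Lemma csm_neq0_sign (J : E -> R) : csm J -> (forall x, J x != 0) ->
  exists2 e : R, e ^+ 2 = 1 & forall x, 0 < e * J x.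
Proof.
move=> Js J0; exists (Num.sg (J 0)); first by rewrite sqr_sg J0.
move=> x; rewrite -sgr_gt0 sgrM sgr_id -sgrM sgr_gt0 ltNge; apply/negP => H.
pose h (t : R) := J (0 + t *: x).
have hc : {within `[0, 1], continuous h}.
  apply: continuous_subspaceT => t; apply/differentiable_continuous/derivable1_diffP.
  by case: (@line_derive R J 0 x t (@csm_derivable R J _ _ Js)).
have h0 : h 0 = J 0 by rewrite /h scale0r addr0.
have h1 : h 1 = J x by rewrite /h scale1r add0r.
have [|c _ /eqP] := @IVT R h 0 1 0 ler01 hc; last by rewrite (negbTE (J0 _)).
rewrite h0 h1 ge_min le_max.
have := J0 0; have := J0 x; move: H; move: (J 0) (J x) => a b H b0 a0.
case: (ltgtP 0 a) a0 => // a0 _; case: (ltgtP 0 b) b0 => // b0 _; rewrite ?orbT //.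
  by move: H; rewrite leNgt mulr_gt0.
by move: H; rewrite leNgt nmulr_rgt0 // b0.
Qed.

(** Lagrange's identity (a^2 + c^2)(b^2 + d^2) = (a b + c d)^2 + (a d - b c)^2 excludes a zero
    Jacobian, and l > 0 excludes N = 0. *)
Lemma conformal_algebra (N l a b c d : R) : 0 < l ->
  l = N * (a * a + c * c) -> 0 = N * (a * b + c * d) -> l = N * (b * b + d * d) ->
  [/\ a * a + c * c = b * b + d * d, a * b + c * d = 0 & a * d - b * c != 0].
Proof.
move=> l0 e0 e1 e2.
have N0 : N != 0 by apply: contraTneq l0 => N0; rewrite e0 N0 mul0r ltxx.
have k1 : a * a + c * c = b * b + d * d by apply: (mulfI N0); rewrite -e0.
have k2 : a * b + c * d = 0 by apply: (mulfI N0); rewrite -e1 mulr0.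
split => //; apply: contraTneq l0 => J0.
have : (a * a + c * c) ^+ 2 = 0.
  rewrite expr2 {2}k1 (_ : _ * _ = (a * b + c * d) ^+ 2 + (a * d - b * c) ^+ 2); last by ring.
  by rewrite k2 J0 expr0n addr0.
by move=> /eqP; rewrite sqrf_eq0 e0 => /eqP ->; rewrite mulr0 ltxx.
Qed.

(** By Lagrange's identity again, the common squared length of the columns is the absolute value of
    the Jacobian; this makes (a - e d)^2 + (b + e c)^2 equal to 0. *)
Lemma conformal_cauchy_riemann (e a b c d : R) : e ^+ 2 = 1 -> 0 < e * (a * d - b * c) ->
  a * a + c * c = b * b + d * d -> a * b + c * d = 0 ->
  a = e * d /\ b = - (e * c).
Proof.
move=> e1 J0 k1 k2.
pose n := a * a + c * c; pose J := e * (a * d - b * c).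
have nJ : n ^+ 2 = J ^+ 2.
  rewrite /J exprMn e1 mul1r expr2 {2}/n k1.
  have -> : (a * d - b * c) ^+ 2 = (a * d - b * c) ^+ 2 + (a * b + c * d) ^+ 2 by rewrite k2 expr0n addr0.
  by rewrite /n; ring.
have n0 : 0 <= n by rewrite addr_ge0 // -expr2 sqr_ge0.
have {}nJ : n = J by apply/eqP; rewrite -(@eqrXn2 _ 2) ?nJ // ltW.
have : (a - e * d) ^+ 2 + (b + e * c) ^+ 2 = 0.
  have -> : (a - e * d) ^+ 2 + (b + e * c) ^+ 2 =
    a * a + b * b + e ^+ 2 * (d * d + c * c) - 2 * J by rewrite /J; ring.
  by rewrite e1 -nJ /n; move: k1; move: (a * a) (b * b) (c * c) (d * d) => *; lra.
move=> /eqP; rewrite paddr_eq0 ?sqr_ge0 // !sqrf_eq0 subr_eq0 addr_eq0.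
by move=> /andP[/eqP -> /eqP ->].
Qed.

(** Differentiation in t shows that the derivative of Lam along p is constant along q; the
    conclusion is its derivative along q, written out. *)
Lemma mixed_difference_derive (Lam : E -> R) p q : csm Lam ->
  (forall x t s, Lam (x + t *: p + s *: q) - Lam (x + t *: p) - Lam (x + s *: q) + Lam x = 0) ->
  forall x, q 0 0 * (p 0 0 * partial 0 (partial 0 Lam) x + p 0 1 * partial 0 (partial 1 Lam) x) +
            q 0 1 * (p 0 0 * partial 1 (partial 0 Lam) x + p 0 1 * partial 1 (partial 1 Lam) x) = 0.
Proof.
move=> Ls H x.
have Dp y s : 'D_p Lam (y + s *: q) = 'D_p Lam y.
  have d z : is_derive (0 : R) (1 : R) (fun t : R => Lam (z + t *: p)) ('D_p Lam z).
    have := @line_derive R Lam z p 0 (@csm_derivable R Lam _ _ Ls).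
    by rewrite scale0r addr0.
  have d1 := d (y + s *: q); have d0 := d y.
  have E1 : (fun t : R => Lam (y + s *: q + t *: p)) =
      (fun t : R => Lam (y + t *: p) + (Lam (y + s *: q) - Lam y)).
    apply/funext => t; have := H y t s; rewrite [y + s *: q + _]addrAC => h.
    by move: h; move: (Lam _) (Lam _) (Lam _) (Lam _) => a b c e h; lra.
  have d2 : is_derive (0 : R) (1 : R) (fun t : R => Lam (y + s *: q + t *: p)) ('D_p Lam y).
    by rewrite E1; apply: is_derive_eq; rewrite addr0.
  by rewrite -(@derive_val _ _ _ _ _ _ _ d1) (@derive_val _ _ _ _ _ _ _ d2).
pose G := (cst (p 0 0) \* partial 0 Lam) \+ (cst (p 0 1) \* partial 1 Lam).
have c0 := csm_cst (p 0 0); have c1 := csm_cst (p 0 1).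
have s0 := csm_partial 0 Ls; have s1 := csm_partial 1 Ls.
have Gs : csm G by apply: csmD; exact: csmM.
have GE y : G y = 'D_p Lam y by rewrite csm_deriveE.
have G0 : 'D_q G x = 0.
  have d := @line_derive R G x q 0 (@csm_derivable R G _ _ Gs).
  have E1 : (fun t : R => G (x + t *: q)) = cst (G x).
    by apply/funext => t; rewrite !GE Dp.
  have := @derive_val _ _ _ _ _ _ _ d; rewrite scale0r addr0 => <-.
  by rewrite E1 derive_cst.
move: G0; rewrite csm_deriveE //.
have pG i : partial i G x = p 0 0 * partial i (partial 0 Lam) x + p 0 1 * partial i (partial 1 Lam) x.
  rewrite /G (partialD i (csmM c0 s0) (csmM c1 s1)) (partialM i c0 s0) (partialM i c1 s1).
  rewrite !partial_cst /=.
  by move: (partial _ _ _) (partial _ _ _) (partial _ _ _) (partial _ _ _) => *; ring.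
by rewrite !pG.
Qed.

(** Up to the orientation sign the new coordinates are the parts of a holomorphic map W, which is
    affine with slope k = a + i b. So Lam is a sum of functions of Re(k z) and Im(k z), and its
    second derivative along the two level directions vanishes. *)
Lemma Liouville_scalar_relation (Lam : E -> R) : csm Lam -> (forall x, 0 < Lam x) ->
  Liouville (fun x => (Lam x)%:M) ->
  exists a b : R, (a, b) != (0, 0) /\ forall x,
    (a ^+ 2 - b ^+ 2) * partial 0 (partial 1 Lam) x +
    a * b * (partial 0 (partial 0 Lam) x - partial 1 (partial 1 Lam) x) = 0.
Proof.
move=> Ls Lpos [phi [L1 [L2 [[psi [phiK psiK phis psis]] Leq]]]].
pose f0 := component phi 0; pose f1 := component phi 1.
have f0s : csm f0 by exact/smooth_csm/phis.
have f1s : csm f1 by exact/smooth_csm/phis.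
pose N x := L1 (f0 x) + L2 (f1 x).
pose J := (partial 0 f0 \* partial 1 f1) \+ (cst (-1) \* (partial 1 f0 \* partial 0 f1)).
have Js : csm J.
  have c1 := @csm_cst R (-1).
  by apply: csmD; [apply: csmM; exact: csm_partial|apply: csmM => //; apply: csmM; exact: csm_partial].
have JE x : J x = partial 0 f0 x * partial 1 f1 x - partial 1 f0 x * partial 0 f1 x.
  by rewrite /J /= mulN1r.
have eqs x i j : Lam x *+ (i == j) = N x * (partial i f0 x * partial j f0 x + partial i f1 x * partial j f1 x).
  by have := Leq x i j; rewrite mxE sum_ord2.
have alg x := conformal_algebra (Lpos x) (eqs x 0 0) (eqs x 0 1) (eqs x 1 1).
have J0 x : J x != 0 by rewrite JE; have [] := alg x.
have [e e1 eJ] := csm_neq0_sign Js J0.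
have CR x : partial 0 f0 x = e * partial 1 f1 x /\ partial 1 f0 x = - (e * partial 0 f1 x).
  have [k1 k2 _] := alg x; apply: conformal_cauchy_riemann => //.
  by rewrite -JE.
pose ef1 := cst e \* f1.
have ce := @csm_cst R e.
have ef1s : csm ef1 by exact: csmM.
have pef1 i x : partial i ef1 x = e * partial i f1 x.
  by rewrite /ef1 (partialM i ce f1s) partial_cst /= mul0r add0r.
pose W x := Complex (f0 x) (ef1 x).
have hW : holomorphic W.
  split => // x; rewrite -[reF W]/f0 -[imF W]/ef1 pef1; by have [] := CR x.
(* For e = -1, W is phi followed by a reflection, which makes it holomorphic; [g] undoes the
   reflection before applying psi. *)
pose e0 (y : E) := y 0 0; pose e1' := cst e \* (fun y : E => y 0 1).
have e0s : csm e0 by exact: csm_coord.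
have e1s : csm e1' by apply: csmM => //; exact: csm_coord.
pose g k := fun y : E => component psi k (e0 y *: @ebase R 0 + e1' y *: @ebase R 1).
have gs k : csm (g k) by apply: csm_comp => //; exact/smooth_csm/psis.
have gK x : toE (Complex (g 0 (toE (W x))) (g 1 (toE (W x)))) = x.
  have eqphi : e0 (toE (W x)) *: @ebase R 0 + e1' (toE (W x)) *: @ebase R 1 = phi x.
    rewrite /e0 /e1' /= toE0 toE1 /= mulrA -expr2 e1 mul1r [RHS]rV2E //.
  by rewrite /g eqphi /component phiK toCK.
have [k k0 Wk] := plane_automorphism_affine hW (gs 0) (gs 1) gK.
have Winj0 x y : re (k * toC x) = re (k * toC y) -> f0 x = f0 y.
  by move=> h; rewrite -[f0 x]/(re (W x)) -[f0 y]/(re (W y)) (Wk x) (Wk y) !reD h.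
have Winj1 x y : im (k * toC x) = im (k * toC y) -> f1 x = f1 y.
  move=> h; have en0 : e != 0 by apply: contra_eq_neq e1 => ->; rewrite expr0n eq_sym oner_neq0.
  apply: (mulfI en0).
  by rewrite -[e * f1 x]/(im (W x)) -[e * f1 y]/(im (W y)) (Wk x) (Wk y) !imD h.
pose a := re k; pose b := im k; pose n := a ^+ 2 + b ^+ 2.
have step0 x (h : R) : f0 (x + h *: @ebase R 0) = f0 x + h * a.
  rewrite -[LHS]/(re (W (x + h *: @ebase R 0))) -[f0 x]/(re (W x)) !(Wk (_ + _)) (Wk x) !reD !reM /=.
  by rewrite !line_coord /= mulr1 mulr0 addr0 /a; ring.
have step1 x (h : R) : ef1 (x + h *: @ebase R 0) = ef1 x + h * b.
  rewrite -[LHS]/(im (W (x + h *: @ebase R 0))) -[ef1 x]/(im (W x)) !(Wk (_ + _)) (Wk x) !imD !imM /=.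
  by rewrite !line_coord /= mulr1 mulr0 addr0 /b; ring.
have p0 x : partial 0 f0 x = a.
  apply: partial_line.
  have -> : (fun h : R => f0 (x + h *: @ebase R 0)) = (fun h : R => f0 x + h * a).
    by apply/funext => h; exact: step0.
  by apply: is_derive_eq; rewrite /GRing.scale /=; ring.
have p1 x : e * partial 0 f1 x = b.
  rewrite -pef1; apply: partial_line.
  have -> : (fun h : R => ef1 (x + h *: @ebase R 0)) = (fun h : R => ef1 x + h * b).
    by apply/funext => h; exact: step1.
  by apply: is_derive_eq; rewrite /GRing.scale /=; ring.
have LamE x : Lam x = (L1 (f0 x) + L2 (f1 x)) * n.
  have := eqs x 0 0; rewrite /= mulr1n -[N x]/(L1 (f0 x) + L2 (f1 x)) => ->.
  congr (_ * _); rewrite p0 /n -(p1 x) exprMn e1 mul1r -!expr2 //.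
exists a, b; split.
  apply: contra k0 => /eqP[a0 b0]; apply/eqP; exact: complex_ext.
(* Im(k z) is constant along p and Re(k z) along q. *)
pose p : E := a *: @ebase R 0 - b *: @ebase R 1.
pose q : E := b *: @ebase R 0 + a *: @ebase R 1.
have pE0 : p 0 0 = a by rewrite /p !mxE !eqxx /= mulr1 mulr0 subr0.
have pE1 : p 0 1 = - b by rewrite /p !mxE !eqxx /= mulr1 mulr0 add0r.
have qE0 : q 0 0 = b by rewrite /q !mxE !eqxx /= mulr1 mulr0 addr0.
have qE1 : q 0 1 = a by rewrite /q !mxE !eqxx /= mulr1 mulr0 add0r.
have H x t s : Lam (x + t *: p + s *: q) - Lam (x + t *: p) - Lam (x + s *: q) + Lam x = 0.
  have z0 y (u : R) : f0 (y + u *: q) = f0 y.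
    apply: Winj0; rewrite !reM /= -/a -/b [(y + _) 0 0]mxE [(u *: q) 0 0]mxE.
    by rewrite [(y + _) 0 1]mxE [(u *: q) 0 1]mxE qE0 qE1; ring.
  have z1 y (u : R) : f1 (y + u *: p) = f1 y.
    apply: Winj1; rewrite !imM /= -/a -/b [(y + _) 0 0]mxE [(u *: p) 0 0]mxE.
    by rewrite [(y + _) 0 1]mxE [(u *: p) 0 1]mxE pE0 pE1; ring.
  rewrite !LamE !z0 !z1 [x + _ + _]addrAC !z1.
  by move: (L1 _) (L1 _) (L2 _) (L2 _) => *; ring.
move=> x; have := mixed_difference_derive Ls H x; rewrite pE0 pE1 qE0 qE1 (csm_schwarz 1 0 Ls).
by move: (partial _ _ _) (partial _ _ _) (partial _ _ _) => u v w <-; ring.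
Qed.

End Liouville_scalar.

(** * The deformed metric *)

Section deformation.
Variable R : realType.
Notation E := 'rV[R]_2.
Notation T := (tfun R).
Notation HT := (hurwitz (tfun R)).
Notation d := (@tpartial R).
Notation dx := (@tpartial R 0).
Notation dy := (@tpartial R 1).
Notation Dx := (hlift (@tpartial R 0)).
Notation Dy := (hlift (@tpartial R 1)).

Opaque partial.

Lemma tpartial1 i : d i 1 = 0.
Proof.
have := @tpartialM R i 1 1; rewrite !(mulr1, mul1r) => /eqP.
by rewrite -subr_eq0 opprD addrA subrr sub0r oppr_eq0 => /eqP.
Qed.

Lemma tpartial0 i : d i 0 = 0.
Proof.
have := @tpartialD R i 0 0; rewrite addr0 => /eqP.
by rewrite -subr_eq0 opprD addrA subrr sub0r oppr_eq0 => /eqP.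
Qed.

Lemma tpartialN i u : d i (- u) = - d i u.
Proof.
by apply/eqP; rewrite -addr_eq0 -tpartialD addNr tpartial0.
Qed.

Lemma tpartial_mu_init i : d i (mu_init R) = - (mu_init R * mu_init R * d i (L_init R)).
Proof.
have := congr1 (d i) (mu_initE R); rewrite tpartialM tpartial1.
have := mu_initE R; move: (mu_init R) (L_init R) (d i _) (d i _) => m l l' m' ml h.
apply/eqP; rewrite -subr_eq0 opprK; apply/eqP.
transitivity (m * (m' * l + m * l') + m' * (1 - m * l)); first by ring.
by rewrite h ml subrr !mulr0 addr0.
Qed.

(** [m] stands for 1 / L, [p] for the derivative of the initial L in direction i and [q] for the one
    in the other direction, which is constant along i as the variables are separated. *)
Lemma second_partial_product i (m p q : T) : d i m = - (m * m * p) -> d i q = 0 ->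
  d i (d i (m * m * (p * q))) =
  (m * m * m * m * (p * p * p) *+ 6 - m * m * m * (p * d i p) *+ 6 + m * m * d i (d i p)) * q.
Proof.
move=> dm dq.
rewrite !(tpartialM, tpartialD, tpartialN, dm, dq, tpartial0).
rewrite !mulr0 !addr0.
by move: (d i p) (d i (d i p)) => p' p''; ring.
Qed.

Lemma tpartial_twave i j a b :
  d j (twave i a b) = twave i ((i == j)%:R * (2 * pi * a)) (b + pi / 2).
Proof. by apply/val_inj; exact: partial_wave. Qed.

Lemma twave0 i b : twave i 0 b = 0 :> T.
Proof. by apply: tfun_ext => x; rewrite -[LHS]/(0 * cos _) mul0r. Qed.

Lemma tpartial_tconst i a : d i (tconst a) = 0.
Proof. by apply/val_inj; exact: partial_cst. Qed.

Let c : R := 2 * pi.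

Lemma L_init_partial i : d i (L_init R) = twave i c (pi / 2).
Proof.
rewrite /L_init /U_init /V_init !tpartialD tpartial_tconst !tpartial_twave !add0r.
by move: i; apply: ord2P; rewrite /= !(mul0r, mul1r, mulr1) twave0 ?addr0 ?add0r.
Qed.

Lemma L_init_partial2 i j : d j (d i (L_init R)) =
  twave i ((i == j)%:R * (c * c)) (pi / 2 + pi / 2).
Proof. by rewrite L_init_partial tpartial_twave. Qed.

Lemma L_init_partial3 i : d i (d i (d i (L_init R))) =
  twave i (c * (c * c)) (pi / 2 + pi / 2 + pi / 2).
Proof. by rewrite L_init_partial2 tpartial_twave eqxx !mul1r. Qed.

Lemma L_init_mixed i j : i != j -> d j (d i (L_init R)) = 0.
Proof. by move=> /negbTE ij; rewrite L_init_partial2 ij mul0r twave0. Qed.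

(* Here L_init has L_xx = L_yy, while the coefficient of s^2 / 2 in L_xy is not 0. *)
Definition quarter : E := const_mx 4^-1.

Lemma twave_quarter i a b : twave i a (b + pi / 2) quarter = - a * cos b.
Proof.
rewrite -[LHS]/(a * cos (2 * pi * quarter 0 i + (b + pi / 2))) mxE.
have -> : 2 * pi * 4^-1 + (b + pi / 2) = b + pi :> R by field.
by rewrite cosDpi mulrN mulNr.
Qed.

Lemma L_init_quarter : L_init R quarter = 4.
Proof.
rewrite L_initE !mxE (_ : 2 * pi * 4^-1 = pi / 2); last by field.
by rewrite cos_pihalf !addr0.
Qed.

Lemma mu_init_quarter : mu_init R quarter = 4^-1.
Proof. by rewrite -[LHS]/((L_init R quarter)^-1) L_init_quarter. Qed.

(** The product is f_1 g_1, the first-order coefficients in s. At this point L = 4, L_x = L_y = - c,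
    the pure second derivatives are 0 and the pure third ones c^3, so the value is (- 6 / 256 + 1 /
    16) c^3 (- c). *)
Lemma kappa_half i j : i != j ->
  tval (d i (d i (mu_init R * mu_init R * (d i (L_init R) * d j (L_init R))))) quarter = - 10 / 256 * c ^+ 4.
Proof.
move=> ij; rewrite second_partial_product; first last.
- by apply: L_init_mixed; rewrite eq_sym.
- exact: tpartial_mu_init.
have mq := mu_init_quarter.
have pq k : d k (L_init R) quarter = - c.
  by rewrite L_init_partial -[pi / 2]add0r twave_quarter cos0 mulr1.
have pq2 : d i (d i (L_init R)) quarter = 0.
  by rewrite L_init_partial2 twave_quarter cos_pihalf mulr0.
have pq3 : d i (d i (d i (L_init R))) quarter = c * (c * c).
  rewrite L_init_partial3 twave_quarter.
  by rewrite -splitr cospi mulrN1 opprK.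
have qq := pq j; move: pq2 pq3 (pq i) qq mq; move: (mu_init R) (d i (L_init R)) (d i (d i (L_init R)))
  (d i (d i (d i (L_init R)))) (d j (L_init R)) => m p p2 p3 q e2 e3 e1 eq em.
rewrite (_ : tval _ quarter = (m quarter * m quarter * m quarter * m quarter * (p quarter * p quarter * p quarter) *+ 6 -
  m quarter * m quarter * m quarter * (p quarter * p2 quarter) *+ 6 + m quarter * m quarter * p3 quarter) * q quarter) //.
by rewrite e3 e2 e1 eq em; field.
Qed.

Lemma ebound_le rho c1 c2 (u : HT) : 0 <= rho -> c1 <= c2 -> ebound rho c1 u -> ebound rho c2 u.
Proof.
move=> rho0 c12 ub m w x; apply: le_trans (ub m w x) _.
by rewrite ler_wpM2r ?mulr_ge0 ?exprn_ge0 // ler_wpM2r ?exprn_ge0 // ler_wpM2r.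
Qed.

Lemma opp_double_neq0 (a b e : R) : a = e -> b = e -> e != 0 -> - (a + b) != 0.
Proof. by move=> -> -> e0; rewrite oppr_eq0 -mulr2n mulrn_eq0. Qed.

Lemma deformation_streams : exists (L f g V : HT) (rho : R),
  [/\ 0 < rho,
      [/\ ebound rho 6 L, ebound rho 6 f, ebound rho 6 g & ebound rho 6 V],
      [/\ L 0%N = L_init R, f 0%N = 0, g 0%N = 0 & hshift L = Dx f + Dy g],
      [/\ Dx g = Dy f, L * Dy f *+ 2 + Dx L * g + Dy L * f = 0,
          Dx V *+ 2 + Dy (f * g) = 0 & Dy (L - V) *+ 2 + Dx (f * g) = 0] &
      tval (dx (dy (L 2%N))) quarter != 0].
Proof.
have [L [f [g [mu [[L0 f0 g0 mu0] SL Sf Sg Smu]]]]] :=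
  @formal_deformation_exists T dx dy (L_init R) (mu_init R).
(* Antiderivatives in s of f_x, g_y and f_y; [S] is the variable [T] of the formal part. *)
pose U : HT := fun n => if n is k.+1 then dx (f k) else U_init R.
pose V : HT := fun n => if n is k.+1 then dy (g k) else V_init R.
pose S : HT := fun n => if n is k.+1 then dy (f k) else 0.
have DD i := @tpartialD R i; have DM i := @tpartialM R i.
have Dxy u : dx (dy u) = dy (dx u) by exact: tpartialC.
have L_UV : L = U + V by apply: (@formal_L T dx dy L f g U V SL).
have muL0 : mu 0%N * L 0%N = 1 by rewrite mu0 L0 mu_initE.
have curl : Dx g = Dy f.
  exact: (@formal_curl T dx dy (DD 0) (DD 1) (DM 0) (DM 1) Dxy L f g mu).
have UT : Dy U = Dx S.
  exact: (@formal_UT T dx dy (DD 0) Dxy f U S erefl erefl erefl (U_init_dy R)).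
have VT : Dx V = Dy S.
  exact: (@formal_VT T dx dy (DD 0) (DD 1) (DM 0) (DM 1) Dxy L f g mu V S SL Sf Sg Smu
    erefl erefl muL0 f0 g0 erefl (V_init_dx R)).
have TT : S *+ 2 + f * g = 0.
  exact: (@formal_T T dx dy (DD 0) (DD 1) (DM 0) (DM 1) Dxy L f g mu U V S SL Sf Sg Smu
    erefl erefl erefl L0 muL0 f0 g0 erefl (U_init_dy R) (V_init_dx R)).
have div : L * Dy f *+ 2 + Dx L * g + Dy L * f = 0.
  exact: (@formal_divergence T dx dy (DD 0) (DD 1) (DM 0) (DM 1) Dxy L f g mu U V S SL Sf Sg Smu
    erefl erefl erefl L0 muL0 f0 g0 erefl (U_init_dy R) (V_init_dx R)).
pose r : R := 32 * (2 * pi).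
have r0 : 0 < r by rewrite !mulr_gt0 // pi_gt0.
have b0 w x : `|partials w (L 0%N) x| <= 6 * weight r (size w).
  by rewrite L0; exact: L_init_bound.
have m0 w x : `|partials w (mu 0%N) x| <= 1 * weight r (size w).
  by rewrite mu0; exact: mu_init_bound.
have six : 0 < 6 :> R by [].
have [K K1 [_ HK]] := @deformation_bounds R r 6 1 L f g mu r0 six ltr01 b0 m0 f0 g0 SL Sf Sg Smu.
have K0 : 0 < K by lra.
have one6 : 1 <= 6 :> R by rewrite ler1n.
have rho0 : 0 < 2 * K * r by apply: mulr_gt0 => //; apply: mulr_gt0.
(* [V] is g_y one order earlier and inherits the bound of [g]: the spatial derivative takes the
   place of the order in s. *)
have Vb n0 : sbound n0 1 K (weight r) V.
  move=> [|m] w x mn /=.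
    rewrite expr0 !mul1r add0n; apply: le_trans (pow_weight _ (size w)).
    by have := wave_bound 1 1 0 w x; rewrite normr1 mul1r.
  rewrite -partials_rcons; have [_ _ gb _] := HK n0.
  apply: le_trans (gb m _ x (ltnW mn)) _; rewrite size_rcons addnS addSn !mul1r.
  by rewrite ler_wpM2r ?weight_ge0 // exprS ler_peMl // exprn_ge0 // ltW.
exists L, f, g, V, (2 * K * r); split => //.
- split.
  + by apply: sbound_ebound => // n0; have [] := HK n0.
  + apply: (ebound_le (ltW rho0) one6); apply: sbound_ebound => // n0; by have [] := HK n0.
  + apply: (ebound_le (ltW rho0) one6); apply: sbound_ebound => // n0; by have [] := HK n0.
  + exact/(ebound_le (ltW rho0) one6)/sbound_ebound.
- have Dy2 u v : Dy (u + v) = Dy u + Dy v by exact: hliftD (DD 1) _ _.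
  have Dx2 u v : Dx (u + v) = Dx u + Dx v by exact: hliftD (DD 0) _ _.
  have D0 i : hlift (d i) (0 : HT) = 0 by apply/funext => n; exact: tpartial0.
  split=> //.
    rewrite VT mulr2n -!Dy2 -mulr2n TT; exact: D0.
  rewrite L_UV addrK UT mulr2n -!Dx2 -mulr2n TT; exact: D0.
have f1 : f 1%N = mu_init R * dx (L_init R).
  have -> : f 1%N = hshift f 0%N by [].
  by rewrite Sf -mu0 -L0.
have g1 : g 1%N = mu_init R * dy (L_init R).
  have -> : g 1%N = hshift g 0%N by [].
  by rewrite Sg -mu0 -L0.
(* Order 2 of 2 T + f g = 0: of the product only 2 f_1 g_1 survives, because f and g start at 0. *)
have S2 : S 2%N = - (f 1%N * g 1%N).
  have := congr1 (fun u : HT => u 2%N) TT; rewrite -[LHS]/(S 2%N + S 2%N + (f 2%N * g 0%N + f 1%N * g 1%N + (f 1%N * g 1%N + f 0%N * g 2%N))).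
  rewrite f0 g0 mulr0 mul0r add0r addr0 => H; apply: tfun_ext => x.
  have := congr1 (fun u : T => u x) H.
  rewrite -[X in X = _]/(S 2%N x + S 2%N x + (f 1%N x * g 1%N x + f 1%N x * g 1%N x)).
  rewrite -[X in _ = X -> _]/(0 : R) -[X in _ -> _ = X]/(- (f 1%N x * g 1%N x)).
  move: (f 1%N x * g 1%N x) (tval (S 2%N) x) => a b h; lra.
(* L_xy = T_xx + T_yy at order 2 in s; the two terms have equal values at [quarter], so they cannot
   cancel. *)
have -> : dx (dy (L 2%N)) = - (dx (dx (f 1%N * g 1%N)) + dy (dy (f 1%N * g 1%N))).
  have -> : L 2%N = U 2%N + V 2%N by rewrite L_UV.
  rewrite !tpartialD; have -> : dy (U 2%N) = dx (S 2%N) := congr1 (fun u : HT => u 2%N) UT.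
  rewrite Dxy; have -> : dx (V 2%N) = dy (S 2%N) := congr1 (fun u : HT => u 2%N) VT.
  by rewrite S2 !tpartialN opprD.
rewrite f1 g1; have -> : mu_init R * dx (L_init R) * (mu_init R * dy (L_init R)) =
  mu_init R * mu_init R * (dx (L_init R) * dy (L_init R)) by ring.
have k0 : (0 : 'I_2) != 1 by []. have k1 : (1 : 'I_2) != 0 by [].
have h0 := kappa_half k0; have h1 := kappa_half k1.
rewrite [dy (L_init R) * _]mulrC in h1.
rewrite -[X in X != _]/(- (tval (dx (dx (mu_init R * mu_init R * (dx (L_init R) * dy (L_init R))))) quarter +
  tval (dy (dy (mu_init R * mu_init R * (dx (L_init R) * dy (L_init R))))) quarter)).
apply: opp_double_neq0 h0 h1 _.
by rewrite mulf_neq0 ?expf_neq0 // ?gt_eqF ?mulr_gt0 ?pi_gt0 // mulNr oppr_eq0 mulf_neq0 ?invr_eq0 ?pnatr_eq0.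
Qed.

End deformation.

(** * Small values of the parameter *)

Section small_parameter.
Variable R : realType.
Notation E := 'rV[R]_2.
Notation T := (tfun R).
Notation HT := (hurwitz (tfun R)).
Notation dx := (@tpartial R 0).
Notation dy := (@tpartial R 1).

Opaque partial.

Lemma near_right_small (A B : R) : 0 < B -> \forall s \near (0 : R)^'+, `|A| * s < B.
Proof.
move=> B0; have A1 : 0 < `|A| + 1 by rewrite ltr_wpDl.
near=> s.
have s0 : 0 < s by near: s; exact: nbhs_right_gt.
have sB : s < B / (`|A| + 1) by near: s; apply: nbhs_right_lt; exact: divr_gt0.
apply: (@le_lt_trans _ _ (s * (`|A| + 1))).
  by rewrite mulrDr mulr1 mulrC lerDl ltW.
by rewrite -ltr_pdivlMr.
Unshelve. all: by end_near. Qed.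

(** A linear system for (m, n) with nonzero determinant: |P2 Q1| is at least p q s^2, whereas |P1
    Q2| is at most C^2 s^4. *)
Lemma relation_trivial (m n P1 P2 Q1 Q2 C p q s : R) : 0 < s -> 0 < p -> 0 < q -> 0 <= C ->
  m * P1 + n * Q1 = 0 -> m * P2 + n * Q2 = 0 ->
  `|P1| <= C * s ^+ 2 -> q <= `|Q1| -> p * s ^+ 2 <= `|P2| -> `|Q2| <= C * s ^+ 2 ->
  C ^+ 2 * s ^+ 2 < p * q -> m = 0 /\ n = 0.
Proof.
move=> s0 p0 q0 C0 e1 e2 hP1 hQ1 hP2 hQ2 small.
have s2 : 0 < s ^+ 2 by rewrite exprn_gt0.
have f1 : `|n| * `|Q1| = `|m| * `|P1|.
  by rewrite -!normrM -[n * Q1](addKr (m * P1)) e1 addr0 normrN.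
have f2 : `|m| * `|P2| = `|n| * `|Q2|.
  by rewrite -!normrM -[n * Q2](addKr (m * P2)) e2 addr0 normrN.
have g1 : `|n| * q <= `|m| * (C * s ^+ 2).
  by apply: (le_trans (ler_wpM2l _ hQ1)) => //; rewrite f1 ler_wpM2l.
have g2 : `|m| * (p * s ^+ 2) <= `|n| * (C * s ^+ 2).
  by apply: (le_trans (ler_wpM2l _ hP2)) => //; rewrite f2 ler_wpM2l.
have g3 : `|m| * (p * q) <= `|m| * (C ^+ 2 * s ^+ 2).
  rewrite -(ler_pM2r s2).
  have h : `|m| * (p * s ^+ 2) * q <= `|n| * (C * s ^+ 2) * q by apply: ler_wpM2r => //; exact: ltW.
  have h' : `|n| * q * (C * s ^+ 2) <= `|m| * (C * s ^+ 2) * (C * s ^+ 2).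
    by apply: ler_wpM2r => //; rewrite mulr_ge0 // ltW.
  have -> : `|m| * (p * q) * s ^+ 2 = `|m| * (p * s ^+ 2) * q by ring.
  have -> : `|m| * (C ^+ 2 * s ^+ 2) * s ^+ 2 = `|m| * (C * s ^+ 2) * (C * s ^+ 2) by ring.
  apply: (le_trans h); rewrite (_ : _ * q = `|n| * q * (C * s ^+ 2)) //; ring.
have m0 : m = 0.
  apply/eqP; rewrite -normr_le0 leNgt; apply/negP => m0.
  by move: g3; rewrite ler_pM2l // leNgt small.
split => //; apply/eqP; rewrite -normr_le0 -(ler_pM2r q0) mul0r.
by apply: (le_trans g1); rewrite m0 normr0 mul0r.
Qed.

Lemma diff_close (p q u v C t : R) : `|v - u| <= C / 2 * t -> `|q - p| <= C / 2 * t ->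
  `|v - q - (u - p)| <= C * t.
Proof.
have -> : v - q - (u - p) = v - u - (q - p) by ring.
move=> h0 h1; apply: le_trans (ler_normB _ _) _.
by apply: le_trans (lerD h0 h1) _; rewrite le_eqVlt; apply/orP; left; apply/eqP; field.
Qed.

Lemma le_norm_of_close (u d t : R) : t <= d -> `|u - - (2 * d)| <= t -> d <= `|u|.
Proof.
by move=> td; rewrite ler_norml => /andP[_ h]; rewrite ler_normr; apply/orP; right; lra.
Qed.

Variables (L : HT) (rho : R).
Hypothesis rho0 : 0 < rho.
Hypothesis Lb : ebound rho 6 L.
Hypothesis L0 : L 0%N = L_init R.
Hypothesis L1 : L 1%N = 0.

Lemma near_right_radius : \forall s \near (0 : R)^'+, 0 < s /\ `|s| * rho <= 4^-1.
Proof.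
near=> s.
have s0 : 0 < s by near: s; exact: nbhs_right_gt.
split => //; rewrite gtr0_norm // mulrC -(gtr0_norm rho0) ltW //.
by near: s; apply: near_right_small; rewrite invr_gt0.
Unshelve. all: by end_near. Qed.

Lemma deformed_factor_close s w x : 0 < s -> `|s| * rho <= 4^-1 ->
  `|partials w (ev s L) x - partials w (L_init R) x| <=
  12 * (size w)`!%:R * rho ^+ size w * rho ^+ 2 * s ^+ 2.
Proof.
move=> s0 srho; have := ev_taylor (ltW rho0) srho Lb w x 2.
rewrite 2!big_ord_recr big_ord0 /= L0 L1 add0r.
have -> : partials w (0 : T) x = 0.
  by have := partials_cst w 0 x; rewrite normr0 normr_le0 => /eqP.
rewrite mulr0 addr0 fact0 expr0 divr1 mul1r (gtr0_norm s0).
move/le_trans; apply; rewrite exprMn le_eqVlt; apply/orP; left; apply/eqP; ring.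
Qed.

(** The radius condition makes the deviation from [L_init] at most 12 / 16, and [L_init] is at least
    2. *)
Lemma deformed_factor_gt1 s x : 0 < s -> `|s| * rho <= 4^-1 -> 1 < ev s L x.
Proof.
move=> s0 srho; have := deformed_factor_close [::] x s0 srho.
rewrite -[partials [::] (ev s L)]/(ev s L) -[partials [::] (tval (L_init R))]/(tval (L_init R)).
rewrite [size _]/= fact0 expr0 !mulr1; have := L_init_ge2 x.
move: srho; rewrite (gtr0_norm s0) -mulrA -exprMn [rho * s]mulrC => srho L2.
have h : (s * rho) ^+ 2 <= (4^-1) ^+ 2.
  by rewrite ler_sqr ?nnegrE ?mulr_ge0 // ltW.
by rewrite ler_norml => /andP[+ _]; move: h L2; move: ((s * rho) ^+ 2) (ev s L x) (tval _ x) => a b c; lra.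
Qed.

Hypothesis kappa : tval (dx (dy (L 2%N))) (quarter R) != 0.

Lemma deformed_mixed_close s x : 0 < s -> `|s| * rho <= 4^-1 ->
  `|partial 0 (partial 1 (ev s L)) x - s ^+ 2 * (tval (dx (dy (L 2%N))) x / 2)| <= 24 * rho ^+ 5 * s ^+ 3.
Proof.
move=> s0 srho; have := ev_taylor (ltW rho0) srho Lb [:: 0; 1] x 3.
rewrite 3!big_ord_recr big_ord0 /= L0 L1 add0r.
have -> : partial 0 (partial 1 (tval (L_init R))) x = 0.
  by rewrite -[LHS]/(tval (dx (dy (L_init R))) x) L_init_mixed.
have -> : partial 0 (partial 1 (tval (0 : T))) x = 0.
  by have := partials_cst [:: 0; 1] 0 x; rewrite normr0 normr_le0 => /eqP.
rewrite !mulr0 !add0r (gtr0_norm s0) => H.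
rewrite (_ : s ^+ 2 * _ = s ^+ 2 / 2`!%:R * partial 0 (partial 1 (L 2%N)) x); last first.
  by rewrite -[2`!]/2%N; move: (partial _ _ _) => q; field.
apply: (le_trans H); rewrite exprMn -[2`!]/2%N le_eqVlt; apply/orP; left; apply/eqP; ring.
Qed.

Let c : R := 2 * pi.

(** Here the two cosines take the opposite values 1 and -1, which separates L_xx from L_yy. *)
Definition half_y : E := \row_i (if i == 0 then 0 else 2^-1).

Lemma L_init_hessian_half_y :
  partial 0 (partial 0 (L_init R)) half_y - partial 1 (partial 1 (L_init R)) half_y = - (2 * c ^+ 2).
Proof.
rewrite -[partial 0 _ _]/(tval (dx (dx (L_init R))) half_y) -[partial 1 _ _]/(tval (dy (dy (L_init R))) half_y).
rewrite !L_init_partial2 !eqxx !mul1r -/c.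
rewrite -[tval (twave 0 _ _) _]/(c * c * cos (2 * pi * half_y 0 0 + (pi / 2 + pi / 2))).
rewrite -[tval (twave 1 _ _) _]/(c * c * cos (2 * pi * half_y 0 1 + (pi / 2 + pi / 2))).
rewrite !mxE /= -splitr mulr0 add0r cospi.
rewrite (_ : 2 * pi * 2^-1 + pi = 0 + pi *+ 2); last by rewrite -mulr_natl; field.
by rewrite cosD2pi cos0; ring.
Qed.

Lemma L_init_hessian_quarter :
  partial 0 (partial 0 (L_init R)) (quarter R) - partial 1 (partial 1 (L_init R)) (quarter R) = 0.
Proof.
rewrite -[partial 0 _ _]/(tval (dx (dx (L_init R))) (quarter R)) -[partial 1 _ _]/(tval (dy (dy (L_init R))) (quarter R)).
by rewrite !L_init_partial2 !twave_quarter cos_pihalf !mulr0 subrr.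
Qed.

Lemma deformed_not_Liouville :
  \forall s \near (0 : R)^'+, ~ Liouville (fun x => (ev s L x)%:M).
Proof.
pose k := tval (dx (dy (L 2%N))) (quarter R).
(* Twice the closeness constant 12 times 2! times rho^4 of second derivatives, since differences of
   two of them occur. *)
pose C := 48 * rho ^+ 4.
have k4 : 0 < `|k| / 4 by rewrite divr_gt0 // normr_gt0.
have c0 : 0 < c by rewrite mulr_gt0 // pi_gt0.
have c2 : 0 < c ^+ 2 by rewrite exprn_gt0.
have C0 : 0 < C by rewrite mulr_gt0 // exprn_gt0.
near=> s.
have [s0 srho] : 0 < s /\ `|s| * rho <= 4^-1 by near: s; exact: near_right_radius.
have s1 : s < 1 by near: s; exact: nbhs_right_lt.
have small1 : `|C| * s < c ^+ 2 by near: s; exact: near_right_small.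
have small2 : `|24 * rho ^+ 5| * s < `|k| / 4 by near: s; exact: near_right_small.
have small3 : `|C ^+ 2| * s < `|k| / 4 * c ^+ 2.
  by near: s; apply: near_right_small; exact: mulr_gt0.
have ss : s ^+ 2 <= s by rewrite expr2 ler_piMl // ltW.
have Ls := ev_csm (ltW rho0) srho Lb.
have Lpos x : 0 < ev s L x by rewrite (lt_trans ltr01) // deformed_factor_gt1.
move=> /(Liouville_scalar_relation Ls Lpos)[a [b [ab0 rel]]].
have hclose i j x : `|partial i (partial j (ev s L)) x - partial i (partial j (L_init R)) x| <= C / 2 * s ^+ 2.
  apply: le_trans (deformed_factor_close [:: i; j] x s0 srho) _.
  by rewrite -[(size _)`!]/2%N /C /= le_eqVlt; apply/orP; left; apply/eqP; field.
have hP1 : `|partial 0 (partial 1 (ev s L)) half_y| <= C * s ^+ 2.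
  have := hclose 0 1 half_y.
  have -> : partial 0 (partial 1 (L_init R)) half_y = 0.
    by rewrite -[LHS]/(tval (dx (dy (L_init R))) half_y) L_init_mixed.
  rewrite subr0 => /le_trans; apply; rewrite ler_wpM2r ?sqr_ge0 //; lra.
have hQ x e : partial 0 (partial 0 (L_init R)) x - partial 1 (partial 1 (L_init R)) x = e ->
    `|partial 0 (partial 0 (ev s L)) x - partial 1 (partial 1 (ev s L)) x - e| <= C * s ^+ 2.
  by move=> <-; have h0 := hclose 0 0 x; have h1 := hclose 1 1 x; exact: diff_close h0 h1.
have hQ1 : c ^+ 2 <= `|partial 0 (partial 0 (ev s L)) half_y - partial 1 (partial 1 (ev s L)) half_y|.
  have Cs : C * s ^+ 2 <= c ^+ 2.
    by apply: ltW; apply: le_lt_trans small1; rewrite gtr0_norm // ler_pM2l.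
  exact: le_norm_of_close Cs (hQ half_y _ L_init_hessian_half_y).
have hQ2 : `|partial 0 (partial 0 (ev s L)) (quarter R) - partial 1 (partial 1 (ev s L)) (quarter R)| <= C * s ^+ 2.
  by have h := hQ (quarter R) _ L_init_hessian_quarter; rewrite subr0 in h.
have hP2 : `|k| / 4 * s ^+ 2 <= `|partial 0 (partial 1 (ev s L)) (quarter R)|.
  have := deformed_mixed_close (quarter R) s0 srho; rewrite -/k => H.
  have t1 : 24 * rho ^+ 5 * s ^+ 3 <= `|k| / 4 * s ^+ 2.
    rewrite (_ : 24 * rho ^+ 5 * s ^+ 3 = 24 * rho ^+ 5 * s * s ^+ 2); last by ring.
    rewrite ler_pM2r ?exprn_gt0 //; apply: ltW; apply: le_lt_trans small2.
    by rewrite ler_pM2r // ler_norm.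
  have t2 : `|s ^+ 2 * (k / 2)| = `|k| / 2 * s ^+ 2.
    by rewrite normrM normf_div ger0_norm ?sqr_ge0 // normr_nat mulrC.
  move: (partial _ _ _) H t1 t2 => u H t1 t2.
  have := ler_normD (s ^+ 2 * (k / 2) - u) u; rewrite subrK distrC t2.
  move: t1 H; move: (24 * rho ^+ 5 * s ^+ 3) `|_ - _| `|u| => e y z t1 H h.
  have -> : `|k| / 4 * s ^+ 2 = `|k| / 2 * s ^+ 2 - `|k| / 4 * s ^+ 2 by field.
  by rewrite lerBlDr; apply: (le_trans h); rewrite addrC lerD2l; exact: le_trans t1.
have hs : C ^+ 2 * s ^+ 2 < `|k| / 4 * c ^+ 2.
  apply: le_lt_trans small3; rewrite ger0_norm ?sqr_ge0 //.
  by rewrite ler_wpM2l ?sqr_ge0.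
have [m0 n0] := relation_trivial s0 k4 c2 (ltW C0) (rel half_y) (rel (quarter R)) hP1 hQ1 hP2 hQ2 hs.
move: ab0; apply/negP; rewrite negbK.
move: n0 => /eqP; rewrite mulf_eq0 => /orP[/eqP a0|/eqP b0].
  by move: m0 => /eqP; rewrite a0 expr0n sub0r oppr_eq0 sqrf_eq0 => /eqP ->.
by move: m0 => /eqP; rewrite b0 expr0n subr0 sqrf_eq0 => /eqP ->.
Unshelve. all: by end_near. Qed.

End small_parameter.

(** * The first integral *)

Section null_sets.
Variable R : realType.
Notation E := 'rV[R]_2.

Opaque partial.

(** Cosine is injective on [0, pi] and only changes sign under a shift by pi, so t is determined by
    its sign and by the number of half-periods in |t|. *)
Lemma countable_cos_level (r : R) : countable [set t : R | cos t = r].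
Proof.
pose k (t : R) := Num.truncn (`|t| / pi).
have kP (t : R) : `|t| - pi *+ k t \in `[0, pi].
  have p0 := pi_gt0 R; have /truncn_itv : 0 <= `|t| / pi by rewrite divr_ge0 // ltW.
  rewrite -/(k t) ler_pdivlMr // ltr_pdivrMr // => /andP[h1 h2].
  rewrite in_itv /= -mulr_natl subr_ge0 h1 /= lerBlDr.
  by move: h2; rewrite -natr1 mulrDl mul1r addrC => /ltW.
have cosE (t : R) : cos t = (-1) ^+ k t * cos (`|t| - pi *+ k t).
  rewrite -(alternatingn (@cosDpi R)) subrK.
  by case: (ger0P t) => // _; rewrite cosN.
have inj : {in [set t : R | cos t = r] &, injective (fun t : R => (t < 0, k t))}.
  move=> t u; rewrite !inE /= => ct cu [s e].
  have : `|t| - pi *+ k t = `|u| - pi *+ k u.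
    apply: cos_inj => //; have sn : (-1) ^+ k t != 0 :> R by rewrite signr_eq0.
    by apply: (mulfI sn); rewrite -cosE {1}e -cosE ct.
  rewrite e => /addIr; move: s; case: (ltrP t 0) => t0; case: (ltrP u 0) => u0 // _.
    by rewrite !ltr0_norm // => /oppr_inj.
  by rewrite !ger0_norm.
by rewrite -(eq_countable (inj_card_eq inj)); exact: countableP.
Qed.

Lemma countable_trigonometric_zeros (A G F : R) : A != 0 ->
  countable [set t : R | 2 * A * cos t * sin t + G * sin t - F * cos t = 0].
Proof.
move=> A0.
(* Squaring and eliminating sin t, the zeros satisfy q.[cos t] = 0. *)
pose q : {poly R} := (1 - 'X ^+ 2) * ((2 * A)%:P * 'X + G%:P) ^+ 2 - (F ^+ 2)%:P * 'X ^+ 2.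
have qE x : q.[x] = (1 - x ^+ 2) * (2 * A * x + G) ^+ 2 - F ^+ 2 * x ^+ 2.
  by rewrite /q !hornerE.
have q0 : q != 0.
  (* The values at 1, 0 and 1/2 would force F, G and A to vanish in turn. *)
  apply/eqP => q0; have z x := qE x; rewrite q0 in z.
  have F0 : F = 0.
    have /eqP := z 1; rewrite horner0 expr1n subrr mul0r sub0r mulr1 eq_sym oppr_eq0 sqrf_eq0.
    by move/eqP.
  have G0 : G = 0.
    have /eqP := z 0; rewrite horner0 !expr0n !mulr0 !subr0 mul1r add0r eq_sym sqrf_eq0.
    by move/eqP.
  have /eqP := z 2^-1; rewrite horner0 F0 G0 expr0n mul0r subr0 addr0 eq_sym mulf_eq0.
  rewrite sqrf_eq0 !mulf_eq0 (negbTE A0) invr_eq0 !pnatr_eq0 !orbF /=.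
  by apply/negP; rewrite gt_eqF //; lra.
apply: (@sub_countable _ _ _ (\bigcup_(r in [set` rootsR q]) [set t : R | cos t = r])).
  apply: subset_card_le => t /= ht; exists (cos t) => //=.
  rewrite -(roots_on_rootsR q0) in_itv /= /root qE.
  have hs : (2 * A * cos t + G) * sin t = F * cos t.
    by apply/eqP; rewrite -subr_eq0 -ht; apply/eqP; ring.
  by rewrite -sin2cos2 (mulrC (sin t ^+ 2)) -!exprMn hs subrr.
apply: bigcup_countable => [|r _]; last exact: countable_cos_level.
exact: finite_set_countable.
Qed.

Definition base_point (z : R * R) : E := z.1 *: @ebase R 0 + z.2 *: @ebase R 1.

(* G is the pointwise limit of its values at the points of finer and finer
   grids; this avoids comparing the product sigma-algebra with the Borel one. *)
Lemma measurable_base_point (G : E -> R) : continuous G ->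
  measurable_fun [set: R * R] (fun z => G (base_point z)).
Proof.
move=> Gc; pose phi (n : nat) (x : R) : int := Num.floor (x * n.+1%:R).
pose grid (n : nat) (k : int * int) : R * R := (k.1%:~R / n.+1%:R, k.2%:~R / n.+1%:R).
apply: (measurable_realfun.measurable_fun_cvg (h := fun n z => G (base_point (grid n (phi n z.1, phi n z.2))))).
  move=> n _ Y _; rewrite setTI.
  have phim (k : int) : measurable (phi n @^-1` [set k]).
    rewrite (_ : _ @^-1` _ = [set` `[k%:~R / n.+1%:R, (k + 1)%:~R / n.+1%:R[]); first exact: measurable_itv.
    apply/seteqP; split => x /=; rewrite in_itv /= ler_pdivrMr ?ltr0n // ltr_pdivlMr ?ltr0n //.
      by move=> <-; exact: floor_itv.
    exact: floor_def.
  rewrite (_ : _ @^-1` Y = \bigcup_(k : int * int)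
      (if asbool (Y (G (base_point (grid n k)))) then (phi n @^-1` [set k.1]) `*` (phi n @^-1` [set k.2]) else set0)).
    apply: countable_bigcupT_measurable => [|k]; first exact: countableP.
    by case: asboolP => _ //; exact: measurableX.
  apply/seteqP; split => z /=.
    by move=> Yz; exists (phi n z.1, phi n z.2) => //=; case: asboolP.
  by move=> [k _]; case: asboolP => // Yk [/= k1 k2]; rewrite k1 k2; case: k Yk k1 k2.
move=> z _; apply: (continuous_cvg _ (Gc _)).
have cv (x : R) : (fun n => (phi n x)%:~R / n.+1%:R : R) @ \oo --> x.
  apply/cvgrPdist_lt => e e0; near=> n.
  have n0 : 0 < n.+1%:R :> R by rewrite ltr0n.
  have : n.+1%:R^-1 < e.
    by near: n; exact: (near_infty_natSinv_lt (PosNum e0)).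
  apply: le_lt_trans; have /andP[h1 h2] := floor_itv (x * n.+1%:R).
  rewrite -(ler_pM2r n0) mulVf ?gt_eqF // -{2}(gtr0_norm n0) -normrM mulrBl divfK ?gt_eqF //.
  rewrite ger0_norm ?subr_ge0 // lerBlDl; apply: ltW; apply: (lt_le_trans h2).
  by rewrite rmorphD.
by apply: cvgD; apply: cvgZl; exact: cv.
Unshelve. all: by end_near. Qed.

(** The product measure of the zero set is the integral of the measures of its sections, and these
    are countable. *)
Lemma ae_neq0_of_countable_sections (h : R * R * R -> R) :
  measurable_fun [set: R * R * R] h ->
  (forall z, countable [set t | h (z, t) = 0]) ->
  {ae ((@lebesgue_measure R \x @lebesgue_measure R) \x @lebesgue_measure R)%E,
    forall z, h z != 0}.
Proof.
move=> hm hc; exists [set z | h z = 0]; split.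
- by rewrite -[[set _ | _]]setTI; exact: (hm measurableT _ (measurable_set1 (0 : R))).
- apply: integral0_eq => z _ /=; apply: countable_lebesgue_measure0.
  by rewrite (_ : xsection _ _ = [set t | h (z, t) = 0]) //; apply/seteqP; split => t; rewrite xsectionP.
- by move=> z /=; case: eqVneq => // ->.
Qed.

End null_sets.

(** * Conformally flat metrics and quadratic functions of the momenta *)

Section scalar_metric.
Variable R : realType.
Notation E := 'rV[R]_2.

Opaque partial.

Lemma hamiltonian_scalar (Lam : E -> R) x p :
  hamiltonian (fun y => (Lam y)%:M) x p = 2^-1 * ((Lam x)^-1 * (p 0 0 ^+ 2 + p 0 1 ^+ 2)).
Proof.
rewrite /hamiltonian invmx_scalar !sum_ord2 !mxE /= !mulr0n mulr1n !mul0r addr0 add0r.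
by congr (_ * _); ring.
Qed.

Lemma partial_p_hamiltonian_scalar (Lam : E -> R) i x p :
  partial_p i (hamiltonian (fun y => (Lam y)%:M)) x p = (Lam x)^-1 * p 0 i.
Proof.
rewrite /partial_p; apply: partial_line.
have -> : (fun h : R => hamiltonian (fun y => (Lam y)%:M) x (p + h *: @ebase R i)) =
    (fun h : R => 2^-1 * ((Lam x)^-1 * ((p 0 0 + h * (i == 0)%:R) ^+ 2 + (p 0 1 + h * (i == 1)%:R) ^+ 2))).
  by apply/funext => h; rewrite hamiltonian_scalar !line_coord.
apply: is_derive_eq; rewrite /GRing.scale /=.
by move: i (Lam x)^-1; apply: ord2P => l /=; field.
Qed.

Lemma partial_x_hamiltonian_scalar (Lam : E -> R) i x p : csm Lam -> (forall x, Lam x != 0) ->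
  partial_x i (hamiltonian (fun y => (Lam y)%:M)) x p =
  - (2^-1 * ((Lam x)^-1 * (Lam x)^-1 * partial i Lam x * (p 0 0 ^+ 2 + p 0 1 ^+ 2))).
Proof.
move=> Ls L0; rewrite /partial_x.
have -> : (fun y => hamiltonian (fun y => (Lam y)%:M) y p) =
    (fun y => (2^-1 * (p 0 0 ^+ 2 + p 0 1 ^+ 2)) * (Lam y)^-1).
  by apply/funext => y; rewrite hamiltonian_scalar; ring.
have Vs := csmV Ls L0.
have /= h := congr1 (@^~ x) (@partialsZ R [:: i] (2^-1 * (p 0 0 ^+ 2 + p 0 1 ^+ 2)) _ Vs).
apply: (etrans h); rewrite (partialV_diff i _ L0) /=; last by move=> y; exact: csm_differentiable.
by move: (partial i Lam x) => d; ring.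
Qed.

Definition quadratic_integral (f g c : E -> R) (x p : E) : R :=
  p 0 0 ^+ 2 - p 0 1 ^+ 2 + 2 * (g x * p 0 0 + f x * p 0 1) + c x.

Variables (f g c : E -> R).
Hypotheses (fs : csm f) (gs : csm g) (cs : csm c).

Lemma partial_p0_quadratic x p : partial_p 0 (quadratic_integral f g c) x p = 2 * p 0 0 + 2 * g x.
Proof.
rewrite /partial_p; apply: partial_line; rewrite /quadratic_integral.
have -> : (fun h : R => (p + h *: @ebase R 0) 0 0 ^+ 2 - (p + h *: @ebase R 0) 0 1 ^+ 2
    + 2 * (g x * (p + h *: @ebase R 0) 0 0 + f x * (p + h *: @ebase R 0) 0 1) + c x) =
  (fun h : R => (p 0 0 + h) ^+ 2 - p 0 1 ^+ 2 + 2 * (g x * (p 0 0 + h) + f x * p 0 1) + c x).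
  by apply/funext => h; rewrite !line_coord /= mulr1 mulr0 addr0.
by apply: is_derive_eq; rewrite /GRing.scale /=; ring.
Qed.

Lemma partial_p1_quadratic x p : partial_p 1 (quadratic_integral f g c) x p = - 2 * p 0 1 + 2 * f x.
Proof.
rewrite /partial_p; apply: partial_line; rewrite /quadratic_integral.
have -> : (fun h : R => (p + h *: @ebase R 1) 0 0 ^+ 2 - (p + h *: @ebase R 1) 0 1 ^+ 2
    + 2 * (g x * (p + h *: @ebase R 1) 0 0 + f x * (p + h *: @ebase R 1) 0 1) + c x) =
  (fun h : R => p 0 0 ^+ 2 - (p 0 1 + h) ^+ 2 + 2 * (g x * p 0 0 + f x * (p 0 1 + h)) + c x).
  by apply/funext => h; rewrite !line_coord /= mulr1 mulr0 addr0.
by apply: is_derive_eq; rewrite /GRing.scale /=; ring.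
Qed.

Lemma partial_x_quadratic i x p : partial_x i (quadratic_integral f g c) x p =
  2 * (partial i g x * p 0 0 + partial i f x * p 0 1) + partial i c x.
Proof.
rewrite /partial_x.
have -> : (fun y => quadratic_integral f g c y p) =
   (cst (p 0 0 ^+ 2 - p 0 1 ^+ 2)) \+ ((cst (2 * p 0 0) \* g) \+ ((cst (2 * p 0 1) \* f) \+ c)).
  by apply/funext => y; rewrite /quadratic_integral /=; ring.
have c0 := @csm_cst R (p 0 0 ^+ 2 - p 0 1 ^+ 2).
have c1 := @csm_cst R (2 * p 0 0); have c2 := @csm_cst R (2 * p 0 1).
have s1 := csmM c1 gs; have s2 := csmM c2 fs.
rewrite (partialD i c0 (csmD s1 (csmD s2 cs))) (partialD i s1 (csmD s2 cs)) (partialD i s2 cs).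
rewrite (partialM i c1 gs) (partialM i c2 fs) !partial_cst /=.
by move: (partial _ _ _) (partial _ _ _) (partial _ _ _) => *; ring.
Qed.

(** A linear relation between the differentials restricts to their momentum components, so a nonzero
    minor there is enough. *)
Lemma free_of_minor (A B : E -> E -> R) x p :
  partial_p 0 A x p * partial_p 1 B x p - partial_p 1 A x p * partial_p 0 B x p != 0 ->
  free [:: differential A x p; differential B x p].
Proof.
have dE (C : E -> E -> R) i : differential C x p 0 (rshift 2 i) = partial_p i C x p.
  by rewrite /differential row_mxEr mxE.
move=> minor; rewrite free_cons span_seq1 seq1_free; apply/andP; split.
  apply/negP => /vlineP[k AB]; move/negP: minor; apply.
  have hA i : partial_p i A x p = k * partial_p i B x p by rewrite -dE AB [LHS]mxE dE.
  by rewrite !hA; apply/eqP; ring.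
apply/eqP => B0; move/negP: minor; apply.
have hB i : partial_p i B x p = 0 by rewrite -dE B0 mxE.
by rewrite !hB !mulr0 subrr.
Qed.

End scalar_metric.

(** * The first integral and its independence of the Hamiltonian *)

Section first_integral.
Variable R : realType.
Notation E := 'rV[R]_2.

Opaque partial.

(** L times the bracket is a polynomial in the momenta p, q. Once p^2 + q^2 is replaced by L, its
    constant term is the divergence relation, and its coefficients of p and q are the relations for
    V and for L - V. *)
Lemma bracket_algebra (p q L Lx Ly f fx fy g gy Vx Vy : R) : L != 0 -> p ^+ 2 + q ^+ 2 = L ->
  2 * L * fy + Lx * g + Ly * f = 0 ->
  2 * Vx + (fy * g + f * gy) = 0 -> 2 * (Ly - Vy) + (fx * g + f * fy) = 0 ->
  (2 * (fy * p + fx * q) + (2 * Vx - Lx - (f * fx - g * fy))) * (L^-1 * p)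
    - (2 * p + 2 * g) * - (2^-1 * (L^-1 * L^-1 * Lx * L)) +
  ((2 * (gy * p + fy * q) + (2 * Vy - Ly - (f * fy - g * gy))) * (L^-1 * q)
    - (- 2 * q + 2 * f) * - (2^-1 * (L^-1 * L^-1 * Ly * L))) +
  - (2^-1 * (fx + gy)) * ((2 * p + 2 * g) * (L^-1 * q) - (- 2 * q + 2 * f) * (L^-1 * p)) = 0.
Proof.
move=> L0 pq e1 e2 e3.
transitivity (L^-1 * ((2 * L * fy + Lx * g + Ly * f) + 2 * fy * (p ^+ 2 + q ^+ 2 - L)
  + p * (2 * Vx + (fy * g + f * gy)) - q * (2 * (Ly - Vy) + (fx * g + f * fy)))); first by field.
by rewrite e1 e2 e3 pq subrr; ring.
Qed.

Variables (L f g V : E -> R).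
Hypotheses (Ls : csm L) (fs : csm f) (gs : csm g) (Vs : csm V).
Hypotheses (Lp : Z2_periodic L) (fp : Z2_periodic f) (gp : Z2_periodic g) (Vp : Z2_periodic V).
Hypothesis Lpos : forall x, 0 < L x.
Hypothesis curl : forall x, partial 0 g x = partial 1 f x.
Hypothesis div : forall x, 2 * L x * partial 1 f x + partial 0 L x * g x + partial 1 L x * f x = 0.
Hypothesis dV : forall x, 2 * partial 0 V x + (partial 1 f x * g x + f x * partial 1 g x) = 0.
Hypothesis dU : forall x,
  2 * (partial 1 L x - partial 1 V x) + (partial 0 f x * g x + f x * partial 0 g x) = 0.

(** This is V - U - (f^2 - g^2) / 2 with U written as L - V. *)
Definition potential : E -> R := fun x => 2 * V x - L x - 2^-1 * (f x ^+ 2 - g x ^+ 2).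
Definition field_strength : E -> R := fun x => - (2^-1 * (partial 0 f x + partial 1 g x)).

Let potentialE : potential = (cst 2 \* V) \+ ((cst (-1) \* L) \+ (cst (- 2^-1) \* ((f \* f) \+ (cst (-1) \* (g \* g))))).
Proof. by apply/funext => x; rewrite /potential /=; ring. Qed.

Let c2 := @csm_cst R 2.
Let cN := @csm_cst R (-1).
Let ch := @csm_cst R (- 2^-1).
Let ff := csmM fs fs.
Let gg := csmM cN (csmM gs gs).
Let s1 := csmM c2 Vs.
Let s2 := csmM cN Ls.
Let s3 := csmM ch (csmD ff gg).

Lemma csm_potential : csm potential.
Proof. by rewrite potentialE; exact: csmD s1 (csmD s2 s3). Qed.

Lemma partial_potential i x : partial i potential x =
  2 * partial i V x - partial i L x - (f x * partial i f x - g x * partial i g x).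
Proof.
rewrite potentialE (partialD i s1 (csmD s2 s3)) (partialD i s2 s3).
rewrite (partialM i c2 Vs) (partialM i cN Ls) (partialM i ch (csmD ff gg)) (partialD i ff gg).
rewrite (partialM i fs fs) (partialM i cN (csmM gs gs)) (partialM i gs gs) !partial_cst /=.
by move: (partial i V x) (partial i L x) (partial i f x) (partial i g x) => *; field.
Qed.

Lemma field_strength_periodic : Z2_periodic field_strength.
Proof. by move=> i x; rewrite /field_strength (partial_periodic 0 fp) (partial_periodic 1 gp). Qed.

Notation metric := (fun x => (L x)%:M).
Notation F := (quadratic_integral f g potential).

Lemma bracket_vanishes x p : hamiltonian metric x p = 2^-1 ->
  mg_bracket field_strength F (hamiltonian metric) x p = 0.
Proof.
have L0 y : L y != 0 by rewrite gt_eqF.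
rewrite hamiltonian_scalar => H.
have pq : p 0 0 ^+ 2 + p 0 1 ^+ 2 = L x.
  have h2 : 2^-1 != 0 :> R by rewrite invr_eq0 pnatr_eq0.
  have : (L x)^-1 * (p 0 0 ^+ 2 + p 0 1 ^+ 2) = 1 by apply: (mulfI h2); rewrite mulr1.
  by move=> h; rewrite -[RHS]mulr1 -h mulVKf.
rewrite /mg_bracket sum_ord2 !partial_p_hamiltonian_scalar !partial_x_hamiltonian_scalar //.
rewrite !partial_p0_quadratic !partial_p1_quadratic.
rewrite !(partial_x_quadratic fs gs csm_potential) !partial_potential pq curl.
rewrite /field_strength.
have e3 := dU x; rewrite curl in e3.
exact: bracket_algebra (L0 x) pq (div x) (dV x) e3.
Qed.

Lemma quadratic_integral_in_momenta : quadratic_in_momenta F.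
Proof.
exists (fun _ => \matrix_(i, j) (if i == j then (if i == 0 then 1 else -1) else 0)).
exists (fun x => \row_i (if i == 0 then 2 * g x else 2 * f x)), potential; split.
- split=> [i x|i x|i x] //; first by rewrite gp fp.
  by rewrite /potential Vp Lp fp gp.
- split=> [i j|i|]; last exact/csm_smooth/csm_potential.
    rewrite (_ : entry _ i j = cst (if i == j then (if i == 0 then 1 else -1) else 0)).
      exact/csm_smooth/csm_cst.
    by apply/funext => x; rewrite /entry mxE.
  apply: csm_smooth; rewrite (_ : component _ i = cst 2 \* (if i == 0 then g else f)).
    by apply: csmM => //; case: (i == 0).
  by apply/funext => x; rewrite /component mxE /=; case: (i == 0).
- by move=> x; apply/matrixP => i j; rewrite !mxE eq_sym; case: eqP => // ->.
- exists 0; apply/eqP => /matrixP /(_ 0 0); rewrite !mxE /= => /eqP.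
  by rewrite oner_eq0.
- move=> x p; rewrite !sum_ord2 !mxE /= /quadratic_integral.
  by ring.
Qed.

Lemma level_base_base_point (z : R * R * R) : level_base z = base_point z.1.
Proof. by apply/rowP; apply: ord2P; rewrite !mxE /= ?mulr1 ?mulr0 ?addr0 ?add0r. Qed.

Lemma level_momentum_scalar (z : R * R * R) : level_momentum metric z =
  Num.sqrt (L (base_point z.1)) *: \row_(i < 2) (if i == 0 then cos z.2 else sin z.2).
Proof.
rewrite /level_momentum level_base_base_point hamiltonian_scalar !mxE /= cos2Dsin2 mulr1.
rewrite mulrA mulfV ?pnatr_eq0 // mul1r sqrtrV ?invrK //.
exact: ltW.
Qed.

Lemma quadratic_integral_independent : independent_ae_on_level metric F.
Proof.
(* Up to the factor 2 / sqrt L this is the momentum minor of F and H on the level; its term in sin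
   2t has the nonzero coefficient sqrt L. *)
pose h (z : R * R * R) : R := 2 * Num.sqrt (L (base_point z.1)) * cos z.2 * sin z.2
  + g (base_point z.1) * sin z.2 - f (base_point z.1) * cos z.2.
have mG (G : E -> R) : continuous G -> measurable_fun [set: R * R * R] (fun z => G (base_point z.1)).
  move=> Gc; apply: (measurableT_comp (measurable_base_point Gc)); exact: measurable_fst.
have mT (G : R -> R) : continuous G -> measurable_fun [set: R * R * R] (fun z => G z.2).
  move=> Gc; apply: (measurableT_comp (measurable_realfun.continuous_measurable_fun Gc)); exact: measurable_snd.
have hm : measurable_fun [set: R * R * R] h.
  have sL : continuous (fun x => Num.sqrt (L x)).
    by move=> x; apply: continuous_comp; [exact: csm_continuous|exact: sqrt_continuous].
  have ms := mT _ (@continuous_sin R); have mc := mT _ (@continuous_cos R).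
  have m2 := @measurable_cst _ _ (R * R * R)%type R setT 2.
  apply: measurable_realfun.measurable_funB; last first.
    by apply: measurable_realfun.measurable_funM => //; apply: (mG f); exact: csm_continuous.
  apply: measurable_realfun.measurable_funD.
    by do 2 apply: measurable_realfun.measurable_funM => //; apply: measurable_realfun.measurable_funM => //; exact: (mG _ sL).
  by apply: measurable_realfun.measurable_funM => //; apply: (mG g); exact: csm_continuous.
have hc z : countable [set t | h (z, t) = 0].
  have A0 : Num.sqrt (L (base_point z)) != 0 by rewrite gt_eqF // sqrtr_gt0.
  exact: (@countable_trigonometric_zeros R _ (g (base_point z)) (f (base_point z)) A0).
apply: negligibleS (ae_neq0_of_countable_sections hm hc) => z /=; apply: contra_not => hz.
apply: free_of_minor; rewrite !partial_p_hamiltonian_scalar partial_p0_quadratic partial_p1_quadratic.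
rewrite level_base_base_point level_momentum_scalar !mxE /=.
have L0 := Lpos (base_point z.1).
set s := Num.sqrt _; have s0 : 0 < s by rewrite sqrtr_gt0.
rewrite (_ : _ - _ = 2 * s * (L (base_point z.1))^-1 * h z); last by rewrite /h -/s; ring.
by rewrite !mulf_neq0 // ?pnatr_eq0 ?invr_eq0 ?gt_eqF.
Qed.

Lemma quadratic_integral_first_integral : quadratic_first_integral metric field_strength F.
Proof.
split; first exact: quadratic_integral_in_momenta.
  exact: bracket_vanishes.
exact: quadratic_integral_independent.
Qed.

End first_integral.

(** * Assembling the deformed metrics *)

Section existence.
Variable R : realType.
Notation E := 'rV[R]_2.
Notation T := (tfun R).
Notation HT := (hurwitz (tfun R)).
Notation dx := (@tpartial R 0).
Notation dy := (@tpartial R 1).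
Notation Dx := (hlift (@tpartial R 0)).
Notation Dy := (hlift (@tpartial R 1)).

Opaque partial.

Lemma analytic_cst (a : R) : real_analytic (cst a : E -> R).
Proof.
apply: (@analytic_of_bound R _ `|a| 1) => //; first exact: csm_cst.
move=> w x; apply: le_trans (partials_cst w a x) _.
by rewrite expr1n mulr1 ler_peMr // ler1n fact_gt0.
Qed.

Lemma scalar_analytic_torus_metric (Lam : E -> R) : Z2_periodic Lam ->
  (forall x, 0 < Lam x) -> real_analytic Lam -> analytic_torus_metric (fun x => (Lam x)%:M).
Proof.
move=> Lp Lpos La; split; first split.
- by move=> i x; rewrite Lp.
- by move=> x; rewrite tr_scalar_mx.
- move=> x v v0; rewrite !sum_ord2 !mxE /= !mulr0n mulr1n !mul0r addr0 add0r.
  rewrite -!mulrA -mulrDr mulr_gt0 // -!expr2 lt_def addr_ge0 ?sqr_ge0 // andbT.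
  rewrite paddr_eq0 ?sqr_ge0 // !sqrf_eq0; apply: contra v0 => /andP[/eqP v1 /eqP v2].
  by apply/eqP/rowP; apply: ord2P; rewrite mxE.
- move=> i j; case: (eqVneq i j) => [->|ij].
    by rewrite (_ : entry _ j j = Lam) //; apply/funext => x; rewrite /entry mxE eqxx.
  rewrite (_ : entry _ i j = cst 0); first exact: analytic_cst.
  by apply/funext => x; rewrite /entry mxE (negbTE ij).
Qed.

Lemma L_init_periodic : Z2_periodic (L_init R).
Proof. exact: tfun_periodic. Qed.

Lemma L_init_analytic : real_analytic (L_init R).
Proof.
have p0 : 0 < 2 * pi :> R by rewrite mulr_gt0 // pi_gt0.
apply: (analytic_of_bound (C := 6) (tfun_csm _) p0) => w x.
apply: le_trans (L_init_pow w x) _; apply: ler_wpM2r; first by rewrite exprn_ge0 // ltW.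
by rewrite ler_peMr // ler1n fact_gt0.
Qed.

Lemma L_init_Liouville : Liouville (fun x => (L_init R x)%:M).
Proof.
exists id, (fun t => 4 + cos (2 * pi * t)), (fun t => cos (2 * pi * t)); split.
  by exists id; split => // k; apply: csm_smooth; exact: csm_coord.
move=> x i j; rewrite mxE L_initE.
have pc k l : partial k (component id l) x = (k == l)%:R.
  apply: partial_line.
  rewrite (_ : (fun h : R => _) = (fun h : R => x 0 l + h * (k == l)%:R)).
    by apply: is_derive_eq; rewrite /GRing.scale /=; ring.
  by apply/funext => h; rewrite /component line_coord.
rewrite sum_ord2 !pc -[LHS]mulr_natr; congr (_ * _).
by move: i j; apply: ord2P; apply: ord2P; rewrite /= !(mul0r, mulr0, mul1r, addr0, add0r).
Qed.

Lemma scalar_Ck_close k eps (Lam Lam' : E -> R) : 0 < eps ->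
  (forall w x, (size w <= k)%N -> `|partials w Lam' x - partials w Lam x| < eps) ->
  Ck_close k eps (fun x => (Lam x)%:M) (fun x => (Lam' x)%:M).
Proof.
move=> eps0 H w i j x wk.
have e (G : E -> R) : entry (fun x => (G x)%:M) i j = if i == j then G else cst 0.
  by apply/funext => y; rewrite /entry mxE; case: (i == j).
by rewrite !e; case: (i == j); [exact: H|rewrite subrr normr0].
Qed.

Lemma ebound_radius_le (rho rho' a : R) (u : HT) : 0 <= rho -> rho <= rho' ->
  ebound rho a u -> ebound rho' a u.
Proof.
move=> rho0 rr ub; have a0 := ebound_ge0 ub; move=> m w x; apply: le_trans (ub m w x) _.
have h n : 0 <= rho ^+ n <= rho' ^+ n.
  by rewrite exprn_ge0 //= lerXn2r // nnegrE // (le_trans rho0).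
have /andP[h1 h2] := h (size w); have /andP[h3 h4] := h m.
by apply: ler_pM; rewrite ?mulr_ge0 ?ler0n // ?ler_wpM2l ?mulr_ge0 ?ler0n.
Qed.

Lemma eboundD (rho a b : R) (u v : HT) : ebound rho a u -> ebound rho b v -> ebound rho (a + b) (u + v).
Proof.
move=> ub vb m w x; rewrite -[(u + v) m]/(u m + v m) tvalD partialsD; [|exact: tfun_csm..].
by rewrite /= !mulrDl; apply: le_trans (ler_normD _ _) _; apply: lerD; [exact: ub|exact: vb].
Qed.

Lemma double_difference (a b c d e h : R) : b + b = a + a + (c * d + e * h) ->
  2 * (a - b) + (c * d + e * h) = 0.
Proof. by move: (c * d) (e * h) => p q H; lra. Qed.

Lemma ev_analytic s rho a b (u : HT) : 0 < rho -> `|s| * rho <= 4^-1 -> ebound rho a u ->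
  real_analytic (fun x => b * ev s u x).
Proof.
move=> rho0 srho ub; have us := ev_csm (ltW rho0) srho ub.
apply: (analytic_of_bound (C := `|b| * 2 * a) (csmZ b us) rho0) => w x.
rewrite (partialsZ w b us) normrM -!mulrA ler_wpM2l //.
by have := ev_bound (ltW rho0) srho ub w x; rewrite -!mulrA.
Qed.

Section deformed.
Variables (L f g V : HT) (rho s : R).
Hypothesis rho0 : 0 < rho.
Hypotheses (Lb : ebound rho 6 L) (fb : ebound rho 6 f) (gb : ebound rho 6 g) (Vb : ebound rho 6 V).
Hypothesis SL : hshift L = Dx f + Dy g.
Hypothesis curl : Dx g = Dy f.
Hypothesis div : L * Dy f *+ 2 + Dx L * g + Dy L * f = 0.
Hypothesis dV : Dx V *+ 2 + Dy (f * g) = 0.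
Hypothesis dU : Dy (L - V) *+ 2 + Dx (f * g) = 0.
Hypothesis srho : `|s| * (2 * rho) <= 4^-1.

Let rho2 : 0 <= 2 * rho. Proof. by rewrite mulr_ge0 // ltW. Qed.
Let rr : rho <= 2 * rho. Proof. by rewrite ler_peMl ?ler1n // ltW. Qed.

Let srho1 : `|s| * rho <= 4^-1.
Proof. by apply: le_trans srho; rewrite ler_wpM2l. Qed.

(** Streams and their derivatives get the common constant 2 rho, so that products of both kinds can
    be evaluated. *)
Let wide u : ebound rho 6 u -> ebound (2 * rho) 6 u := @ebound_radius_le rho (2 * rho) 6 u (ltW rho0) rr.
Let lift i u : ebound rho 6 u -> ebound (2 * rho) (6 * rho) (hlift (@tpartial R i) u) :=
  @ebound_lift R rho 6 u i (ler0n R 6) (ltW rho0).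
Let evp i u : ebound rho 6 u -> partial i (ev s u) = ev s (hlift (@tpartial R i) u) :=
  fun ub => ev_partial (ltW rho0) srho1 ub i.
Let evM u v a b := @evaluatesM R s (2 * rho) a b u v rho2 srho.
Let ev1 u a := @evaluates_bounded R s (2 * rho) a u rho2 srho.
Let evDD := @evaluatesD R s.
Let DM i := @hliftM T (@tpartial R i) (@tpartialD R i) (@tpartialM R i).
Let DD i := @hliftD T (@tpartial R i) (@tpartialD R i).

Lemma deformed_curl x : partial 0 (ev s g) x = partial 1 (ev s f) x.
Proof. by rewrite (evp 0 gb) (evp 1 fb) curl. Qed.

(** The formal identity is evaluated summand by summand: [evaluatesM] and [evaluatesD] compute the
    value of its left side, and [evaluates_zero] says that this value is 0. *)
Lemma deformed_divergence x : 2 * ev s L x * partial 1 (ev s f) x +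
  partial 0 (ev s L) x * ev s g x + partial 1 (ev s L) x * ev s f x = 0.
Proof.
rewrite (evp 1 fb) (evp 0 Lb) (evp 1 Lb).
have m1 := evM (wide Lb) (lift 1 fb) x; have m2 := evM (lift 0 Lb) (wide gb) x.
have m3 := evM (lift 1 Lb) (wide fb) x.
have := evDD (evDD (evDD m1 m1) m2) m3; rewrite -mulr2n div => /evaluates_zero <-.
move: (ev s L x) (ev s (Dy f) x) (ev s (Dx L) x) (ev s g x) (ev s (Dy L) x) (ev s f x) => *; ring.
Qed.

Lemma deformed_V x : 2 * partial 0 (ev s V) x +
  (partial 1 (ev s f) x * ev s g x + ev s f x * partial 1 (ev s g) x) = 0.
Proof.
rewrite (evp 0 Vb) (evp 1 fb) (evp 1 gb).
have m1 := ev1 (lift 0 Vb) x; have m2 := evM (lift 1 fb) (wide gb) x.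
have m3 := evM (wide fb) (lift 1 gb) x.
have := evDD (evDD m1 m1) (evDD m2 m3); rewrite -mulr2n -DM dV => /evaluates_zero <-.
move: (ev s (Dx V) x) (ev s (Dy f) x) (ev s g x) (ev s f x) (ev s (Dy g) x) => *; ring.
Qed.

Lemma deformed_U x : 2 * (partial 1 (ev s L) x - partial 1 (ev s V) x) +
  (partial 0 (ev s f) x * ev s g x + ev s f x * partial 0 (ev s g) x) = 0.
Proof.
rewrite (evp 1 Lb) (evp 1 Vb) (evp 0 fb) (evp 0 gb).
have m1 := ev1 (lift 1 Lb) x; have m2 := evM (lift 0 fb) (wide gb) x.
have m3 := evM (wide fb) (lift 0 gb) x; have m4 := ev1 (lift 1 Vb) x.
(* The identity is rearranged without subtraction, as [evaluates] is only shown to respect sums and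
   products; both sides are then evaluated separately. *)
have E1 : Dy L + Dy L + (Dx f * g + f * Dx g) = Dy V + Dy V.
  have DL : Dy L = Dy (L - V) + Dy V by rewrite -DD subrK.
  rewrite -DM DL -[RHS]add0r -dU; move: (Dy (L - V)) (Dy V) (Dx (f * g)) => a b c; ring.
have [_ e1] := evDD (evDD m1 m1) (evDD m2 m3); have [_ e2] := evDD m4 m4.
rewrite E1 e2 in e1.
move: e1; move: (ev s (Dy L) x) (ev s (Dy V) x) (ev s (Dx f) x) (ev s g x) (ev s f x) (ev s (Dx g) x).
exact: double_difference.
Qed.

(** The field is - L_s / 2. As a single series it is within reach of the bounds for analyticity and
    of Taylor expansion in s. *)
Lemma deformed_field_strength : field_strength (ev s f) (ev s g) =
  (fun x => - 2^-1 * ev s (hshift L) x).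
Proof.
apply/funext => x; rewrite /field_strength (evp 0 fb) (evp 1 gb) SL.
by have [_ ->] := evDD (ev1 (lift 0 fb) x) (ev1 (lift 1 gb) x); rewrite mulNr.
Qed.

Lemma hshift_bound : ebound (2 * rho) (6 * rho + 6 * rho) (hshift L).
Proof. by rewrite SL; apply: eboundD; exact: lift. Qed.

End deformed.
(** L_s = s L_2 + O(s^2), because f and g start at 0; the first term dominates at a point where L_2
    is nonzero. *)
Lemma shift_nonzero (L f g : HT) (rho : R) (x : E) : 0 < rho ->
  ebound rho 6 f -> ebound rho 6 g ->
  f 0%N = 0 -> g 0%N = 0 -> hshift L = Dx f + Dy g -> tval (L 2%N) x != 0 ->
  \forall s \near (0 : R)^'+, ev s (hshift L) x != 0.
Proof.
move=> rho0 fb gb f0 g0 SL L2; have r2 : 0 < 2 * rho by rewrite mulr_gt0.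
near=> s.
have [s0 srho] : 0 < s /\ `|s| * (2 * rho) <= 4^-1 by near: s; exact: near_right_radius.
have sm : `|2 * ((6 * rho + 6 * rho) * (2 * rho) ^+ 2)| * s < `|L 2%N x|.
  by near: s; apply: near_right_small; rewrite normr_gt0.
have := ev_taylor (ltW r2) srho (hshift_bound rho0 fb gb SL) [::] x 2.
have W0 : hshift L 0%N = 0.
  by rewrite SL -[LHS]/(dx (f 0%N) + dy (g 0%N)) f0 g0 !tpartial0 addr0.
rewrite (_ : \sum_(n < 2) _ = s * L 2%N x); last first.
  rewrite sum_ord2 -[LHS]/(s ^+ 0 / 0`!%:R * hshift L 0%N x + s ^+ 1 / 1`!%:R * L 2%N x) W0.
  by rewrite mulr0 add0r divr1 expr1.
rewrite -[partials [::] _ x]/(ev s (hshift L) x) [size _]/= fact0 expr0 !mulr1 => H.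
apply/eqP => e0; move: H; rewrite e0 sub0r normrN normrM (gtr0_norm s0) leNgt => /negP; apply.
rewrite (_ : 2 * _ = 2 * ((6 * rho + 6 * rho) * (2 * rho) ^+ 2) * s * s); last by ring.
rewrite mulrC ltr_pM2l //; apply: le_lt_trans sm.
by rewrite ler_pM2r // ler_norm.
Unshelve. all: by end_near. Qed.

End existence.

Theorem theorem1 (R : realType) :
  exists g0 : 'rV[R]_2 -> 'M[R]_2,
    [/\ analytic_torus_metric g0, Liouville g0 &
        forall (k : nat) (eps : R), 0 < eps ->
          exists g : 'rV[R]_2 -> 'M[R]_2,
            [/\ analytic_torus_metric g, ~ Liouville g, Ck_close k eps g0 g &
                exists Omega : 'rV[R]_2 -> R,
                  [/\ Z2_periodic Omega, real_analytic Omega,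
                      exists x, Omega x != 0 &
                      exists F : 'rV[R]_2 -> 'rV[R]_2 -> R,
                        quadratic_first_integral g Omega F]]].
Proof.
exists (fun x => (L_init R x)%:M); split.
- apply: scalar_analytic_torus_metric; [exact: L_init_periodic| |exact: L_init_analytic].
  by move=> x; apply: lt_le_trans (L_init_ge2 x).
- exact: L_init_Liouville.
move=> k eps eps0.
have [L [f [g [V [rho [rho0 [Lb fb gb Vb] [L0 f0 g0 SL] [curl div dV dU] kap]]]]]] :=
  deformation_streams R.
have r2 : 0 < 2 * rho by rewrite mulr_gt0.
have L1 : L 1%N = 0.
  by rewrite -[L 1%N]/(hshift L 0%N) SL -[LHS]/(tpartial 0 (f 0%N) + tpartial 1 (g 0%N)) f0 g0
    !tpartial0 addr0.
(* A mixed derivative of L_2 is nonzero at [quarter], so L_2 is not identically 0. *)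
have [x L2x] : exists x, tval (L 2%N) x != 0.
  apply: contrapT => H; move/eqP: kap; apply.
  have -> : L 2%N = 0.
    by apply: tfun_ext => x; apply/eqP/negPn/negP => n0; apply: H; exists x.
  by rewrite !tpartial0.
(* Dominates the closeness constants of all orders up to k at once. *)
pose M : R := \sum_(j < k.+1) 12 * j`!%:R * rho ^+ j * rho ^+ 2.
near (0 : R)^'+ => s.
have [s0 srho] : 0 < s /\ `|s| * (2 * rho) <= 4^-1 by near: s; exact: near_right_radius.
have srho1 : `|s| * rho <= 4^-1.
  by apply: le_trans srho; rewrite ler_wpM2l // ler_peMl ?ler1n // ltW.
have s1 : s < 1 by near: s; exact: nbhs_right_lt.
have small : `|M| * s < eps by near: s; exact: near_right_small.
have nL : ~ Liouville (fun x => (ev s L x)%:M) by near: s; exact: (deformed_not_Liouville rho0 Lb L0 L1 kap).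
have W0 : ev s (hshift L) x != 0 by near: s; exact: (shift_nonzero rho0 fb gb f0 g0 SL L2x).
have Ls := ev_csm (ltW rho0) srho1 Lb; have fs := ev_csm (ltW rho0) srho1 fb.
have gs := ev_csm (ltW rho0) srho1 gb; have Vs := ev_csm (ltW rho0) srho1 Vb.
have Lpos y : 0 < ev s L y.
  by apply: lt_trans ltr01 _; exact: (deformed_factor_gt1 rho0 Lb L0 L1 y s0 srho1).
exists (fun x => (ev s L x)%:M); split => //.
- apply: scalar_analytic_torus_metric => //; first exact: ev_periodic.
  by have := ev_analytic 1 rho0 srho1 Lb; under eq_fun do rewrite mul1r.
- apply: scalar_Ck_close => // w y wk.
  apply: le_lt_trans small; apply: le_trans (deformed_factor_close rho0 Lb L0 L1 w y s0 srho1) _.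
  have t0 j : 0 <= 12 * j`!%:R * rho ^+ j * rho ^+ 2 :> R.
    by rewrite !mulr_ge0 ?ler0n ?exprn_ge0 // ltW.
  rewrite [s ^+ 2]expr2 mulrA ler_pM2r //.
  apply: (@le_trans _ _ (12 * (size w)`!%:R * rho ^+ size w * rho ^+ 2)).
    by rewrite -[leRHS]mulr1 ler_wpM2l // ltW.
  apply: le_trans (ler_norm _); rewrite /M (bigD1 (inord (size w))) //= inordK ?ltnS //.
  by rewrite lerDl sumr_ge0.
exists (field_strength (ev s f) (ev s g)); split.
- by apply: field_strength_periodic; exact: ev_periodic.
- rewrite (deformed_field_strength rho0 fb gb SL srho).
  exact: ev_analytic r2 srho (hshift_bound rho0 fb gb SL).
- exists x; rewrite (deformed_field_strength rho0 fb gb SL srho).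
  by rewrite mulf_neq0 // oppr_eq0 invr_eq0 pnatr_eq0.
exists (quadratic_integral (ev s f) (ev s g) (potential (ev s L) (ev s f) (ev s g) (ev s V))).
apply: quadratic_integral_first_integral => //; try exact: ev_periodic.
- exact: deformed_curl rho0 fb gb curl srho.
- exact: deformed_divergence rho0 Lb fb gb div srho.
- exact: deformed_V rho0 fb gb Vb dV srho.
- exact: deformed_U rho0 Lb fb gb Vb dU srho.
Unshelve. all: by end_near. Qed.
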